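(* Assume that $\mathbf{E}\ln\rho_0<0$ and that there exists a unique $\kappa>0$ such that $\mathbf{E}[\rho_0^{\kappa}]=1$ and $\mathbf{E}[\rho_0^{\kappa}\ln^+\rho_0]<\infty$. Let $t^\omega_{\mathrm{mix}}(n)$ be the mixing time of the lazy random walk in random environment $(Y^n_k)_{k\in\mathbb{N}_0}$ on $\{0,\dots,n\}$. Then for $\mathbf{P}$-almost every environment $\omega$: (a) if $0<\kappa\le 1$, then $\displaystyle\lim_{n\to\infty}\frac{\ln t^\omega_{\mathrm{mix}}(n)}{\ln n}=\frac1\kappa$; (b) if $\kappa>1$, then $\displaystyle\lim_{n\to\infty}\frac{t^\omega_{\mathrm{mix}}(n)}{n}=2\,\mathbb{E}T_1$.
   Context: Environment: $\omega=(\omega_k)_{k\in\mathbb{Z}}$ is a family of i.i.d. random variables with values in $(0,1)$; $\mathbf{P}$ is its law, $\mathbf{E}$ the corresponding expectation, and $\rho_i:=(1-\omega_i)/\omega_i$. Random walk in random environment on $\mathbb{Z}$: under $P_\omega$, $(X_k)_{k\in\mathbb{N}_0}$ is the Markov chain on $\mathbb{Z}$ with $X_0=0$ which jumps from $i$ to $i+1$ with probability $\omega_i$ and from $i$ to $i-1$ with probability $1-\omega_i$. $T_1:=\min\{l\in\mathbb{N}_0:X_l=1\}$, and $\mathbb{E}$ is expectation under the annealed law $\mathbb{P}=\mathbf{P}\times P_\omega$, so $\mathbb{E}T_1=\mathbf{E}[E_\omega T_1]$. Lazy reflected walk: for $n\in\mathbb{N}$ put $\omega^n_0:=1$, $\omega^n_k:=\omega_k$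 for $1\le k\le n-1$, $\omega^n_n:=0$. Under $P_{\omega^n}^z$, $(Y^n_k)_{k\in\mathbb{N}_0}$ is the Markov chain on $\{0,\dots,n\}$ started at $z$ which from $i$ jumps to $i+1$ with probability $\omega^n_i/2$, stays at $i$ with probability $1/2$, and jumps to $i-1$ with probability $(1-\omega^n_i)/2$. Let $\pi_{\omega^n}$ be its stationary distribution. Mixing time: $t^\omega_{\mathrm{mix}}(n):=\min\{l\in\mathbb{N}: d_n(l)\le \tfrac14\}$, where $d_n(l):=\max_{x\in\{0,\dots,n\}}\|P^x_{\omega^n}(Y^n_l\in\cdot)-\pi_{\omega^n}\|_{TV}$ (total variation distance). *)

(* Defs.v *)
From HB Require Import structures.
From mathcomp Require Import all_boot all_order all_algebra finmap.
From mathcomp Require Import all_classical all_reals all_analysis.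

Set Implicit Arguments.
Unset Strict Implicit.
Unset Printing Implicit Defensive.

Import Order.TTheory GRing.Theory Num.Theory.
Import numFieldNormedType.Exports.

Local Open Scope classical_set_scope.
Local Open Scope ring_scope.

(* Both clauses only speak of measurable sets: the value of a measure on a
   non-measurable set is unspecified. *)
Definition iid (R : realType) (d : measure_display) (T : measurableType d)
    (P : probability T R) (I : choiceType) (xi : I -> {RV P >-> R}) : Prop :=
  (forall (J : {fset I}) (B : I -> set R),
      (forall i, measurable (B i)) ->
      P (\bigcap_(i in [set` J]) (xi i @^-1` B i)) =
      (\prod_(i <- J) P (xi i @^-1` B i))%E) /\
  (forall (i j : I) (B : set R), measurable B ->
      P (xi i @^-1` B) = P (xi j @^-1` B)).

(* The finite-dimensional distributions determine the Markov chain with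
   transition probabilities K started at z, since S is countable. *)
Definition markov_chain (R : realType) (d : measure_display)
    (T : measurableType d) (Q : probability T R) (S : countType)
    (K : S -> S -> R) (z : S) (X : nat -> T -> S) : Prop :=
  (forall k x, measurable (X k @^-1` [set x])) /\
  (forall (m : nat) (x : nat -> S),
      Q (\bigcap_(k in `I_m.+1) (X k @^-1` [set x k])) =
      ((x 0%N == z)%:R * \prod_(k < m) K (x k) (x k.+1))%:E).

Definition walk_kernel (R : realType) (w : int -> R) (i j : int) : R :=
  if j == i + 1 then w i else if j == i - 1 then 1 - w i else 0.

(* The infimum of the empty set is +oo: a path that never hits a has an
   infinite hitting time. *)
Definition hitting_time (R : realType) (S : Type) (x : nat -> S) (a : S) :
    \bar R :=
  ereal_inf [set l%:R%:E | l in [set l : nat | x l = a]].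

(* Only used for 0 < n and k <= n. *)
Definition reflected_env (R : realType) (w : int -> R) (n k : nat) : R :=
  if k == 0%N then 1 else if k == n then 0 else w k%:Z.

Definition lazy_reflected_kernel (R : realType) (w : int -> R) (n : nat)
    (i j : 'I_n.+1) : R :=
  if j == i.+1 :> nat then reflected_env w n i / 2
  else if j == i then 1 / 2
  else if i == j.+1 :> nat then (1 - reflected_env w n i) / 2
  else 0.

Definition is_stationary (R : realType) (S : finType) (K : S -> S -> R)
    (p : {ffun S -> R}) : Prop :=
  [/\ forall x, 0 <= p x, \sum_x p x = 1 &
      forall y, \sum_x p x * K x y = p y].

Definition stationary_distribution (R : realType) (S : finType)
    (K : S -> S -> R) : {ffun S -> R} :=
  xget [ffun=> 0] [set p | is_stationary K p].

Definition law (R : realType) (d : measure_display) (T : measurableType d)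
    (Q : probability T R) (S : Type) (f : T -> S) (x : S) : R :=
  fine (Q (f @^-1` [set x])).

Definition total_variation_distance (R : realType) (S : finType)
    (p q : S -> R) : R :=
  \big[Num.max/0]_(A : {set S}) `|\sum_(x in A) p x - \sum_(x in A) q x|.

Definition distance_to_stationarity (R : realType) (d : measure_display)
    (T : measurableType d) (S : finType) (K : S -> S -> R)
    (Q : S -> probability T R) (Y : nat -> T -> S) (l : nat) : R :=
  \big[Num.max/0]_(x : S)
    total_variation_distance (law (Q x) (Y l)) (stationary_distribution K).

Definition nat_min (A : set nat) : nat :=
  xget 0%N [set l | A l /\ forall m, A m -> (l <= m)%N].

Definition mixing_time (R : realType) (d : measure_display)
    (T : measurableType d) (S : finType) (K : S -> S -> R)
    (Q : S -> probability T R) (Y : nat -> T -> S) : nat :=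
  nat_min [set l | (0 < l)%N /\ distance_to_stationarity K Q Y l <= 1 / 4].

(* Main.v *)
Require Import Defs.
From HB Require Import structures.
From mathcomp Require Import all_boot all_order all_algebra finmap.
From mathcomp Require Import all_classical all_reals all_analysis.
From mathcomp Require Import measurable_realfun.
From mathcomp Require Import ring lra zify.

(** Write [rho k = (1 - w k) / w k].  Two copies of the reflected walk driven by
    complementary lazy coins cannot cross before the lower one has reached [n],
    so the distance to stationarity is at most the probability of not having
    crossed [0, n], and the mixing time is governed by the crossing time of
    [0, n].  Its mean is the sum of the crossing times [e j] of the edges, with
    [e j.+1 = 2 (1 + rho j.+1) + rho j.+1 * e j].

    If [kappa > 1], the moments of [rho] of some order [p > 1] are smaller than 1;
    then a law of large numbers holds for the means and the variances are
    [o(n^2)], so by Chebyshev the walk crosses at time [2 (E T_1) n (1 + o(1))].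
    As the stationary mass sits within [o(n)] of [n], the walk cannot be mixed
    before that time.

    If [kappa <= 1], the moment of order [s] is smaller than 1 for [s < kappa],
    so the mean crossing time is [o(n^b)] for [b > 1 / kappa].  Conversely the
    moment of order [a > kappa] is larger than 1, which forces blocks of [rho]
    with product at least [c] and probability at least [c^-a]; concatenating
    them shows that [0, n] contains a stretch with product at least [n^b] for
    [b < 1 / kappa], and such a valley holds the walk for a time of this order. *)

Set Implicit Arguments.
Unset Strict Implicit.
Unset Printing Implicit Defensive.
Import Order.TTheory GRing.Theory Num.Theory.
Import numFieldNormedType.Exports.
Local Open Scope classical_set_scope.
Local Open Scope ring_scope.

(** * Mixing of the lazy reflected walk in a fixed environment *)

(** The walk enters only through the averaging operator [step]: probabilities are iterates of [step]
    on functions on {0,...,n}, so coupling, optional stopping and escape become inductions on the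
    number of steps, and no coupled or stopped process is built. For kappa > 1 the obstacle is that
    kappa may be less than 2, so that crossing times need not have bounded second moments. The
    variance is therefore taken in a fixed environment and summed through its moment of order p/2 <=
    1, where powers are subadditive; the fluctuation of the means is a martingale controlled in L^p
    with 1 < p <= 2. Since the walk is reflected at 0, the means [cross_mean j] are not stationary
    in [j]. Their moments stay bounded because each step of the recursion multiplies by an
    independent factor whose moment is smaller than 1. For the valleys the moment of order a may be
    infinite; only its being larger than 1 is used, through the tails of products over blocks. The
    almost sure statements come from summable expectations, often along a subsequence with
    monotonicity filling the gaps. *)

Section ReflectedChain.
Variables (R : realType) (w : int -> R) (n : nat).
Hypothesis w01 : forall k, 0 < w k < 1.
Hypothesis n_gt0 : (0 < n)%N.

Definition odds (k : int) : R := (1 - w k) / w k.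

Let q := reflected_env w n.

Lemma odds_gt0 k : 0 < odds k.
Proof. by rewrite /odds; have /andP[? ?] := w01 k; rewrite divr_gt0// subr_gt0. Qed.

Lemma reflected_env_ge0 i : 0 <= q i.
Proof.
rewrite /q /reflected_env; case: eqP => // _; case: eqP => // _.
by have /andP[/ltW] := w01 i.
Qed.

Lemma reflected_env_le1 i : q i <= 1.
Proof.
rewrite /q /reflected_env; case: eqP => // _; case: eqP => // _.
by have /andP[_ /ltW] := w01 i.
Qed.

Lemma reflected_env0 : q 0 = 1. Proof. by []. Qed.

Lemma reflected_envn : q n = 0.
Proof. by rewrite /q /reflected_env; case: eqP n_gt0 => [->//|_ _]; rewrite eqxx. Qed.

Lemma reflected_env_mid i : (0 < i < n)%N -> q i = w i%:Z.
Proof.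
move=> /andP[i0 iltn]; rewrite /q /reflected_env.
by rewrite gtn_eqF// ltn_eqF.
Qed.

Lemma odds_reflected_env i : (0 < i < n)%N -> q i * odds i%:Z = 1 - q i.
Proof.
move=> h; rewrite reflected_env_mid// /odds; have /andP[w0 _] := w01 i%:Z.
by rewrite mulrCA divff ?mulr1// gt_eqF.
Qed.

(** Functions live on [nat] instead of the states: the spurious values [f 0.-1] at 0 and [f n.+1] at
    [n] carry the weights [1 - q 0] and [q n], both 0. *)
Definition step (f : nat -> R) (i : nat) : R :=
  (f i + q i * f i.+1 + (1 - q i) * f i.-1) / 2.

Lemma step_le (f g : nat -> R) i : (i <= n)%N ->
  (forall j, (j <= n)%N -> f j <= g j) -> step f i <= step g i.
Proof.
move=> lein fg; rewrite /step ler_pM2r ?invr_gt0//.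
have q0 := reflected_env_ge0 i; have q1 := reflected_env_le1 i.
apply: lerD; [apply: lerD; [exact: fg|]|].
  move: lein; rewrite leq_eqVlt => /predU1P[->|iltn].
    by rewrite reflected_envn !mul0r.
  by apply: ler_wpM2l => //; exact: fg.
by apply: ler_wpM2l; [rewrite subr_ge0|apply: fg; rewrite (leq_trans (leq_pred _))].
Qed.

Lemma step_cst c i : step (fun=> c) i = c.
Proof. by rewrite /step; field. Qed.

Lemma step_ext (f g : nat -> R) i : (i <= n)%N ->
  (forall j, (j <= n)%N -> f j = g j) -> step f i = step g i.
Proof.
by move=> lein fg; apply/eqP; rewrite eq_le !step_le// => j /fg ->.
Qed.

Lemma stepZ c (f : nat -> R) i : step (fun j => c * f j) i = c * step f i.
Proof. by rewrite /step; field. Qed.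

Lemma sum_ord_eq (F : nat -> R) m :
  \sum_(j < n.+1) (j == m :> nat)%:R * F j = if (m <= n)%N then F m else 0.
Proof.
case: leqP => [mn|mn].
  have mn' : (m < n.+1)%N by [].
  rewrite (bigD1 (Ordinal mn'))//= eqxx mul1r big1 ?addr0// => j /negPf.
  by rewrite -val_eqE /= => ->; rewrite mul0r.
by apply: big1 => j _; rewrite ltn_eqF ?mul0r//; apply: leq_ltn_trans mn; rewrite -ltnS.
Qed.

Let K := @lazy_reflected_kernel R w n.

Lemma sum_lazy_reflected_kernel (F : nat -> R) (i : 'I_n.+1) :
  \sum_j K i j * F j = step F i.
Proof.
have E (j : 'I_n.+1) : K i j * F j =
    (j == i.+1 :> nat)%:R * (q i / 2 * F j) + (j == i :> nat)%:R * (1 / 2 * F j)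
    + (if i == 0%N :> nat then 0 else (j == i.-1 :> nat)%:R * ((1 - q i) / 2 * F j)).
  rewrite /K /lazy_reflected_kernel -/q -[j == i](inj_eq val_inj).
  case: (eqVneq (j : nat) i.+1) => [->|ji].
    rewrite gtn_eqF//= ?mul1r; case: eqP => [_|]; first by rewrite mul0r !addr0.
    by rewrite gtn_eqF ?mul0r ?addr0// ltnS leq_pred.
  rewrite mul0r add0r; case: (eqVneq (j : nat) i) => [->|ji'].
    rewrite !mul1r; case: eqP => [_|/eqP i0]; first by rewrite addr0.
    by rewrite gtn_eqF ?mul0r ?addr0// prednK ?lt0n.
  rewrite mul0r add0r; case: (eqVneq (i : nat) 0%N) => [->|i0].
    by rewrite mul0r.
  rewrite -[(i : nat) in LHS]prednK ?lt0n// eqSS eq_sym.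
  by rewrite prednK ?lt0n//; case: eqP => _; rewrite ?mul1r ?mul0r.
under eq_bigr do rewrite E.
rewrite big_split big_split/= (sum_ord_eq (fun j => q i / 2 * F j)).
rewrite (sum_ord_eq (fun j => 1 / 2 * F j)).
rewrite (_ : (if (i.+1 <= n)%N then _ else 0) = q i / 2 * F i.+1); last first.
  case: leqP => // h; suff -> : (i : nat) = n by rewrite reflected_envn !mul0r.
  by apply/eqP; rewrite eqn_leq h -ltnS ltn_ord.
rewrite -ltnS ltn_ord.
have -> : \sum_(j < n.+1) (if i == 0%N :> nat then 0 else
    (j == i.-1 :> nat)%:R * ((1 - q i) / 2 * F j)) = (1 - q i) / 2 * F i.-1.
  case: eqP => [->|_]; first by rewrite big1// reflected_env0 subrr !mul0r.
  by rewrite (sum_ord_eq (fun j => (1 - q i) / 2 * F j)) (leq_trans (leq_pred _))// -ltnS.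
by rewrite /step; field.
Qed.

(* The probability that the walk started at i has not reached n by time l. *)
Fixpoint surv (l i : nat) : R :=
  if l is l'.+1 then (if (i < n)%N then step (surv l') i else 0)
  else (i < n)%:R.

Lemma surv_n l : surv l n = 0.
Proof. by case: l => [|l]/=; rewrite ltnn. Qed.

Lemma surv_ge0 l i : (i <= n)%N -> 0 <= surv l i.
Proof.
elim: l i => [|l IH] i lein /=; first by rewrite ler0n.
by case: ifP => // _; rewrite -(step_cst 0 i) step_le.
Qed.

(* With probability 1/2 only the left walker moves and with probability 1/2
   only the right one does, so that they cannot cross each other. *)
Lemma step_sub (f : nat -> R) i j : step f i - step f j =
  (q i * (f i.+1 - f j) + (1 - q i) * (f i.-1 - f j)
   + (q j * (f i - f j.+1) + (1 - q j) * (f i - f j.-1))) / 2.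
Proof. by rewrite /step; field. Qed.

(** Induction on [l]: equal walkers give difference 0; otherwise each of the four moves in
    [step_sub] keeps the walkers weakly ordered, so the induction hypothesis applies with the new
    lower position. *)
Lemma coupling_bound (f : nat -> R) l i j : (forall k, 0 <= f k <= 1) ->
  (i <= j <= n)%N -> `|iter l step f i - iter l step f j| <= surv l i.
Proof.
move=> f01; elim: l i j => [|l IH] i j /andP[]; rewrite leq_eqVlt.
- case/predU1P => [-> jn|ij jn] /=; first by rewrite subrr normr0 ler0n.
  rewrite (leq_trans ij jn) -[true%:R]/(1 : R) ler_norml; move: (f01 i) (f01 j) => /andP[? ?] /andP[? ?].
  by apply/andP; split; lra.
- case/predU1P => [-> jn|ij jn] /=; first by rewrite subrr normr0 (@surv_ge0 l.+1).
  have iltn := leq_trans ij jn; rewrite iltn step_sub.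
  set F := iter l step f in IH *.
  have q0 := reflected_env_ge0; have q1 := reflected_env_le1.
  have h2 : `|2^-1 : R| = 2^-1 by rewrite ger0_norm// invr_ge0.
  rewrite [X in _ <= X]/step normrM h2 ler_pM2r ?invr_gt0//.
  (* The term where the lower walker stays is split with the weights [q j] and [1 - q j], to match
     the two moves of the upper walker. *)
  have -> : surv l i + q i * surv l i.+1 + (1 - q i) * surv l i.-1 =
     q i * surv l i.+1 + (1 - q i) * surv l i.-1 + (q j * surv l i + (1 - q j) * surv l i).
    by ring.
  apply: (le_trans (ler_normD _ _)); apply: lerD;
    (apply: (le_trans (ler_normD _ _)); apply: lerD); rewrite normrM.
  + rewrite ger0_norm//; apply: ler_wpM2l => //; apply: IH; exact/andP.
  + rewrite ger0_norm ?subr_ge0//; apply: ler_wpM2l; rewrite ?subr_ge0//; apply: IH.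
    by rewrite jn andbT (leq_trans (leq_pred _))// ltnW.
  + rewrite ger0_norm//; move: jn; rewrite leq_eqVlt => /predU1P[->|jn].
      by rewrite reflected_envn !mul0r.
    by apply: ler_wpM2l => //; apply: IH; rewrite jn andbT (leq_trans (ltnW ij)).
  + rewrite ger0_norm ?subr_ge0//; apply: ler_wpM2l; rewrite ?subr_ge0//; apply: IH.
    by rewrite (leq_trans (leq_pred _) jn) andbT -ltnS prednK// (leq_ltn_trans _ ij).
Qed.

Lemma surv_le l i j : (i <= j <= n)%N -> surv l j <= surv l i.
Proof.
elim: l i j => [|l IH] i j /andP[]; rewrite leq_eqVlt.
- case/predU1P => [->//|ij jn] /=; rewrite (leq_trans ij jn).
  by rewrite ler_nat leq_b1.
- case/predU1P => [->//|ij jn] /=; rewrite (leq_trans ij jn).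
  have q0 := reflected_env_ge0; have q1 := reflected_env_le1.
  move: (jn); rewrite leq_eqVlt => /predU1P[->|jltn].
    rewrite ltnn; have := @surv_ge0 l.+1 i; rewrite /= (leq_trans ij jn); apply.
    by rewrite ltnW// (leq_trans ij).
  rewrite jltn -subr_ge0 step_sub.
  apply: mulr_ge0; rewrite ?invr_ge0//.
  apply: addr_ge0; apply: addr_ge0; apply: mulr_ge0; rewrite ?subr_ge0//; apply: IH.
  + by apply/andP.
  + by rewrite jn andbT (leq_trans (leq_pred _))// ltnW.
  + by rewrite jltn andbT (leq_trans (ltnW ij)).
  + by rewrite (leq_trans (leq_pred _) jn) andbT -ltnS prednK// (leq_ltn_trans _ ij).
Qed.

(* The mean time to go from j to j.+1, and a bound on its variance. *)
Fixpoint cross_mean (j : nat) : R :=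
  if j is j'.+1 then 2 * (1 + odds j) + odds j * cross_mean j' else 2.

Fixpoint cross_var (j : nat) : R :=
  if j is j'.+1 then odds j * cross_var j' + cross_mean j ^+ 2 + odds j * cross_mean j' ^+ 2
  else cross_mean 0 ^+ 2.

Definition mean_to (k i : nat) : R := \sum_(i <= j < k) cross_mean j.
Definition var_to (k i : nat) : R := \sum_(i <= j < k) cross_var j.

Lemma cross_mean_ge0 j : 0 <= cross_mean j.
Proof.
by elim: j => //= j IH; have := odds_gt0 j.+1; nra.
Qed.

Lemma cross_var_ge0 j : 0 <= cross_var j.
Proof.
elim: j => [|j IH] /=; first by rewrite sqr_ge0.
have /ltW o := odds_gt0 j.+1.
by apply: addr_ge0; [apply: addr_ge0|]; rewrite ?sqr_ge0// mulr_ge0// sqr_ge0.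
Qed.

Lemma mean_to_ge0 k i : 0 <= mean_to k i.
Proof. by apply: sumr_ge0 => j _; exact: cross_mean_ge0. Qed.

Lemma var_to_ge0 k i : 0 <= var_to k i.
Proof. by apply: sumr_ge0 => j _; exact: cross_var_ge0. Qed.

Lemma step_mean_to k i : (i < k <= n)%N -> step (mean_to k) i = mean_to k i - 1.
Proof.
move=> /andP[ik kn]; rewrite /step /mean_to [in RHS]big_ltn// [X in X + _ + _]big_ltn//.
case: i ik => [|i] ik /=; first by rewrite reflected_env0 subrr mul0r mul1r; field.
rewrite [X in _ + (1 - _) * X]big_ltn ?(ltnW ik)// [X in _ + (1 - _) * (_ + X)]big_ltn//=.
have := @odds_reflected_env i.+1; rewrite (leq_trans ik kn) => /(_ isT).
set S := \sum_(_ <= _ < _) _; set o := odds _; set c := cross_mean i.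
set Q := q i.+1 => qo.
set c' := (2 * (1 + o) + o * c).
have : Q * c' = 2 + (1 - Q) * c by rewrite /c' -qo; nra.
by clearbody c' S o c Q => H; lra.
Qed.

(* The square of the (compensated) time elapsed when the walk reaches i plus
   a bound on the variance of the remaining time is a supermartingale. *)
Lemma step_quadratic k i x : (i < k <= n)%N ->
  step (fun j => (x + mean_to k j) ^+ 2 + var_to k j) i <=
  (x - 1 + mean_to k i) ^+ 2 + var_to k i.
Proof.
move=> /andP[ik kn]; rewrite /step /mean_to /var_to.
rewrite ![\sum_(i <= _ < _) _]big_ltn//.
set S := \sum_(_ <= _ < _) _; set U := \sum_(_ <= _ < _) _.
case: i ik @S @U => [|i] ik S U /=.
  by rewrite reflected_env0 subrr mul0r mul1r; nra.
rewrite ![\sum_(i <= _ < _) _]big_ltn ?(ltnW ik)// ![\sum_(i.+1 <= _ < _) _]big_ltn//= -/S -/U.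
have := @odds_reflected_env i.+1; rewrite (leq_trans ik kn) => /(_ isT).
have q0 := reflected_env_ge0 i.+1.
set o := odds _; set c := cross_mean i; set v := cross_var i; set Q := q i.+1 in q0 *.
move=> qo.
set c' := (2 * (1 + o) + o * c).
have e1 : Q * c' = 2 + (1 - Q) * c by rewrite /c' -qo; nra.
have e2 : Q * (o * v + c' ^+ 2 + o * c ^+ 2) = (1 - Q) * v + Q * c' ^+ 2 + (1 - Q) * c ^+ 2.
  by rewrite -qo; ring.
set v' := (o * v + c' ^+ 2 + o * c ^+ 2) in e2 *.
clearbody c' v' Q S U o c v.
set y := x + (c' + S).
have -> : x + S = y - c' by rewrite /y; ring.
have -> : x + (c + (c' + S)) = y + c by rewrite /y; ring.
have -> : x - 1 + (c' + S) = y - 1 by rewrite /y; ring.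
rewrite ler_pdivrMr// -subr_ge0.
(* [e1] and [e2] are the recursions of [cross_mean] and [cross_var] multiplied by [Q]. They cancel
   both brackets and leave 2, the slack of [cross_var] over the recursion of the exact variance. *)
have -> : ((y - 1) ^+ 2 + (v' + U)) * 2 - (y ^+ 2 + (v' + U) +
   Q * ((y - c') ^+ 2 + U) + (1 - Q) * ((y + c) ^+ 2 + (v + (v' + U)))) =
   2 + 2 * y * (Q * c' - (2 + (1 - Q) * c)) +
   (Q * v' - ((1 - Q) * v + Q * c' ^+ 2 + (1 - Q) * c ^+ 2)) by ring.
by rewrite e1 e2 !subrr mulr0 !addr0.
Qed.

(** Optional stopping at [n] for the supermartingale [Phi], indexed by the number of steps left: it
    is worth at least [c] if the time runs out below [n], and at least 0 on arrival at [n]. *)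
Lemma surv_supermartingale c (Phi : nat -> nat -> R) m i : (i <= n)%N ->
  (forall i, (i < n)%N -> c <= Phi 0%N i) -> (forall m, 0 <= Phi m n) ->
  (forall m i, (i < n)%N -> step (Phi m) i <= Phi m.+1 i) ->
  c * surv m i <= Phi m i.
Proof.
move=> + Phi0 Phin Phis; elim: m i => [|m IH] i; rewrite leq_eqVlt => /predU1P[->|iltn].
- by rewrite surv_n mulr0.
- by rewrite /= iltn mulr1 Phi0.
- by rewrite surv_n mulr0.
- rewrite /= iltn; apply: le_trans (Phis _ _ iltn); rewrite -stepZ.
  by apply: step_le (ltnW iltn) _ => j jn; exact: IH.
Qed.

Lemma surv_markov l : l%:R * surv l 0 <= mean_to n 0.
Proof.
(* [l - m] is the time already spent and [mean_to n i] the mean time still needed: their sum is a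
   martingale until [n] is hit. *)
suff H m : (m <= l)%N -> forall i, (i <= n)%N -> l%:R * surv m i <= l%:R - m%:R + mean_to n i.
  by have := H l (leqnn _) 0%N isT; rewrite subrr add0r.
elim: m => [_|m IH lm] i; rewrite leq_eqVlt => /predU1P[->|iltn].
- by rewrite surv_n mulr0 subr0 addr_ge0// mean_to_ge0.
- by rewrite /= iltn mulr1 subr0 lerDl mean_to_ge0.
- by rewrite surv_n mulr0 addr_ge0 ?mean_to_ge0// subr_ge0 ler_nat.
- rewrite /= iltn -stepZ.
  apply: (@le_trans _ _ (step (fun j => l%:R - m%:R + mean_to n j) i)).
    by apply: step_le (ltnW iltn) _ => j jn; apply: IH => //; exact: ltnW.
  have := @step_mean_to n i; rewrite iltn leqnn => /(_ isT).
  rewrite /step -[m.+1%:R]natr1 => H; lra.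
Qed.

(** Chebyshev for the hitting time of [n]: if [n] is not reached after [l] steps, the elapsed time
    plus the mean remaining time exceeds the initial mean by at least [l%:R - mean_to n 0]. *)
Lemma surv_chebyshev l : mean_to n 0 <= l%:R ->
  (l%:R - mean_to n 0) ^+ 2 * surv l 0 <= var_to n 0.
Proof.
set a := mean_to n 0 => al.
have := @surv_supermartingale ((l%:R - a) ^+ 2)
  (fun m i => (l%:R - m%:R - a + mean_to n i) ^+ 2 + var_to n i) l 0 isT.
have -> : (l%:R - l%:R - a + mean_to n 0) ^+ 2 + var_to n 0 = var_to n 0.
  by rewrite -/a subrr add0r addNr expr0n add0r.
apply.
- move=> i _; rewrite subr0 -[leLHS]addr0 lerD ?var_to_ge0//.
  by have := mean_to_ge0 n i; move: al; rewrite -subr_ge0; nra.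
- by move=> m; rewrite addr_ge0 ?sqr_ge0 ?var_to_ge0.
- move=> m i iltn; apply: le_trans (step_quadratic _ _) _; first by rewrite iltn leqnn.
  by rewrite -[m.+1%:R]natr1 le_eqVlt; apply/orP; left; apply/eqP; congr (_ ^+ 2 + _); ring.
Qed.

Definition geind (k i : nat) : R := (k <= i)%:R.

Lemma iter_step_ge0 (f : nat -> R) l i : (forall k, 0 <= f k) -> (i <= n)%N ->
  0 <= iter l step f i.
Proof.
move=> f0; elim: l i => [|l IH] i lein //=; rewrite -(step_cst 0 i).
exact: step_le.
Qed.

Lemma iter_step_le1 (f : nat -> R) l i : (forall k, f k <= 1) -> (i <= n)%N ->
  iter l step f i <= 1.
Proof.
move=> f1; elim: l i => [|l IH] i lein //=; rewrite -(step_cst 1 i).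
exact: step_le.
Qed.

(** Being in [k, n] at time [l] requires a hit of [k] by then, hence a deviation of at least
    [mean_to k 0 - l%:R]. From [k] on the sums [mean_to k] and [var_to k] are empty and the walk
    need not be stopped: it suffices that the iterate is at most 1. *)
Lemma iter_step_chebyshev k l : (k <= n)%N -> l%:R <= mean_to k 0 ->
  (mean_to k 0 - l%:R) ^+ 2 * iter l step (geind k) 0 <= var_to k 0.
Proof.
move=> kn; set a := mean_to k 0 => la.
suff H m i : (i <= n)%N -> (a - l%:R) ^+ 2 * iter m step (geind k) i <=
    (l%:R - m%:R - a + mean_to k i) ^+ 2 + var_to k i.
  by have := H l 0%N isT; rewrite -/a subrr add0r addNr expr0n add0r.
elim: m i => [|m IH] i lein; have [ki|ik] := leqP k i.
- rewrite /geind /= ki mulr1 /mean_to /var_to !big_geq// !addr0 subr0.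
  by rewrite -sqrrN opprB.
- by rewrite /geind /= leqNgt ik mulr0 addr_ge0 ?sqr_ge0 ?var_to_ge0.
- have -> : mean_to k i = 0 by rewrite /mean_to big_geq.
  have -> : var_to k i = 0 by rewrite /var_to big_geq.
  rewrite !addr0.
  apply: (@le_trans _ _ ((a - l%:R) ^+ 2)).
    by rewrite ler_piMr ?sqr_ge0// iter_step_le1// => j; rewrite /geind lern1 leq_b1.
  rewrite -(sqrrN (_ - a)) lerXn2r ?nnegrE ?subr_ge0//; have := ler0n R m.+1; lra.
- apply: (@le_trans _ _ (step (fun j => (l%:R - m%:R - a + mean_to k j) ^+ 2 + var_to k j) i)).
    by rewrite /= -stepZ; apply: step_le lein _ => j jn; exact: IH.
  apply: le_trans (step_quadratic _ _) _; first by rewrite ik.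
  by rewrite -[m.+1%:R]natr1 le_eqVlt; apply/orP; left; apply/eqP; congr (_ ^+ 2 + _); ring.
Qed.

(** * Detailed balance and the stationary distribution *)

Definition balanced (p : nat -> R) :=
  forall x, (x < n)%N -> p x * q x = p x.+1 * (1 - q x.+1).

(** Summation by parts: under detailed balance only the flux through the edge from [j] to [j.+1]
    survives. At [j = n] it vanishes, which gives stationarity; inside the interval it measures the
    escape from [0, j]. *)
Lemma balanced_sum_step p h j : balanced p -> (j <= n)%N ->
  \sum_(x < j.+1) p x * step h x =
  \sum_(x < j.+1) p x * h x + p j * q j * (h j.+1 - h j) / 2.
Proof.
move=> bp; elim: j => [_|j IH jn].
  by rewrite !big_ord1 /step reflected_env0 subrr; field.
rewrite big_ord_recr/= IH; last exact: ltnW.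
rewrite [in RHS]big_ord_recr/= bp// /step /=.
by field.
Qed.

Lemma balanced_stationary p h : balanced p ->
  \sum_(x < n.+1) p x * step h x = \sum_(x < n.+1) p x * h x.
Proof.
by move=> bp; rewrite balanced_sum_step// reflected_envn mulr0 !mul0r addr0.
Qed.

Fixpoint weight (x : nat) : R :=
  if x is x'.+1 then weight x' * q x' / (1 - q x) else 1.

Lemma reflected_env_gt0 x : (x < n)%N -> 0 < q x.
Proof.
case: x => [|x] xn; first by rewrite reflected_env0.
by rewrite reflected_env_mid//; have /andP[] := w01 x.+1%:Z.
Qed.

Lemma reflected_env_lt1 x : (0 < x <= n)%N -> 0 < 1 - q x.
Proof.
move=> /andP[x0]; rewrite leq_eqVlt => /predU1P[->|xn].
  by rewrite reflected_envn subr0.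
by rewrite reflected_env_mid ?x0// subr_gt0; have /andP[] := w01 x%:Z.
Qed.

Lemma weight_gt0 x : (x <= n)%N -> 0 < weight x.
Proof.
elim: x => // x IH xn; rewrite /= divr_gt0 ?mulr_gt0 ?reflected_env_gt0 ?IH//.
  exact: ltnW.
exact: reflected_env_lt1.
Qed.

Lemma weight_balanced : balanced weight.
Proof. by move=> x xn /=; rewrite divfK// gt_eqF// reflected_env_lt1. Qed.

(** [stationary_distribution] is a choice with default 0, so a stationary law has to be exhibited:
    the normalised reversible weights. *)
Lemma ex_stationary : exists p, is_stationary K p.
Proof.
set Z := \sum_(x < n.+1) weight x.
have Z0 : 0 < Z.
  rewrite /Z big_ord_recl ltr_pwDl ?weight_gt0// sumr_ge0// => i _.
  by apply/ltW/weight_gt0; rewrite -ltnS; exact: (ltn_ord (lift ord0 i)).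
exists [ffun x : 'I_n.+1 => weight x / Z]; split.
- by move=> x; rewrite ffunE divr_ge0 ?(ltW Z0)// ltW// weight_gt0// -ltnS.
- under eq_bigr do rewrite ffunE.
  by rewrite -mulr_suml divff// gt_eqF.
- move=> y; rewrite ffunE.
  have E (x : 'I_n.+1) : K x y = step (fun k => (k == y)%:R) x.
    rewrite -sum_lazy_reflected_kernel (bigD1 y)//= eqxx mulr1 big1 ?addr0// => j /negPf.
    by rewrite -val_eqE /= => ->; rewrite mulr0.
  under eq_bigr do rewrite ffunE E mulrAC.
  rewrite -mulr_suml (balanced_stationary _ weight_balanced).
  under eq_bigr do rewrite mulrC.
  rewrite (sum_ord_eq weight).
  by rewrite -ltnS ltn_ord.
Qed.

Definition stat (k : nat) : R := stationary_distribution K (inord k).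

Lemma stationary_distributionP : is_stationary K (stationary_distribution K).
Proof. exact: (xgetPex _ ex_stationary). Qed.

Lemma stat_ord (x : 'I_n.+1) : stat x = stationary_distribution K x.
Proof. by rewrite /stat inord_val. Qed.

Lemma stat_ge0 k : 0 <= stat k.
Proof. by have [h _ _] := stationary_distributionP; exact: h. Qed.

Lemma sum_stat : \sum_(x < n.+1) stat x = 1.
Proof.
by have [_ <- _] := stationary_distributionP; apply: eq_bigr => x _; exact: stat_ord.
Qed.

Lemma stat_stationary h : \sum_(x < n.+1) stat x * step h x = \sum_(x < n.+1) stat x * h x.
Proof.
under eq_bigr do rewrite -sum_lazy_reflected_kernel mulr_sumr stat_ord.
rewrite exchange_big/=; apply: eq_bigr => y _.
have [_ _ /(_ y)] := stationary_distributionP.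
rewrite -stat_ord => <-; rewrite mulr_suml; apply: eq_bigr => x _.
by rewrite mulrA.
Qed.

Lemma stat_balanced : balanced stat.
Proof.
move=> x xn.
(* Stationarity is tested on the indicator of {0,...,x}: only the edge from [x] to [x.+1]
   contributes. *)
have := stat_stationary (fun z => (z <= x)%:R).
move/eqP; rewrite -subr_eq0 -sumrB.
have E (z : 'I_n.+1) : stat z * step (fun z : nat => (z <= x)%:R) z - stat z * (z <= x)%:R =
   (z == x :> nat)%:R * (- stat x * q x / 2) +
   (z == x.+1 :> nat)%:R * (stat x.+1 * (1 - q x.+1) / 2).
  have T1 : true%:R = 1 :> R by []. have F0 : false%:R = 0 :> R by [].
  rewrite /step; case: (ltngtP z x) => [zx|zx|->].
  - have -> : ((z : nat) == x.+1) = false by lia.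
    have -> : (z.-1 <= x)%N by lia.
    by rewrite T1 F0; field.
  - have [->|zx'] := eqVneq (z : nat) x.+1.
      by have -> : (x.+1.-1 <= x)%N by []; rewrite T1 F0; field.
    have -> : (z.-1 <= x)%N = false by lia.
    by rewrite F0; field.
  - have -> : (x == x.+1) = false by lia.
    have -> : (x.-1 <= x)%N by lia.
    by rewrite T1 F0; field.
under eq_bigr do rewrite E.
rewrite big_split/= (sum_ord_eq (fun=> - stat x * q x / 2)).
rewrite (sum_ord_eq (fun=> stat x.+1 * (1 - q x.+1) / 2)) (ltnW xn) xn => /eqP H.
lra.
Qed.

Lemma stat0_gt0 : 0 < stat 0.
Proof.
rewrite lt_neqAle stat_ge0 andbT eq_sym; apply/eqP => s0.
suff H x : (x <= n)%N -> stat x = 0.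
  have := sum_stat; rewrite big1; first by move/eqP; rewrite eq_sym oner_eq0.
  by move=> x _; rewrite H// -ltnS.
elim: x => // x IH xn; have := stat_balanced xn; rewrite IH ?(ltnW xn)// mul0r.
move/esym/eqP; rewrite mulf_eq0 => /orP[/eqP//|].
by rewrite gt_eqF// reflected_env_lt1.
Qed.

(** [stat i * q i] is twice the conductance of the edge from [i] to [i.+1]; by balance, consecutive
    conductances differ by one factor [odds]. *)
Lemma stat_flow i j : (i <= j < n)%N ->
  stat i * q i = stat j * q j * \prod_(i.+1 <= k < j.+1) odds k%:Z.
Proof.
move=> /andP[]; elim: j => [|j IH]; first by rewrite leqn0 => /eqP-> _; rewrite big_geq// mulr1.
rewrite leq_eqVlt => /predU1P[<-|ij] jn; first by rewrite big_geq// mulr1.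
rewrite (IH ij (ltnW jn)) (stat_balanced (ltnW jn)) [in RHS]big_nat_recr//=.
by rewrite -(@odds_reflected_env j.+1) ?jn//; ring.
Qed.

Lemma stat_le1 k : (k <= n)%N -> stat k <= 1.
Proof.
move=> kn; rewrite -sum_stat.
have kn' : (k < n.+1)%N by [].
by rewrite (bigD1 (Ordinal kn'))//= lerDl sumr_ge0// => i _; exact: stat_ge0.
Qed.

Definition tail_prod (x : nat) : R := \prod_(x.+1 <= k < n) odds k%:Z.

Lemma tail_prod_ge0 x : 0 <= tail_prod x.
Proof. by apply: prodr_ge0 => k _; rewrite ltW// odds_gt0. Qed.

(** The top edge carries the flow [stat n <= 1], because [1 - q n = 1], and [stat_flow] compares
    every lower edge with it. *)
Lemma stat_flow_top x : (x < n)%N -> stat x * q x <= tail_prod x.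
Proof.
move=> xn; have n1 : n.-1.+1 = n by rewrite prednK.
rewrite (@stat_flow x n.-1); last by rewrite -ltnS n1 xn leqnn.
rewrite stat_balanced ?n1// reflected_envn subr0 mulr1.
by rewrite ler_piMl// ?tail_prod_ge0// stat_le1.
Qed.

Lemma stat_mass j : (j < n)%N ->
  \sum_(x < j.+1) stat x <= 2 * \sum_(x < j.+1) tail_prod x.
Proof.
(* By balance [stat x] is the sum of the flows through its two edges, hence the factor 2. The extra
   [tail_prod j] reserves the flow through the last edge for the next site. *)
suff H : (j < n)%N -> \sum_(x < j.+1) stat x + tail_prod j <= 2 * \sum_(x < j.+1) tail_prod x.
  by move=> /H; apply: le_trans; rewrite lerDl tail_prod_ge0.
elim: j => [|j IH] jn.
  rewrite !big_ord1; have := stat_flow_top jn; rewrite reflected_env0 mulr1; lra.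
rewrite big_ord_recr [in X in _ <= X]big_ord_recr/=.
have := IH (ltnW jn); have := stat_flow_top jn; have := stat_flow_top (ltnW jn).
by rewrite (stat_balanced (ltnW jn)); lra.
Qed.

(** Started from [stat] on [0, k], the probability of being beyond [k] grows per step by at most the
    flow through the edge from [k] to [k.+1], halved by laziness. *)
Lemma escape_bound k l : (k < n)%N ->
  \sum_(x < k.+1) stat x * iter l step (geind k.+1) x <= l%:R * (stat k * q k) / 2.
Proof.
move=> kn; elim: l => [|l IH].
  by rewrite big1 ?mul0r// => x _; rewrite /= /geind leqNgt ltnS -ltnS ltn_ord mulr0.
rewrite /= balanced_sum_step//; [|exact: stat_balanced|exact: ltnW].
have h0 : 0 <= iter l step (geind k.+1) k.
  by apply: iter_step_ge0 (ltnW kn) => i; rewrite ler0n.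
have h1 : iter l step (geind k.+1) k.+1 <= 1.
  by apply: iter_step_le1 kn => i; rewrite /geind lern1 leq_b1.
have h2 : 0 <= stat k * q k by rewrite mulr_ge0 ?stat_ge0// reflected_env_ge0.
have : stat k * q k * (iter l step (geind k.+1) k.+1 - iter l step (geind k.+1) k) <= stat k * q k.
  by rewrite ler_piMr//; lra.
by rewrite -[l.+1%:R]natr1; lra.
Qed.

Lemma stat_iter l h :
  \sum_(x < n.+1) stat x * iter l step h x = \sum_(x < n.+1) stat x * h x.
Proof. by elim: l => [//|l <-]; exact: stat_stationary. Qed.

Lemma iter_step_ext (f g : nat -> R) l i : (i <= n)%N ->
  (forall j, (j <= n)%N -> f j = g j) -> iter l step f i = iter l step g i.
Proof.
by move=> + fg; elim: l i => [|l IH] i lein /=; [exact: fg|exact: step_ext].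
Qed.

Lemma iter_step_sum (I : finType) (A : {set I}) (F : I -> nat -> R) l i :
  iter l step (fun k => \sum_(y in A) F y k) i = \sum_(y in A) iter l step (F y) i.
Proof.
elim: l i => // l IH i; rewrite /= /step !IH.
by rewrite !mulr_sumr -!big_split/= mulr_suml; exact: eq_bigr.
Qed.

(** * Bounds on the mixing time *)

Variables (d : measure_display) (T : measurableType d).
Variables (Q : 'I_n.+1 -> probability T R) (Y : nat -> T -> 'I_n.+1).
Hypothesis lawE : forall l x y,
  law (Q x) (Y l) y = iter l step (fun k => (k == y)%:R) x.

Let dist := distance_to_stationarity K Q Y.
Let tmix := mixing_time K Q Y.

Let inset (A : {set 'I_n.+1}) (k : nat) : R := (inord k \in A)%:R.

Lemma sum_law l x (A : {set 'I_n.+1}) : \sum_(y in A) law (Q x) (Y l) y = iter l step (inset A) x.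
Proof.
under eq_bigr do rewrite lawE.
rewrite -iter_step_sum; apply: iter_step_ext; first by rewrite -ltnS.
move=> j jn; have jn' : (j < n.+1)%N by [].
rewrite /inset; have [jA|jA] := boolP (inord j \in A).
  rewrite (bigD1 (inord j))//= inordK// eqxx big1 ?addr0// => y /andP[_ yj].
  by have [jy|//] := eqVneq j y; move: yj; rewrite jy inord_val eqxx.
rewrite big1// => y yA; have [jy|//] := eqVneq j y.
by move: jA; rewrite jy inord_val yA.
Qed.

Lemma sum_stat_set l (A : {set 'I_n.+1}) : \sum_(y in A) stationary_distribution K y =
  \sum_(x < n.+1) stat x * iter l step (inset A) x.
Proof.
rewrite stat_iter big_mkcond; apply: eq_bigr => x _.
by rewrite /inset inord_val stat_ord; case: (x \in A); rewrite ?mulr1 ?mulr0.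
Qed.

Lemma dist_le_surv l : dist l <= surv l 0.
Proof.
have s0 := @surv_ge0 l 0 isT.
apply: bigmax_le => // x _; apply: bigmax_le => // A _.
(* A second starting point is drawn from [stat], so the distance becomes a mean of differences
   between two starting points. Each is bounded by [coupling_bound], and 0 is the worst lower
   start. *)
rewrite sum_law (sum_stat_set l) -[iter l step _ x]mul1r -sum_stat mulr_suml -sumrB.
rewrite -[leRHS]mul1r -sum_stat mulr_suml; apply: (le_trans (ler_norm_sum _ _ _)).
apply: ler_sum => y _; rewrite -mulrBr normrM ger0_norm ?stat_ge0//.
apply: ler_wpM2l; first exact: stat_ge0.
have f01 k : 0 <= inset A k <= 1 by rewrite ler0n lern1 leq_b1.
have on (z : 'I_n.+1) : (z <= n)%N by rewrite -ltnS.
have [xy|yx] := leqP x y.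
  apply: (@le_trans _ _ (surv l x)); last by apply: surv_le; rewrite on.
  by apply: coupling_bound => //; rewrite xy -ltnS ltn_ord.
apply: (@le_trans _ _ (surv l y)); last by apply: surv_le; rewrite on.
by rewrite distrC; apply: coupling_bound => //; rewrite (ltnW yx) -ltnS ltn_ord.
Qed.

Lemma dist_ge_tail l k (x : 'I_n.+1) : (k <= n)%N ->
  1 - \sum_(y < k) stat y - iter l step (geind k) x <= dist l.
Proof.
move=> kn; set A := finset (fun y : 'I_n.+1 => (k <= y)%N).
have e j : (j <= n)%N -> inset A j = geind k j.
  by move=> jn; rewrite /inset inE inordK.
have -> : iter l step (geind k) x = iter l step (inset A) x.
  by apply: iter_step_ext => [|j /e//]; rewrite -ltnS.
rewrite -sum_law.
have -> : 1 - \sum_(y < k) stat y = \sum_(y in A) stationary_distribution K y.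
  apply/eqP; rewrite subr_eq -sum_stat; apply/eqP.
  rewrite (bigID (fun y : 'I_n.+1 => (k <= y)%N))/=; congr (_ + _).
    by rewrite [in RHS](eq_bigl (fun y : 'I_n.+1 => (k <= y)%N)) => [|y]; rewrite ?inE//;
       apply: eq_bigr => y _; rewrite stat_ord.
  rewrite [RHS](big_ord_widen n.+1 stat); last exact: leqW.
  by apply: eq_bigl => y; rewrite -ltnNge.
apply: (@le_trans _ _ (total_variation_distance (law (Q x) (Y l)) (stationary_distribution K))); last first.
  by rewrite /dist /distance_to_stationarity; exact: (le_bigmax 0 (fun x => total_variation_distance (law (Q x) (Y l)) (stationary_distribution K))).
apply: le_trans (le_bigmax 0 (fun B : {set 'I_n.+1} => `|_|) A).
by rewrite distrC ler_norm.
Qed.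

Lemma nat_minP (B : set nat) : (exists l, B l) ->
  B (nat_min B) /\ forall m, B m -> (nat_min B <= m)%N.
Proof.
move=> [l Bl]; apply: (@xgetPex _ 0%N [set l | B l /\ forall m, B m -> (l <= m)%N]).
have [m /asboolP Bm min] := ex_minnP (ex_intro (fun l => `[< B l >]) l (asboolT Bl)).
by exists m; split => // k Bk; apply: min; exact: asboolT.
Qed.

Lemma surv_eventually (c : R) : 0 < c -> exists2 l, (0 < l)%N &
  surv l 0 <= c /\ l%:R <= mean_to n 0 / c + 1.
Proof.
move=> c0; set l := (Num.truncn (mean_to n 0 / c)).+1; exists l => //.
have m0 : 0 <= mean_to n 0 / c by rewrite divr_ge0 ?mean_to_ge0// ltW.
have /andP[h1 h2] := truncn_itv m0; rewrite -/l in h2; split; last first.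
  by rewrite /l -natr1 lerD2r.
have l0 : 0 < l%:R :> R by rewrite ltr0n.
rewrite -(ler_pM2l l0); apply: (le_trans (surv_markov l)).
by rewrite -ler_pdivrMr// ltW.
Qed.

Lemma tmixP : [/\ (0 < tmix)%N, dist tmix <= 1 / 4 &
  forall l, (0 < l)%N -> dist l <= 1 / 4 -> (tmix <= l)%N].
Proof.
have [|[t0 dt] mt] := @nat_minP [set l | (0 < l)%N /\ dist l <= 1 / 4].
  have [|l l0 [h _]] := @surv_eventually (1 / 4); first by rewrite divr_gt0.
  by exists l; split => //; exact: le_trans (dist_le_surv l) h.
by split => // l l0 dl; apply: mt.
Qed.

Lemma tmix_le_mean : tmix%:R <= 4 * mean_to n 0 + 1.
Proof.
have [|l l0 [h h']] := @surv_eventually (1 / 4); first by rewrite divr_gt0.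
have [_ _ /(_ l l0 (le_trans (dist_le_surv l) h))] := tmixP.
by rewrite -(ler_nat R); lra.
Qed.

Lemma tmix_le_chebyshev l : mean_to n 0 < l%:R ->
  4 * var_to n 0 <= (l%:R - mean_to n 0) ^+ 2 -> (tmix <= l)%N.
Proof.
move=> ml vl; have [_ _] := tmixP; apply.
  by rewrite -(ltr_nat R) (le_lt_trans _ ml)// mean_to_ge0.
apply: (le_trans (dist_le_surv l)).
have := surv_chebyshev (ltW ml); have : 0 < l%:R - mean_to n 0 by rewrite subr_gt0.
set x := l%:R - _ in vl *; set s := surv _ _ => x0 h.
have x2 : 0 < x ^+ 2 by rewrite exprn_gt0.
rewrite -(ler_pM2l x2); lra.
Qed.

Lemma tmix_ge_chebyshev k : (k <= n)%N -> \sum_(y < k) stat y <= 1 / 4 ->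
  tmix%:R <= mean_to k 0 -> (mean_to k 0 - tmix%:R) ^+ 2 <= 2 * var_to k 0.
Proof.
move=> kn sk tm; have [_ dt _] := tmixP.
have := iter_step_chebyshev kn tm.
have := dist_ge_tail tmix (ord0 : 'I_n.+1) kn; rewrite [nat_of_ord ord0]/=.
set h := iter _ _ _ _; set x := (_ - _) ^+ 2 => h1 h2.
(* The stationary mass from [k] on is at least 3/4 and the distance at most 1/4. *)
have h3 : 1 / 2 <= h by lra.
have : x * (1 / 2) <= x * h by rewrite ler_wpM2l// sqr_ge0.
lra.
Qed.

(** Of the stationary mass S of [0, j], at least half must have left by the mixing time, while each
    step releases at most half the flow through the edge above [j]. The product over the valley
    makes this flow at most S / c. *)
Lemma tmix_ge_valley i j c : 0 < c -> (i <= j < n)%N ->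
  c <= \prod_(i.+1 <= k < j.+1) odds k%:Z ->
  \sum_(y < j.+1) stat y <= 1 / 4 -> c <= tmix%:R.
Proof.
move=> c0 /andP[ij jn] hc sj; have [_ dt _] := tmixP.
have esc := escape_bound tmix jn.
have S0 : 0 < \sum_(x < j.+1) stat x.
  by rewrite big_ord_recl ltr_pwDl ?stat0_gt0// sumr_ge0// => x _; exact: stat_ge0.
have low : \sum_(x < j.+1) stat x * (1 / 2) <=
    \sum_(x < j.+1) stat x * iter tmix step (geind j.+1) x.
  apply: ler_sum => x _; apply: ler_wpM2l; first exact: stat_ge0.
  have xn : (x < n.+1)%N by apply: leq_trans (ltn_ord x) _; exact: leqW.
  have := dist_ge_tail tmix (Ordinal xn) jn; rewrite /=; lra.
have flow : c * (stat j * q j) <= \sum_(x < j.+1) stat x.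
  apply: (@le_trans _ _ (stat i)).
    apply: (@le_trans _ _ (stat i * q i)); last first.
      by rewrite ler_piMr ?stat_ge0// reflected_env_le1.
    rewrite (@stat_flow i j) ?ij// mulrC ler_wpM2l// mulr_ge0 ?stat_ge0//.
    exact: reflected_env_ge0.
  have ij' : (i < j.+1)%N by [].
  rewrite (bigD1 (Ordinal ij'))//= lerDl sumr_ge0// => x _; exact: stat_ge0.
move: S0 low esc flow; rewrite -mulr_suml; set S := \sum_(x < _) _.
set X := \sum_(x < _) _; set f := stat j * q j; set t := tmix%:R => S0 low esc flow.
have h1 : S <= t * f by lra.
have t0 : 0 <= t by rewrite ler0n.
have h2 : c * S <= t * S.
  apply: (@le_trans _ _ (t * (c * f))); last by rewrite ler_wpM2l.
  by rewrite mulrCA ler_wpM2l// ltW.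
by rewrite -(ler_pM2r S0).
Qed.

End ReflectedChain.

(** * Laws of Markov chains and hitting times *)

Section MarkovChain.
Variables (R : realType) (d : measure_display) (T : measurableType d).
Variables (Q : probability T R) (S : countType) (K : S -> S -> R) (z : S).
Variable X : nat -> T -> S.
Hypothesis mcX : markov_chain Q K z X.

Definition cylinder (m : nat) (x : nat -> S) : set T :=
  \bigcap_(k in `I_m.+1) (X k @^-1` [set x k]).

Definition extend (x : nat -> S) (m : nat) (j : S) (k : nat) : S :=
  if k == m.+1 then j else x k.

Lemma measurable_chain k x : measurable (X k @^-1` [set x]).
Proof. by have [] := mcX. Qed.

Lemma measurable_cylinder m x : measurable (cylinder m x).
Proof. by apply: bigcap_measurableType => // k _; exact: measurable_chain. Qed.

Lemma cylinderS m x j :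
  cylinder m.+1 (extend x m j) = cylinder m x `&` (X m.+1 @^-1` [set j]).
Proof.
apply/seteqP; split => [s h|s [h1 h2] k /=].
  split; last by have := h m.+1 (ltnSn _); rewrite /= /extend eqxx.
  move=> k /= km; have := h k (leq_trans km (leqnSn _)).
  by rewrite /= /extend ltn_eqF.
rewrite ltnS leq_eqVlt => /predU1P[->|km]; first by rewrite /extend eqxx.
by rewrite /extend ltn_eqF//; exact: h1.
Qed.

Definition path_weight (m : nat) (x : nat -> S) : R :=
  (x 0%N == z)%:R * \prod_(k < m) K (x k) (x k.+1).

Lemma cylinderE m x : Q (cylinder m x) = (path_weight m x)%:E.
Proof. by have [_ ->] := mcX. Qed.

Lemma path_weightS m x j :
  path_weight m.+1 (extend x m j) = path_weight m x * K (x m) j.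
Proof.
rewrite /path_weight /extend/= big_ord_recr/= eqxx ltn_eqF// mulrA; congr (_ * _ * _).
apply: eq_bigr => k _; have km := ltn_ord k.
by rewrite (ltn_eqF (leqW km)) eqSS (ltn_eqF km).
Qed.

End MarkovChain.

Section FiniteMarkovChain.
Variables (R : realType) (d : measure_display) (T : measurableType d).
Variables (Q : probability T R) (S : finType) (K : S -> S -> R) (z : S).
Variable X : nat -> T -> S.
Hypothesis mcX : markov_chain Q K z X.

Lemma measure_fin_partition (f : T -> S) (A : set T) :
  (forall x, measurable (f @^-1` [set x])) -> measurable A ->
  Q A = (\sum_x Q (A `&` (f @^-1` [set x])))%E.
Proof.
move=> mf mA.
have {1}-> : A = \bigcup_(x in [set: S]) (A `&` (f @^-1` [set x])).
  by apply/seteqP; split => [t At|t [x _ []//]]; exists (f t).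
rewrite measure_fin_bigcup//.
- rewrite (_ : [set: S] = [set` predT]); last by apply/seteqP; split.
  rewrite -(@bigfs _ _ _ _ (index_enum S) predT) ?index_enum_uniq//.
  by move=> i _; rewrite mem_index_enum.
- exact: finite_finset.
- apply/trivIsetP => x y _ _ /eqP xy; rewrite -subset0 => t [[_ /= fx] [_ /= fy]].
  by apply: xy; rewrite -fx -fy.
- by move=> x _; apply: measurableI.
Qed.

Definition kernel_iter l (f : S -> R) : S -> R :=
  iter l (fun f x => \sum_y K x y * f y) f.

(** The Markov property recovered from path probabilities: splitting according to the next state
    lengthens the cylinder by one. *)
Lemma markov_chain_cylinder m l x y :
  Q (cylinder X m x `&` (X (m + l)%N @^-1` [set y])) =
  (path_weight K z m x * kernel_iter l (fun i => (i == y)%:R) (x m))%:E.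
Proof.
elim: l m x => [|l IH] m x.
  rewrite addn0 /=; have [<-|xy] := eqVneq (x m) y.
    rewrite mulr1 -(cylinderE mcX) setIidl// => s h; exact: (h m (ltnSn _)).
  rewrite mulr0 (_ : _ `&` _ = set0) ?measure0//.
  rewrite -subset0 => s [h /= sy]; move: xy; rewrite -sy => /eqP; apply.
  by rewrite (h m (ltnSn _)).
rewrite (@measure_fin_partition (X m.+1)); first last.
- by apply: measurableI; [exact: measurable_cylinder mcX _ _|exact: measurable_chain mcX _ _].
- exact: measurable_chain mcX _.
rewrite /= mulr_sumr -sumEFin; apply: eq_bigr => j _.
rewrite setIAC -cylinderS -addSnnS IH (path_weightS K z) mulrA.
by rewrite /extend eqxx.
Qed.

Lemma law_markov_chain l y :
  law Q (X l) y = kernel_iter l (fun i => (i == y)%:R) z.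
Proof.
have mX := measurable_chain mcX.
rewrite /law (@measure_fin_partition (X 0%N))//.
have E x : Q ((X l @^-1` [set y]) `&` (X 0%N @^-1` [set x])) =
    ((x == z)%:R * kernel_iter l (fun i => (i == y)%:R) x)%:E.
  have := markov_chain_cylinder 0 l (fun=> x) y; rewrite add0n /path_weight big_ord0 mulr1 => <-.
  rewrite setIC; congr (Q (_ `&` _)).
  by apply/seteqP; split => [s sx [|k]//=|s /(_ 0%N isT)].
under eq_bigr do rewrite E.
rewrite sumEFin/= (bigD1 z)//= eqxx mul1r big1 ?addr0// => j /negPf ->.
by rewrite mul0r.
Qed.

End FiniteMarkovChain.

Section HittingTime.
Variables (R : realType) (S : eqType).

(** The hitting time as the sum of the indicators that it exceeds [l]; both sides are infinite if
    [a] is never visited. *)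
Lemma hitting_timeE (x : nat -> S) (a : S) :
  hitting_time R x a = (\sum_(l <oo) [forall k : 'I_l.+1, x k != a]%:R%:E)%E.
Proof.
have [[N xN]|noN] := pselect (exists N, x N == a).
  have [N0 /eqP xN0 minN0] := ex_minnP (ex_intro (fun N => x N == a) N xN).
  have -> : hitting_time R x a = N0%:R%:E.
    apply/eqP; rewrite eq_le; apply/andP; split.
      by apply: ereal_inf_lbound; exists N0.
    apply: le_ereal_inf_tmp => _ [m xm <-]; rewrite lee_fin ler_nat.
    by apply: minN0; apply/eqP.
  rewrite (nneseries_split 0 N0)//.
  rewrite add0n [X in (_ + X)%E]eseries0 ?adde0; last first.
    move=> k N0k _; rewrite (_ : [forall _, _] = false)//.
    apply/negbTE/forallPn; have N0k' : (N0 < k.+1)%N by [].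
    by exists (Ordinal N0k'); rewrite /= xN0 negbK.
  rewrite (eq_big_nat _ _ (F2 := fun=> 1%:E)); last first.
    move=> k /andP[_ kN0]; rewrite (_ : [forall _, _] = true)//.
    apply/forallP => -[i ik]/=; apply/negP => /minN0.
    by rewrite leqNgt (leq_trans _ kN0)// ltnS -ltnS.
  by rewrite sumEFin big_const_nat subn0 iter_addr addr0.
have nx k : x k != a by apply/negP => xk; apply: noN; exists k.
have -> : hitting_time R x a = +oo%E.
  rewrite /hitting_time (_ : [set _ | _ in _] = set0) ?ereal_inf0//.
  by rewrite -subset0 => y [l /= xl _]; move: (nx l); rewrite xl eqxx.
apply/esym/eqyP => A A0.
apply: (@le_trans _ _ (\sum_(0 <= l < (Num.truncn A).+1) [forall k : 'I_l.+1, x k != a]%:R%:E)%E); last first.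
  by apply: nneseries_lim_ge => k _ _; rewrite lee_fin ler0n.
rewrite (eq_big_nat _ _ (F2 := fun=> 1%:E)); last first.
  move=> k _; rewrite (_ : [forall _, _] = true)//; exact/forallP.
by rewrite sumEFin big_const_nat subn0 iter_addr addr0 lee_fin ltW// truncnS_gt.
Qed.

End HittingTime.

(** * Mean hitting time of 1 for the walk on the integers *)

Section WalkOnZ.
Variables (R : realType) (w : int -> R).
Hypothesis w01 : forall k, 0 < w k < 1.
Variables (d : measure_display) (T : measurableType d) (Q : probability T R).
Variable X : nat -> T -> int.
Hypothesis mcX : markov_chain Q (walk_kernel w) 0 X.

(* The probability that the walk started at i avoids 1 up to time l. *)
Fixpoint miss (l : nat) (i : int) : R :=
  if i == 1 then 0 else
  if l is l'.+1 then w i * miss l' (i + 1) + (1 - w i) * miss l' (i - 1) else 1.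

Definition misses (m l : nat) : set T :=
  [set s | forall k, (0 < k <= l)%N -> X (m + k)%N s <> 1].

Lemma measurable_misses m l : measurable (misses m l).
Proof.
have -> : misses m l = \bigcap_(k in [set k | (0 < k <= l)%N]) ~` (X (m + k)%N @^-1` [set 1]).
  by apply/seteqP; split => s h k /h.
by apply: bigcap_measurableType => k _; apply: measurableC; exact: measurable_chain mcX _ _.
Qed.

Lemma misses_cylinder m l x : x m != 1 ->
  Q (cylinder X m x `&` misses m l) = (path_weight (walk_kernel w) 0 m x * miss l (x m))%:E.
Proof.
elim: l m x => [|l IH] m x xm.
  rewrite /= (negbTE xm) mulr1 -(cylinderE mcX) setIidl// => s _ k.
  by case: k.
have mX k y := measurable_chain mcX k y.
have mC k y := measurable_cylinder mcX k y.
have mM := measurable_misses.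
pose up := X m.+1 @^-1` [set x m + 1]; pose dn := X m.+1 @^-1` [set x m - 1].
have mup : measurable up by exact: mX.
have mdn : measurable dn by exact: mX.
have ud : (x m + 1 == x m - 1) = false by lia.
have updn A : measurable A -> Q (A `&` (up `|` dn)) = (Q (A `&` up) + Q (A `&` dn))%E.
  move=> mA; rewrite setIUr measureU; [|by apply: measurableI|by apply: measurableI|].
    by [].
  rewrite -subset0 => s [[_ h1] [_ h2]]; move: ud.
  have <- : X m.+1 s = x m + 1 by [].
  have <- : X m.+1 s = x m - 1 by [].
  by rewrite eqxx.
have Kup : walk_kernel w (x m) (x m + 1) = w (x m) by rewrite /walk_kernel eqxx.
have Kdn : walk_kernel w (x m) (x m - 1) = 1 - w (x m).
  by rewrite /walk_kernel eq_sym ud eqxx.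
have Cup : cylinder X m x `&` up = cylinder X m.+1 (extend x m (x m + 1)).
  by rewrite cylinderS.
have Cdn : cylinder X m x `&` dn = cylinder X m.+1 (extend x m (x m - 1)).
  by rewrite cylinderS.
(* The state space is infinite, so only the two neighbours are kept as next states: their kernel
   values add up to 1, and the rest is a null set. *)
have rest : Q (cylinder X m x `\` (up `|` dn)) = 0%E.
  have -> : Q (cylinder X m x `\` (up `|` dn)) =
      (Q (cylinder X m x) - Q (cylinder X m x `&` (up `|` dn)))%E.
    by rewrite measureD//; [exact: measurableU|rewrite (le_lt_trans (probability_le1 _ _))// ltry].
  have -> : Q (cylinder X m x `&` (up `|` dn)) = (path_weight (walk_kernel w) 0 m x)%:E.
    rewrite updn// Cup Cdn !(cylinderE mcX) !path_weightS Kup Kdn -EFinD.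
    by congr EFin; ring.
  by rewrite (cylinderE mcX) subee.
have mA : measurable (cylinder X m x `&` misses m l.+1) by apply: measurableI.
have mud : measurable (up `|` dn) by apply: measurableU.
have -> : Q (cylinder X m x `&` misses m l.+1) =
    (Q ((cylinder X m x `&` misses m l.+1) `\` (up `|` dn)) +
     Q ((cylinder X m x `&` misses m l.+1) `&` (up `|` dn)))%E by exact: measureDI.
rewrite [X in (X + _)%E](_ : _ = 0%E) ?add0e; last first.
  apply/eqP; rewrite eq_le measure_ge0 andbT -rest le_measure ?inE//; [by apply: measurableD|by apply: measurableD|].
  by move=> s [[h _] h2]; split.
rewrite updn//.
have key j : j = x m + 1 \/ j = x m - 1 ->
    Q (cylinder X m x `&` misses m l.+1 `&` (X m.+1 @^-1` [set j])) =
    (path_weight (walk_kernel w) 0 m x * walk_kernel w (x m) j * miss l j)%:E.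
  (* A step onto 1 contributes 0 on both sides; elsewhere the induction hypothesis applies to the
     lengthened cylinder. *)
  move=> _; have [->|j1] := eqVneq j 1.
    rewrite (_ : _ `&` _ = set0) ?measure0; last first.
      rewrite -subset0 => s [[_ /(_ 1%N isT)]]; rewrite addn1 /=.
      by move=> h /h.
    by case: l {IH mA} => [|l] /=; rewrite mulr0.
  rewrite setIAC -cylinderS.
  rewrite (_ : _ `&` _ = cylinder X m.+1 (extend x m j) `&` misses m.+1 l).
    by rewrite IH /extend eqxx// -path_weightS.
  apply/seteqP; split => s [h1 h2]; split => // k /andP[k0 kl].
    by rewrite addSnnS; apply: h2.
  case: k k0 kl => // k _; rewrite ltnS => kl.
  case: k kl => [_|k kl]; last by rewrite -addSnnS; apply: h2.
  rewrite addn1; have := h1 m.+1 (ltnSn _); rewrite /= /extend eqxx => ->.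
  exact/eqP.
rewrite key; [rewrite key|by left]; [|by right].
rewrite Kup Kdn -EFinD; congr EFin.
by rewrite /= (negbTE xm); ring.
Qed.

Lemma integral_hitting_time :
  (\int[Q]_s hitting_time R (fun l => X l s) 1%R = \sum_(l <oo) (miss l 0)%:E)%E.
Proof.
have mX k y := measurable_chain mcX k y.
pose A l := [set s | [forall k : 'I_l.+1, X k s != 1]].
have mA l : measurable (A l).
  have -> : A l = \bigcap_(k in `I_l.+1) ~` (X k @^-1` [set 1]).
    apply/seteqP; split => [s /forallP h k /= kl|s h].
      by apply/eqP; exact: (h (Ordinal kl)).
    by apply/forallP => k; apply/eqP; apply: h => /=.
  by apply: bigcap_measurableType => // k _; apply: measurableC; exact: mX.
transitivity (\int[Q]_s \sum_(l <oo) (\1_(A l) s)%:E)%E.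
  apply: eq_integral => s _; rewrite hitting_timeE; apply: eq_eseriesr => l _.
  rewrite indicE; congr ((nat_of_bool _)%:R%:E); apply/esym.
  by apply/idP/idP => [/set_mem//|h]; apply/mem_set.
rewrite integral_nneseries//; last first.
- by move=> l; apply/measurable_EFinP; exact: measurable_indic.
- apply: eq_eseriesr => l _; rewrite integral_indic// setIT.
  have -> : A l = (X 0%N @^-1` [set (0 : int)] `&` misses 0 l) `|` (A l `\` (X 0%N @^-1` [set (0 : int)])).
    apply/seteqP; split => [s|s].
      have [s0|s0] := eqVneq (X 0%N s) 0 => /forallP h.
        left; split => // k /andP[_ kl]; apply/eqP; rewrite add0n.
        by have := h (Ordinal (kl : (k < l.+1)%N)).
      by right; split; [exact/forallP|exact/eqP].
    move=> [[/= s0 h]|[//]]; apply/forallP => -[[|k] kl]; first by rewrite /= s0.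
    by apply/eqP; have := h k.+1; rewrite add0n; apply.
  have C0 : cylinder X 0 (fun=> 0) = X 0%N @^-1` [set (0 : int)].
    by apply/seteqP; split => [s /(_ 0%N isT)|s s0 [|k]//=].
  have Q0 : Q (X 0%N @^-1` [set (0 : int)]) = 1%E.
    by rewrite -C0 (cylinderE mcX) /path_weight big_ord0 mulr1.
  rewrite measureU0; first last.
  - apply/eqP; rewrite eq_le measure_ge0 andbT.
    have <- : Q (~` (X 0%N @^-1` [set (0 : int)])) = 0%E by rewrite probability_setC// Q0 subee.
    by apply: le_measure; rewrite ?inE; [by apply: measurableD|by apply: measurableC|move=> s []].
  - by apply: measurableD.
  - by apply: measurableI => //; exact: measurable_misses.
  by have := @misses_cylinder 0 l (fun=> 0) isT; rewrite C0 /path_weight big_ord0 !mul1r.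
Qed.

Let rho (k : nat) : R := odds w (- k%:Z).
(** Starting points are indexed by their distance [k] to the left of 1. *)
Let miss_nat (l k : nat) : R := miss l (1 - k%:Z).
(** As a sum of tails this is the mean of min(T, L), T being the hitting time of 1, so it is finite
    even when T has infinite mean. *)
Let total (L k : nat) : R := \sum_(l < L) miss_nat l k.

(* The mean time to go from - k to 1 - k, with its recursion truncated after N
   steps. *)
Fixpoint back (N k : nat) : R :=
  if N is N'.+1 then 1 + odds w (- k%:Z) + odds w (- k%:Z) * back N' k.+1 else 0.

Let rho_gt0 k : 0 < rho k. Proof. exact: odds_gt0. Qed.

Let w_rho k : w (- k%:Z) * (1 + rho k) = 1.
Proof.
rewrite /rho /odds; have /andP[w0 _] := w01 (- k%:Z).
by field; rewrite gt_eqF.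
Qed.

Lemma back_ge0 N k : 0 <= back N k.
Proof.
by elim: N k => //= N IH k; have := IH k.+1; have := rho_gt0 k; rewrite /rho; nra.
Qed.

Lemma back_le N k : back N k <= back N.+1 k.
Proof.
elim: N k => [|N IH] k; first exact: back_ge0.
by rewrite [in X in _ <= X]/= lerD2l ler_wpM2l ?IH// ltW// (rho_gt0 k).
Qed.

Let miss_nat0 l : miss_nat l 0 = 0.
Proof. by rewrite /miss_nat subr0; case: l. Qed.

Let miss_nat0S k : miss_nat 0 k.+1 = 1.
Proof. by rewrite /miss_nat/=; case: eqP => //; lia. Qed.

Let miss_natSS l k : miss_nat l.+1 k.+1 =
  w (- k%:Z) * miss_nat l k + (1 - w (- k%:Z)) * miss_nat l k.+2.
Proof.
rewrite /miss_nat/=; case: eqP => [|_]; first by lia.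
have -> : 1 - k.+1%:Z = - k%:Z by lia.
have -> : - k%:Z + 1 = 1 - k%:Z by lia.
by have -> : - k%:Z - 1 = 1 - k.+2%:Z by lia.
Qed.

Let miss_nat_ge0 l k : 0 <= miss_nat l k.
Proof.
elim: l k => [|l IH] [|k]; rewrite ?miss_nat0 ?miss_nat0S// miss_natSS.
have /andP[w0 w1] := w01 (- k%:Z).
by rewrite addr_ge0// mulr_ge0// ?subr_ge0 ltW.
Qed.

(** Starts of equal parity cannot cross: one step leads from [k.+1] to [k] or [k.+2] and from [k.+3]
    to [k.+2] or [k.+4], so the value at [k.+2] separates the two averages. *)
Let miss_nat_mono2 l k : miss_nat l k <= miss_nat l k.+2.
Proof.
elim: l k => [|l IH] [|k]; rewrite ?miss_nat0 ?miss_nat_ge0 ?miss_nat0S// !miss_natSS.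
have /andP[w0 w1] := w01 (- k%:Z); have /andP[w0' w1'] := w01 (- k.+2%:Z).
have := IH k; have := IH k.+2; nra.
Qed.

Let miss_nat_shift l k : miss_nat l.+1 k <= miss_nat l k.+1.
Proof.
case: k => [|k]; first by rewrite miss_nat0 miss_nat_ge0.
rewrite miss_natSS; have /andP[w0 w1] := w01 (- k%:Z).
have := miss_nat_mono2 l k; nra.
Qed.

Let total0 L : total L 0 = 0.
Proof. by rewrite /total big1// => l _; rewrite miss_nat0. Qed.

Let totalS L k : total L.+1 k.+1 =
  1 + w (- k%:Z) * total L k + (1 - w (- k%:Z)) * total L k.+2.
Proof.
rewrite /total big_ord_recl miss_nat0S -addrA; congr (_ + _).
by rewrite !mulr_sumr -big_split/=; apply: eq_bigr => l _; rewrite miss_natSS.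
Qed.

Let total_shift L k : total L.+1 k <= 1 + total L k.+1.
Proof.
rewrite /total big_ord_recl lerD//; last by apply: ler_sum => l _; exact: miss_nat_shift.
Qed.

Let total_ge0 L k : 0 <= total L k.
Proof. by apply: sumr_ge0 => l _; exact: miss_nat_ge0. Qed.

Let total_le L L' k : (L <= L')%N -> total L k <= total L' k.
Proof.
move=> /subnKC <-; rewrite /total big_split_ord/= lerDl; apply: sumr_ge0 => l _.
exact: miss_nat_ge0.
Qed.

Lemma total_le_back L N : (L < N)%N -> total L 1 <= back N 0.
Proof.
(* From distance [k] all edges [m < k] are crossed. The truncation levels [N - m] match the
   recursion of [back], and [k + L <= N] keeps them positive whenever they are unfolded. *)
move=> LN; pose H k := \sum_(m < k) back (N - m) m.
suff key k : (k + L <= N)%N -> total L k <= H k.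
  by have := key 1%N; rewrite add1n /H big_ord1 subn0; apply.
elim: L k {LN} => [|L IH] k; first by rewrite /total big_ord0 sumr_ge0// => m _; exact: back_ge0.
case: k => [|k] kL; first by rewrite total0 /H big_ord0.
rewrite totalS; have h1 := IH k; have h2 := IH k.+2.
have /andP[w0 w1] := w01 (- k%:Z).
have {}h1 : total L k <= H k by apply: h1; lia.
have {}h2 : total L k.+2 <= H k.+2 by apply: h2; lia.
move: h2; rewrite /H !big_ord_recr/= -/(H k).
have -> : (N - k = (N - k.+1).+1)%N by lia.
rewrite /= -/(rho k); set b := back _ _; have := w_rho k.
set r := rho k; set w' := w _ in w0 w1 *; move: h1.
set t1 := total _ _; set t2 := total _ _; set h := H k; clearbody b r w' t1 t2 h.
move=> h1 wr h2.
have : (1 - w') * t2 <= (1 - w') * (h + (1 + r + r * b) + b) by rewrite ler_wpM2l// subr_ge0 ltW.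
have : w' * t1 <= w' * h by rewrite ler_wpM2l// ltW.
have : w' * (1 + r + r * b + b) = 1 + b.
  by transitivity (w' * (1 + r) * (1 + b)); [ring|rewrite wr mul1r].
lra.
Qed.

Section FiniteMean.
Variable B : R.
Hypothesis total_bound : forall L, total L 1 <= B.

Let total_bounded k : exists C, forall L, total L k <= C.
Proof.
case: k => [|k]; first by exists 0 => L; rewrite total0.
elim: k => [|k [C IH]]; first by exists B.
have /andP[w0 w1] := w01 (- k%:Z).
exists (C / (1 - w (- k%:Z))) => L; rewrite ler_pdivlMr ?subr_gt0//.
apply: le_trans (IH L.+1); rewrite totalS mulrC.
have := mulr_ge0 (ltW w0) (total_ge0 L k); lra.
Qed.

Let total_cvg k : cvgn (total ^~ k).
Proof.
apply: nondecreasing_is_cvgn; first by move=> L L'; exact: total_le.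
by have [C hC] := total_bounded k; exists C => _ [L _ <-].
Qed.

Let mean (k : nat) : R := limn (total ^~ k).
Let diff (k : nat) : R := mean k.+1 - mean k.

Let mean_eq k : mean k.+1 = 1 + w (- k%:Z) * mean k + (1 - w (- k%:Z)) * mean k.+2.
Proof.
have h : (fun L => total L.+1 k.+1) @ \oo -->
    (1 + w (- k%:Z) * mean k + (1 - w (- k%:Z)) * mean k.+2).
  under eq_fun do rewrite totalS.
  apply: cvgD; [apply: cvgD; [exact: cvg_cst|]|]; apply: cvgMr; exact: total_cvg.
have h' : (fun L => total L.+1 k.+1) @ \oo --> mean k.+1.
  by have := @total_cvg k.+1; rewrite -(cvg_shiftS (total ^~ k.+1)).
exact: (cvg_unique _ h' h).
Qed.

Let diff_geN1 k : - 1 <= diff k.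
Proof.
suff : mean k <= 1 + mean k.+1 by rewrite /diff; lra.
have h' : (fun L => total L.+1 k) @ \oo --> mean k.
  by have := @total_cvg k; rewrite -(cvg_shiftS (total ^~ k)).
have h : (fun L => 1 + total L k.+1) @ \oo --> 1 + mean k.+1.
  by apply: cvgD; [exact: cvg_cst|exact: total_cvg].
by apply: (ler_cvg_to h' h); near=> L; exact: total_shift.
Unshelve. all: by end_near. Qed.

Let diff_eq k : diff k = 1 + rho k + rho k * diff k.+1.
Proof.
rewrite /diff; have := mean_eq k; have := w_rho k.
set m0 := mean k; set m1 := mean k.+1; set m2 := mean k.+2.
have /andP[w0 w1] := w01 (- k%:Z).
move=> wr e; apply: (mulfI (lt0r_neq0 w0)).
transitivity (w (- k%:Z) * (1 + rho k) + (w (- k%:Z) * (1 + rho k) - w (- k%:Z)) * (m2 - m1)); last by ring.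
rewrite wr; lra.
Qed.

(* A negative [diff k] would make [diff k.+1 < -1]. *)
Let diff_ge0 k : 0 <= diff k.
Proof.
have := diff_eq k; have := diff_geN1 k.+1; have := rho_gt0 k; nra.
Qed.

(** The increments [diff] of the limiting means solve the recursion that [back] truncates with
    remainder 0; being nonnegative, they dominate every truncation, and [diff 0] is the mean from
    distance 1. *)
Lemma back_le_bound N : back N 0 <= B.
Proof.
have h k : back N k <= diff k.
  elim: N k => [|N IH] k; first exact: diff_ge0.
  rewrite /= -/(rho k) diff_eq; have := IH k.+1; have := rho_gt0 k; nra.
apply: (le_trans (h 0%N)); rewrite /diff.
have -> : mean 0 = 0.
  by rewrite /mean (_ : total ^~ 0%N = cst 0) ?lim_cst//; apply/funext => L; exact: total0.
rewrite subr0; apply: limr_le; first exact: total_cvg.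
by near=> L; exact: total_bound.
Unshelve. all: by end_near. Qed.

End FiniteMean.

Lemma mean_hitting_time :
  (\int[Q]_s hitting_time R (fun l => X l s) 1%R =
   ereal_sup (range (fun N => (back N 0)%:E)))%E.
Proof.
rewrite integral_hitting_time.
have m0 l : 0 <= miss l 0 by have := miss_nat_ge0 l 1; rewrite /miss_nat subrr.
have tot L : total L 1 = \sum_(0 <= l < L) miss l 0.
  by rewrite /total big_mkord; apply: eq_bigr => l _; rewrite /miss_nat subrr.
apply/eqP; rewrite eq_le; apply/andP; split.
  apply: lime_le; first by apply: is_cvg_nneseries => l _ _; rewrite lee_fin.
  near=> L; rewrite sumEFin -tot.
  apply: (@le_trans _ _ (back L.+1 0)%:E); first by rewrite lee_fin total_le_back.
  by apply: ereal_sup_ubound; exists L.+1.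
apply: ge_ereal_sup => _ [N _ <-].
set U := (\sum_(_ <= _ <oo) _)%E.
have U0 : (0 <= U)%E by apply: nneseries_ge0 => l _ _; rewrite lee_fin.
move: U0; case Uu : U => [u| |]// _; last by rewrite leey.
rewrite lee_fin; apply: back_le_bound => L.
rewrite -lee_fin -Uu tot -sumEFin.
by apply: nneseries_lim_ge => l _ _; rewrite lee_fin.
Unshelve. all: by end_near. Qed.

End WalkOnZ.

(** * Independence *)

Section Independence.
Variables (R : realType) (d : measure_display) (T : measurableType d).
Variables (P : probability T R) (omega : int -> {RV P >-> R}).

(* The cylinders depending on the coordinates in J only. *)
Definition events_of (J : set int) : set (set T) :=
  [set A | exists (F : {fset int}) (B : int -> set R),
     [/\ [set` F] `<=` J, forall i, measurable (B i) &
         A = \bigcap_(i in [set` F]) (omega i @^-1` B i)]].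

Definition known (J : set int) (f : T -> R) :=
  @measurable_fun _ _ (g_sigma_algebraType (events_of J)) R setT f.

Lemma measurable_omega i B : measurable B -> measurable (omega i @^-1` B).
Proof. by move=> mB; rewrite -[X in measurable X]setTI; exact: measurable_funP. Qed.

Lemma events_of_measurable J A : events_of J A -> measurable A.
Proof.
move=> [F [B [_ mB ->]]]; apply: fin_bigcap_measurable => // i _.
exact: measurable_omega.
Qed.

Lemma gen_measurable J A : <<s events_of J >> A -> measurable A.
Proof.
apply: smallest_sub; last exact: events_of_measurable.
exact: sigma_algebra_measurable.
Qed.

Lemma events_of_setI_closed J : setI_closed (events_of J).
Proof.
move=> _ _ [F1 [B1 [F1J mB1 ->]]] [F2 [B2 [F2J mB2 ->]]].
exists (F1 `|` F2)%fset.
exists (fun i => (if i \in F1 then B1 i else setT) `&` (if i \in F2 then B2 i else setT)).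
split.
- by move=> i /=; rewrite inE => /orP[/F1J|/F2J].
- by move=> i; apply: measurableI; case: ifP.
- apply/seteqP; split => t /=.
    by move=> [h1 h2] i _; split; case: ifP => // iF; [exact: h1|exact: h2].
  by move=> h; split => i iF; have := h i; rewrite /= inE iF ?orbT => /(_ isT)[].
Qed.

Lemma knownP J f : known J f <-> forall B, measurable B -> <<s events_of J >> (f @^-1` B).
Proof.
split => h; first by move=> B mB; have := h measurableT B mB; rewrite setTI.
by move=> _ B mB; rewrite setTI; exact: h.
Qed.

Lemma events_ofS J J' : J `<=` J' -> events_of J `<=` events_of J'.
Proof.
by move=> JJ' A [F [B [FJ mB AE]]]; exists F, B; split => //; exact: subset_trans JJ'.
Qed.

Lemma knownS J J' f : J `<=` J' -> known J f -> known J' f.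
Proof.
move=> JJ' /knownP h; apply/knownP => B /h.
by apply: sub_smallest2r => //; exact: events_ofS.
Qed.

Lemma known_measurable J f : known J f -> measurable_fun [set: T] f.
Proof. by move=> /knownP h _ B mB; rewrite setTI; exact: (gen_measurable (h _ mB)). Qed.

Lemma known_omega (J : set int) i : J i -> known J (omega i).
Proof.
move=> Ji; apply/knownP => B mB; apply: sub_sigma_algebra.
exists [fset i]%fset, (fun=> B); split => //.
  by move=> j /=; rewrite inE => /eqP ->.
by rewrite (_ : [set` [fset i]%fset] = [set i]) ?bigcap_set1//;
  apply/seteqP; split => j /=; rewrite inE => /eqP.
Qed.

Lemma known_cst J c : known J (fun=> c).
Proof. exact: measurable_cst. Qed.

Lemma knownD J f g : known J f -> known J g -> known J (fun t => f t + g t).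
Proof. exact: measurable_funD. Qed.

Lemma knownB J f g : known J f -> known J g -> known J (fun t => f t - g t).
Proof. exact: measurable_funB. Qed.

Lemma knownM J f g : known J f -> known J g -> known J (fun t => f t * g t).
Proof. exact: measurable_funM. Qed.

Lemma known_comp J f (g : R -> R) : measurable_fun setT g -> known J f ->
  known J (fun t => g (f t)).
Proof. by move=> mg kf; exact: (measurableT_comp mg kf). Qed.

Lemma known_powR J f p : known J f -> known J (fun t => f t `^ p).
Proof. by move=> kf; apply: (known_comp (measurable_powR p)). Qed.

Lemma knownX J f n : known J f -> known J (fun t => f t ^+ n).
Proof. by move=> kf; elim: n => [|n IH]; [exact: known_cst|rewrite /known; under eq_fun do rewrite exprS; exact: knownM]. Qed.

Lemma known_prod J (r : seq nat) (f : nat -> T -> R) :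
  (forall i, i \in r -> known J (f i)) -> known J (fun t => \prod_(i <- r) f i t).
Proof.
elim: r => [|a r IH] kf.
  by rewrite /known; under eq_fun do rewrite big_nil; exact: known_cst.
rewrite /known; under eq_fun do rewrite big_cons.
apply: knownM; first by apply: kf; rewrite mem_head.
by apply: IH => i ir; apply: kf; rewrite inE ir orbT.
Qed.

Hypothesis iid_omega : iid omega.

Lemma indep_cylinders J1 J2 A1 A2 : J1 `&` J2 = set0 ->
  events_of J1 A1 -> events_of J2 A2 -> P (A1 `&` A2) = (P A1 * P A2)%E.
Proof.
move=> J12 [F1 [B1 [F1J mB1 ->]]] [F2 [B2 [F2J mB2 ->]]].
have [prodP _] := iid_omega.
have F12 i : i \in F1 -> i \in F2 -> False.
  by move=> /F1J ? /F2J ?; have : (J1 `&` J2) i by []; rewrite J12.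
have dF : [disjoint F1 & F2]%fset.
  by apply/fdisjointP => i i1; apply/negP => i2; exact: (F12 i).
pose B i := if i \in F1 then B1 i else B2 i.
rewrite !prodP// (_ : _ `&` _ = \bigcap_(i in [set` (F1 `|` F2)%fset]) (omega i @^-1` B i)).
  rewrite prodP; last by move=> i; rewrite /B; case: ifP.
  rewrite (perm_big (F1 ++ F2))/=.
    rewrite big_cat/=; congr (_ * _)%E; apply: eq_big_seq => i iF; rewrite /B.
      by rewrite iF.
    by case: ifP => // i1; have := F12 i i1 iF.
  apply: uniq_perm; rewrite ?fset_uniq//.
    rewrite cat_uniq !fset_uniq/= andbT; apply/hasPn => i i2.
    by apply/negP => i1; exact: (F12 i).
  by move=> i; rewrite mem_cat inE.
apply/seteqP; split => t /=.
  move=> [h1 h2] i /=; rewrite inE /B => /orP[iF|iF]; first by rewrite iF; exact: h1.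
  by case: ifP => i1; [exact: h1|exact: h2].
move=> h; split => i iF; have := h i; rewrite /= inE iF ?orbT => /(_ isT).
  by rewrite /B iF.
by rewrite /B; case: ifP => // i1; have := F12 i i1 iF.
Qed.

(* Dynkin's pi-lambda argument in the first of the two factors. *)
Lemma indep_extend J A2 : measurable A2 ->
  (forall A1, events_of J A1 -> P (A1 `&` A2) = (P A1 * P A2)%E) ->
  forall A1, <<s events_of J >> A1 -> P (A1 `&` A2) = (P A1 * P A2)%E.
Proof.
move=> mA2 h A1 hA1.
have finP X : measurable X -> P X = (fine (P X))%:E.
  by move=> mX; rewrite fineK//; exact: fin_num_measure.
pose Pr (A : set (g_sigma_algebraType (events_of J))) := P (A `&` A2) = (P A * P A2)%E.
apply: (@dynkin_induction _ (g_sigma_algebraType (events_of J)) (events_of J) Pr) => //.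
- exact: events_of_setI_closed.
- by rewrite /Pr setTI probability_setT mul1e.
- move=> A mA; rewrite /Pr => hA.
  have mA' : measurable (A : set T) by exact: gen_measurable mA.
  have -> : P (~` A `&` A2) = (P A2 - P (A `&` A2))%E.
    rewrite setIC -setDE measureD//; first by rewrite setIC.
    by rewrite (le_lt_trans (probability_le1 _ _))// ltry.
  rewrite hA probability_setC// (finP _ mA') (finP _ mA2).
  move: (fine _) (fine _) => a a2.
  suff : ((a2 - a * a2)%:E = ((1 - a) * a2)%:E)%E by [].
  by congr EFin; ring.
- move=> F mF tF; rewrite /Pr => hF.
  have mF' n : measurable (F n : set T) by exact: gen_measurable (mF n).
  rewrite setI_bigcupl.
  have -> : P (\bigcup_i (F i `&` A2)) =
      (\sum_(0 <= i <oo | i \in [set: nat]) ((fine (P A2))%:E * P (F i)))%E.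
    rewrite measure_bigcup//; first last.
    + by apply: trivIset_setIr.
    + by move=> n _; apply: measurableI.
    by apply: eq_eseriesr => n _; rewrite muleC -(finP _ mA2); exact: hF.
  have -> : P (\bigcup_k F k) = (\sum_(0 <= i <oo | i \in [set: nat]) P (F i))%E.
    by rewrite measure_bigcup.
  by rewrite nneseriesZl// muleC -(finP _ mA2).
Qed.

Lemma indep_events J1 J2 A1 A2 : J1 `&` J2 = set0 ->
  <<s events_of J1 >> A1 -> <<s events_of J2 >> A2 -> P (A1 `&` A2) = (P A1 * P A2)%E.
Proof.
move=> J12 hA1 hA2.
apply: (indep_extend (gen_measurable hA2) _ hA1) => A eA.
rewrite setIC muleC.
apply: (indep_extend (events_of_measurable eA) _ hA2) => B eB.
by rewrite setIC muleC; exact: (indep_cylinders J12 eA eB).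
Qed.

Definition same_law (f g : T -> R) :=
  forall B, measurable B -> P (f @^-1` B) = P (g @^-1` B).

(** With [f = f'] and [g = g'] this is independence; with other variables of the same laws it
    transports joint laws, as [same_lawM] requires. *)
Lemma joint_law (f g f' g' : {RV P >-> R}) J1 J2 (X : set (R * R)) :
  J1 `&` J2 = set0 -> known J1 f' -> known J2 g' ->
  same_law f f' -> same_law g g' -> measurable X ->
  (distribution P f \x distribution P g)%E X = P ((fun t => (f' t, g' t)) @^-1` X).
Proof.
move=> J12 /knownP kf /knownP kg ff' gg' mX.
have mfg : measurable_fun [set: T] (fun t => (f' t, g' t)).
  by apply: measurable_fun_pair; exact: measurable_funP.
pose fg : {mfun T >-> (R * R)%type} := HB.pack (fun t => (f' t, g' t))
  (isMeasurableFun.Build _ _ _ _ _ mfg).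
have := @product_measure_unique _ _ _ _ _ (distribution P f) (distribution P g)
  (distribution P fg); apply => //.
move=> A B mA mB.
rewrite [RHS](_ : _ = (P (f' @^-1` A) * P (g' @^-1` B))%E); last first.
  by congr (_ * _)%E; [exact: ff'|exact: gg'].
exact: (indep_events J12 (kf _ mA) (kg _ mB)).
Qed.

Lemma integral_indep (f g : T -> R) J1 J2 (h : R * R -> \bar R) :
  J1 `&` J2 = set0 -> known J1 f -> known J2 g ->
  measurable_fun setT h -> (forall x, 0 <= h x)%E ->
  (\int[P]_t h (f t, g t) = \int[P]_t \int[P]_s h (f t, g s))%E.
Proof.
move=> J12 kf kg mh h0.
have mf := known_measurable kf; have mg := known_measurable kg.
pose F : {RV P >-> R} := HB.pack f (isMeasurableFun.Build _ _ _ _ _ mf).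
pose G : {RV P >-> R} := HB.pack g (isMeasurableFun.Build _ _ _ _ _ mg).
have mfg : measurable_fun [set: T] (fun t => (f t, g t)).
  exact: measurable_fun_pair.
transitivity (\int[pushforward P (fun t => (f t, g t))]_z h z)%E.
  by rewrite ge0_integral_pushforward.
transitivity (\int[distribution P F \x distribution P G]_z h z)%E.
  apply: eq_measure_integral => A mA _; apply/esym.
  exact: (@joint_law F G F G J1 J2).
rewrite fubini_tonelli1// /fubini_F.
rewrite (@ge0_integral_distribution _ _ _ _ _ P F)//; last first.
- by move=> y; apply: integral_ge0.
- exact: measurable_fun_fubini_tonelli_F.
apply: eq_integral => t _ /=.
rewrite (@ge0_integral_distribution _ _ _ _ _ P G)//.
exact: measurableT_comp.
Qed.

Lemma integralM_indep (f g : T -> R) J1 J2 :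
  J1 `&` J2 = set0 -> known J1 f -> known J2 g ->
  (forall t, 0 <= f t) -> (forall t, 0 <= g t) ->
  (\int[P]_t (f t * g t)%:E = \int[P]_t (f t)%:E * \int[P]_t (g t)%:E)%E.
Proof.
move=> J12 kf kg f0 g0.
have mf := known_measurable kf; have mg := known_measurable kg.
(* [integral_indep] asks for an integrand that is nonnegative on the whole plane, hence the absolute
   value. *)
transitivity (\int[P]_t `|(f t, g t).1 * (f t, g t).2|%:E)%E.
  by apply: eq_integral => t _ /=; rewrite ger0_norm// mulr_ge0.
rewrite (@integral_indep f g J1 J2 (fun z => `|z.1 * z.2|%:E))//; last first.
  apply/measurable_EFinP/measurableT_comp => //.
  by apply: measurable_funM; [exact: measurable_fst|exact: measurable_snd].
transitivity (\int[P]_t ((f t)%:E * \int[P]_s (g s)%:E))%E.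
  apply: eq_integral => t _; rewrite -ge0_integralZl//; last 3 first.
  - by apply/measurable_EFinP.
  - by move=> s _; rewrite lee_fin.
  - by rewrite lee_fin.
  by apply: eq_integral => s _; rewrite /= ger0_norm ?mulr_ge0// EFinM.
rewrite ge0_integralZr//; first exact/measurable_EFinP.
  by move=> t _; rewrite lee_fin.
by apply: integral_ge0 => s _; rewrite lee_fin.
Qed.

Lemma same_lawM (f g f' g' : T -> R) J1 J2 J1' J2' :
  J1 `&` J2 = set0 -> J1' `&` J2' = set0 ->
  known J1 f -> known J2 g -> known J1' f' -> known J2' g' ->
  same_law f f' -> same_law g g' ->
  same_law (fun t => f t * g t) (fun t => f' t * g' t).
Proof.
move=> J12 J12' kf kg kf' kg' ff' gg' B mB.
pose F : {RV P >-> R} := HB.pack f (isMeasurableFun.Build _ _ _ _ _ (known_measurable kf)).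
pose G : {RV P >-> R} := HB.pack g (isMeasurableFun.Build _ _ _ _ _ (known_measurable kg)).
pose F' : {RV P >-> R} := HB.pack f' (isMeasurableFun.Build _ _ _ _ _ (known_measurable kf')).
pose G' : {RV P >-> R} := HB.pack g' (isMeasurableFun.Build _ _ _ _ _ (known_measurable kg')).
pose X := (fun z : R * R => z.1 * z.2) @^-1` B.
have mX : measurable X.
  rewrite -[X]setTI; apply: (_ : measurable_fun setT _) => //.
  by apply: measurable_funM; [exact: measurable_fst|exact: measurable_snd].
transitivity ((distribution P F \x distribution P G)%E X).
  by apply/esym; exact: (@joint_law F G F G J1 J2).
exact: (@joint_law F G F' G' J1' J2').
Qed.

Lemma same_law_integral (f g : T -> R) (h : R -> \bar R) :
  measurable_fun setT f -> measurable_fun setT g -> same_law f g ->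
  measurable_fun setT h -> (forall x, 0 <= h x)%E ->
  (\int[P]_t h (f t) = \int[P]_t h (g t))%E.
Proof.
move=> mf mg fg mh h0.
transitivity (\int[pushforward P f]_x h x)%E; first by rewrite ge0_integral_pushforward.
transitivity (\int[pushforward P g]_x h x)%E; last by rewrite ge0_integral_pushforward.
apply: eq_measure_integral => A mA _; exact: fg.
Qed.

Lemma same_law_comp (f g : T -> R) (u : R -> R) : measurable_fun setT u ->
  same_law f g -> same_law (fun t => u (f t)) (fun t => u (g t)).
Proof.
move=> mu fg B mB; have := fg (u @^-1` B); rewrite -[u @^-1` B]setTI.
by move=> /(_ (mu measurableT _ mB)); rewrite setTI.
Qed.

Lemma same_law_omega i j : same_law (omega i) (omega j).
Proof. by have [_ h] := iid_omega => B mB; exact: h. Qed.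

End Independence.

(** * Moments and almost sure growth of the crossing times *)

Section PowerInequalities.
Variable R : realType.
Implicit Types x y z p q : R.

Lemma powR_young z q : 0 <= z -> 0 <= q <= 1 -> z `^ q <= q * z + (1 - q).
Proof.
rewrite le_eqVlt => /predU1P[<-|z0] /andP[q0 q1].
  have [->|qn0] := eqVneq q 0; first by rewrite powRr0; lra.
  by rewrite powR0//; lra.
have -> : z = expR (ln z) by rewrite lnK.
set a := ln z; rewrite -expRM; set b := a * q.
have eb : 0 < expR b by exact: expR_gt0.
have -> : expR a = expR b * expR ((1 - q) * a).
  by rewrite -expRD /b; congr expR; ring.
(* The tangent of exp at [b = a * q] lies below exp at [a] and at 0; averaging with weights [q] and
   [1 - q] cancels the linear terms. *)
have h1 := expR_ge1Dx ((1 - q) * a).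
have h2 : 1 >= expR b * (1 - b).
  rewrite -[leRHS](@expR0 R) -(subrr b) expRD ler_wpM2l//.
  by have := expR_ge1Dx (- b); lra.
have h3 : q * (expR b * (1 + (1 - q) * a)) <= q * (expR b * expR ((1 - q) * a)).
  by apply: ler_wpM2l => //; apply: ler_wpM2l => //; exact: ltW.
have h4 : (1 - q) * (expR b * (1 - b)) <= (1 - q) * 1 by rewrite ler_wpM2l// subr_ge0.
suff : expR b = q * (expR b * (1 + (1 - q) * a)) + (1 - q) * (expR b * (1 - b)) by lra.
by rewrite /b; ring.
Qed.

Lemma powRD_le1 x y q : 0 <= x -> 0 <= y -> 0 < q <= 1 ->
  (x + y) `^ q <= x `^ q + y `^ q.
Proof.
move=> x0 y0 /andP[q0 q1].
have [s0|sn0] := eqVneq (x + y) 0.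
  by rewrite s0 powR0 ?gt_eqF// addr_ge0// powR_ge0.
have s0 : 0 < x + y by rewrite lt_neqAle eq_sym sn0 addr_ge0.
have H u : 0 <= u -> u <= x + y -> (x + y) `^ q * (u / (x + y)) <= u `^ q.
  rewrite le_eqVlt => /predU1P[<-|u0] us; first by rewrite mul0r mulr0 powR_ge0.
  rewrite -[X in _ <= X `^ q](divfK (lt0r_neq0 s0)) mulrC.
  rewrite powRM ?(ltW s0) ?divr_ge0 ?(ltW u0) ?(ltW s0)//.
  rewrite ler_wpM2r ?powR_ge0// ger1_powR//.
  by rewrite divr_gt0//= ler_pdivrMr// mul1r.
have := H x x0; have := H y y0; rewrite lerDl lerDr => /(_ x0) h1 /(_ y0) h2.
have -> : (x + y) `^ q = (x + y) `^ q * (x / (x + y)) + (x + y) `^ q * (y / (x + y)).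
  by field.
exact: lerD.
Qed.

Lemma powR_sum_le1 (I : Type) (r : seq I) (F : I -> R) q : (forall i, 0 <= F i) ->
  0 < q <= 1 -> (\sum_(i <- r) F i) `^ q <= \sum_(i <- r) F i `^ q.
Proof.
move=> F0 q01; elim: r => [|a r IH].
  by rewrite !big_nil powR0// gt_eqF//; case/andP: q01.
rewrite !big_cons; apply: (le_trans (powRD_le1 _ _ q01)) => //.
  exact: sumr_ge0.
by rewrite lerD2l.
Qed.

(** All the loss is put on [x]: the constant on [y] must be close to 1 for a moment smaller than 1
    to remain a contraction. *)
Lemma powRD_le p (eta : R) : 0 < p -> 0 < eta -> exists2 C : R, 0 <= C &
  forall x y, 0 <= x -> 0 <= y -> (x + y) `^ p <= C * x `^ p + (1 + eta) * y `^ p.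
Proof.
move=> p0 eta0; pose delta := (1 + eta) `^ p^-1 - 1.
have e0 : 0 <= 1 + eta by lra.
have delta0 : 0 < delta.
  have : 1 `^ p^-1 < (1 + eta) `^ p^-1.
    by apply: gt0_ltr_powR; rewrite ?invr_gt0 ?nnegrE//; lra.
  by rewrite powR1 subr_gt0.
have dp : (1 + delta) `^ p = 1 + eta.
  by rewrite /delta addrC subrK -powRrM mulVf ?gt_eqF// powRr1.
clearbody delta; exists ((1 + delta^-1) `^ p); first exact: powR_ge0.
move=> x y x0 y0; have d1 : 0 <= 1 + delta^-1 by rewrite addr_ge0// invr_ge0 ltW.
have d2 : 0 <= 1 + delta by lra.
have [xy|yx] := leP x (delta * y).
  apply: (@le_trans _ _ ((1 + delta) * y `^ p * 0 + (1 + eta) * y `^ p)); last first.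
    by rewrite mulr0 add0r lerDr mulr_ge0 ?powR_ge0.
  rewrite mulr0 add0r -dp -powRM//.
  apply: ge0_ler_powR; rewrite ?nnegrE ?(mulr_ge0 d2 y0) ?(addr_ge0 x0 y0) ?(ltW p0)//.
  by rewrite mulrDl mul1r addrC lerD2l.
apply: (@le_trans _ _ ((1 + delta^-1) `^ p * x `^ p)); last first.
  by rewrite lerDl mulr_ge0 ?powR_ge0.
rewrite -powRM//; apply: ge0_ler_powR; rewrite ?nnegrE ?(mulr_ge0 d1 x0) ?(addr_ge0 x0 y0) ?(ltW p0)//.
rewrite mulrDl mul1r lerD2l mulrC ler_pdivlMr// mulrC; exact: ltW.
Qed.

(** If [x <= 2 * |y|] (with [x >= 0]), the left side is at most 3^p |y|^p <= 9 |y|^p and the linear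
    term at most 4 |y|^p in size, whence 13. Otherwise one divides by [x] and bounds (1 + u)^(p-1)
    by its tangent; the error u^2 is at most |u|^p. *)
Lemma powR_norm_taylor p x y : 1 < p <= 2 ->
  `|x + y| `^ p <= `|x| `^ p + p * Num.sg x * `|x| `^ (p - 1) * y + 13 * `|y| `^ p.
Proof.
move=> /andP[p1 p2]; have p0 : 0 < p by lra.
wlog x0 : x y / 0 <= x.
  move=> H; have [/H//|x0] := leP 0 x.
  have := H (- x) (- y); rewrite oppr_ge0 ltW// => /(_ isT).
  rewrite -opprD !normrN sgrN => /le_trans; apply.
  by rewrite !mulrN !mulNr !opprK.
rewrite (ger0_norm x0).
have [xy|yx] := leP x (2 * `|y|).
  have h1 : `|x + y| `^ p <= 9 * `|y| `^ p.
    apply: (@le_trans _ _ ((3 * `|y|) `^ p)).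
      apply: ge0_ler_powR; rewrite ?nnegrE ?mulr_ge0 ?(ltW p0)//.
      by apply: (le_trans (ler_normD _ _)); rewrite (ger0_norm x0); lra.
    rewrite powRM// ler_wpM2r ?powR_ge0//.
    have -> : 9 = 3 `^ 2 :> R by rewrite powR_mulrn//; ring.
    by apply: ler_powR => //; lra.
  have h2 : `|p * Num.sg x * x `^ (p - 1) * y| <= 4 * `|y| `^ p.
    rewrite !normrM (ger0_norm (ltW p0)) (ger0_norm (powR_ge0 _ _)).
    have s1 : `|Num.sg x| <= 1 by rewrite normr_sg lern1 leq_b1.
    apply: (@le_trans _ _ (2 * 1 * (2 * `|y|) `^ (p - 1) * `|y|)).
      apply: ler_wpM2r => //; apply: ler_pM; rewrite ?mulr_ge0 ?powR_ge0 ?(ltW p0)//.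
        by apply: ler_pM => //; exact: ltW.
      by apply: ge0_ler_powR; rewrite ?nnegrE ?mulr_ge0//; lra.
    rewrite powRM// -!mulrA mul1r [_ * `|y|]mulrC mulr_powRB1//.
    rewrite mulrA; apply: ler_wpM2r; first exact: powR_ge0.
    have : 2 `^ (p - 1) <= 2 :> R.
      by rewrite -[leRHS]powRr1//; apply: ler_powR; lra.
    lra.
  have := powR_ge0 x p; move: h2; rewrite ler_norml => /andP[h2 _]; lra.
have {}x0 : 0 < x by apply: le_lt_trans yx; rewrite mulr_ge0.
rewrite gtr0_sg// mulr1.
pose u := y / x; have yE : y = x * u by rewrite /u mulrCA divff ?mulr1// gt_eqF.
have u1 : `|u| < 1.
  rewrite /u normrM normfV (gtr0_norm x0) ltr_pdivrMr// mul1r; have := normr_ge0 y; lra.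
clearbody u.
have u1' : -1 < u < 1 by rewrite -ltr_norml.
have u0 : 0 < 1 + u by case/andP: u1' => ? ?; lra.
have -> : x + y = x * (1 + u) by rewrite yE; ring.
rewrite yE !normrM !(gtr0_norm x0) (gtr0_norm u0) !powRM ?(ltW x0) ?(ltW u0)//.
have -> : p * x `^ (p - 1) * (x * u) = x `^ p * (p * u).
  by rewrite -(mulr_powRB1 (ltW x0) p0); ring.
rewrite [13 * _]mulrCA -[X in X + _ + _]mulr1 -!mulrDr ler_wpM2l ?powR_ge0//.
have b : (1 + u) `^ (p - 1) <= 1 + (p - 1) * u.
  have := @powR_young (1 + u) (p - 1) (ltW u0).
  have -> : (0 <= p - 1 <= 1) by lra.
  by move=> /(_ isT); lra.
have u2 : u ^+ 2 <= `|u| `^ p.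
  rewrite -real_normK ?num_real// -powR_mulrn//.
  have [->|un0] := eqVneq u 0; first by rewrite normr0 !powR0// gt_eqF.
  by apply: ger_powR; rewrite ?normr_gt0 ?un0 ?(ltW u1).
rewrite -(mulr_powRB1 (ltW u0) p0).
have : (1 + u) * (1 + u) `^ (p - 1) <= (1 + u) * (1 + (p - 1) * u).
  by rewrite ler_wpM2l// ltW.
have : (p - 1) * u ^+ 2 <= 1 * u ^+ 2 by rewrite ler_wpM2r ?sqr_ge0//; lra.
have := powR_ge0 `|u| p; rewrite expr2 in u2 *; nra.
Qed.

End PowerInequalities.

Section AlmostSureConvergence.
Variables (R : realType) (d : measure_display) (T : measurableType d).
Variable P : probability T R.

(* Tonelli: the sum of the W n has finite expectation, hence is finite almost surely. *)
Lemma ae_cvg0 (W : nat -> T -> R) (c : nat -> R) :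
  (forall n, measurable_fun setT (W n)) -> (forall n t, 0 <= W n t) ->
  (forall n, (\int[P]_t (W n t)%:E <= (c n)%:E)%E) -> cvgn (series c) ->
  {ae P, forall t, W n t @[n --> \oo] --> 0}.
Proof.
move=> mW W0 Wc cc.
have mS : measurable_fun setT (fun t => \sum_(n <oo) (W n t)%:E)%E.
  apply: ge0_emeasurable_sum => [n t _ _|n _]; first by rewrite lee_fin.
  exact/measurable_EFinP.
have S0 t : (0 <= \sum_(n <oo) (W n t)%:E)%E.
  by apply: nneseries_ge0 => n _ _; rewrite lee_fin.
have iS : P.-integrable setT (fun t => \sum_(n <oo) (W n t)%:E)%E.
  apply/integrableP; split => //.
  under eq_integral do rewrite gee0_abs//.
  rewrite integral_nneseries//; last 2 first.
  - by move=> n; apply/measurable_EFinP.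
  - by move=> n t _; rewrite lee_fin.
  apply: (@le_lt_trans _ _ (limn (series c))%:E); last exact: ltry.
  apply: lime_le.
    by apply: is_cvg_nneseries => n _ _; apply: integral_ge0 => t _; rewrite lee_fin.
  near=> N.
  apply: (@le_trans _ _ (\sum_(0 <= n < N) (c n)%:E)%E); first exact: lee_sum.
  rewrite sumEFin lee_fin; apply: nondecreasing_cvgn_le => //.
  apply: nondecreasing_series => n _ _.
  by rewrite -lee_fin; apply: le_trans (Wc n); apply: integral_ge0 => t _; rewrite lee_fin.
apply: filterS (integrable_ae measurableT iS) => t /(_ I) fS.
apply: cvg_series_cvg_0; apply: nondecreasing_is_cvgn.
  by apply: nondecreasing_series => n _ _.
exists (fine (\sum_(n <oo) (W n t)%:E)%E) => _ [N _ <-].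
rewrite -lee_fin fineK// /series/= -sumEFin.
by apply: nneseries_lim_ge => n _ _; rewrite lee_fin.
Unshelve. all: by end_near. Qed.

End AlmostSureConvergence.

Section Expectation.
Variables (R : realType) (d : measure_display) (T : measurableType d).
Variable P : probability T R.
Implicit Types f g : T -> R.

Definition mean f : \bar R := (\int[P]_t (f t)%:E)%E.

Lemma mean_ge0 f : (forall t, 0 <= f t) -> (0 <= mean f)%E.
Proof. by move=> f0; apply: integral_ge0 => t _; rewrite lee_fin. Qed.

Lemma mean_cst (c : R) : mean (fun=> c) = c%:E.
Proof. by rewrite /mean integral_cst// -[RHS]mule1; congr (_ * _)%E; exact: probability_setT. Qed.

Lemma mean_le f g : (forall t, 0 <= f t) -> measurable_fun setT f ->
  measurable_fun setT g -> (forall t, f t <= g t) -> (mean f <= mean g)%E.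
Proof.
move=> f0 mf mg fg; apply: ge0_le_integral => //.
- by move=> t _; rewrite lee_fin.
- exact/measurable_EFinP.
- exact/measurable_EFinP.
- by move=> t _; rewrite lee_fin.
Qed.

Lemma meanD f g : (forall t, 0 <= f t) -> (forall t, 0 <= g t) ->
  measurable_fun setT f -> measurable_fun setT g ->
  mean (fun t => f t + g t) = (mean f + mean g)%E.
Proof.
move=> f0 g0 mf mg; rewrite /mean; under eq_integral do rewrite EFinD.
rewrite ge0_integralD//; try exact/measurable_EFinP.
all: by move=> t _; rewrite lee_fin.
Qed.

Lemma meanZ (c : R) f : 0 <= c -> (forall t, 0 <= f t) -> measurable_fun setT f ->
  mean (fun t => c * f t) = (c%:E * mean f)%E.
Proof.
move=> c0 f0 mf; rewrite /mean; under eq_integral do rewrite EFinM.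
rewrite ge0_integralZl//; first exact/measurable_EFinP.
by move=> t _; rewrite lee_fin.
Qed.

Lemma mean_sum (I : Type) (r : seq I) (f : I -> T -> R) :
  (forall i t, 0 <= f i t) -> (forall i, measurable_fun setT (f i)) ->
  mean (fun t => \sum_(i <- r) f i t) = (\sum_(i <- r) mean (f i))%E.
Proof.
move=> f0 mf; rewrite /mean; under eq_integral do rewrite -sumEFin.
rewrite ge0_integral_sum//; first by move=> i; exact/measurable_EFinP.
by move=> i t _; rewrite lee_fin.
Qed.

Lemma mean_finite f (B : R) : (forall t, 0 <= f t) -> (mean f <= B%:E)%E ->
  exists2 m : R, mean f = m%:E & 0 <= m <= B.
Proof.
move=> f0 fB; have m0 := mean_ge0 f0.
have ff : mean f \is a fin_num by rewrite ge0_fin_numE// (le_lt_trans fB)// ltry.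
by exists (fine (mean f)); rewrite ?fine_ge0//= -?lee_fin fineK.
Qed.

End Expectation.

(** * Moments of the crossing times *)

Section Moments.
Variables (R : realType) (d : measure_display) (T : measurableType d).
Variables (P : probability T R) (omega : int -> {RV P >-> R}).
Hypothesis iid_omega : iid omega.
Hypothesis omega01 : forall k t, 0 < omega k t < 1.

Definition env (t : T) (k : int) : R := omega k t.
Definition rho (i : int) (t : T) : R := odds (env t) i.
Definition past (j : nat) : set int := [set i | 0 < i <= j%:Z].

Let K := known omega.
Let mu := mean P.

Lemma rho_gt0 i t : 0 < rho i t.
Proof. by apply: odds_gt0 => k; exact: omega01. Qed.

Let rho_ge0 i t : 0 <= rho i t. Proof. exact/ltW/rho_gt0. Qed.

Definition odds_fun (x : R) : R := (1 - x) * x `^ (-1).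

Lemma measurable_odds_fun : measurable_fun setT odds_fun.
Proof.
apply: measurable_funM; last exact: measurable_powR.
by apply: measurable_funB; [exact: measurable_cst|exact: measurable_id].
Qed.

Lemma rhoE i t : rho i t = odds_fun (omega i t).
Proof.
by rewrite /odds_fun powR_inv1//; have /andP[/ltW] := omega01 i t.
Qed.

Lemma known_rho (J : set int) i : J i -> K J (rho i).
Proof.
move=> Ji; rewrite /K (_ : rho i = fun t => odds_fun (omega i t)); last first.
  by apply/funext => t; rewrite rhoE.
exact: known_comp measurable_odds_fun (known_omega Ji).
Qed.

Lemma measurable_rho i : measurable_fun setT (rho i).
Proof. exact: (known_measurable (@known_rho setT i I)). Qed.

Lemma same_law_rho i j : same_law P (rho i) (rho j).
Proof.
have E k : rho k = fun t => odds_fun (omega k t) by apply/funext => t; rewrite rhoE.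
rewrite !E; apply: same_law_comp measurable_odds_fun _; exact: same_law_omega.
Qed.

Definition moment (s : R) : \bar R := mu (fun t => rho 0 t `^ s).

Lemma measurable_powR_fun (f : T -> R) s : measurable_fun setT f ->
  measurable_fun setT (fun t => f t `^ s).
Proof. by move=> mf; exact: (measurableT_comp (measurable_powR s) mf). Qed.

Lemma mean_rho_powR i s : mu (fun t => rho i t `^ s) = moment s.
Proof.
apply: (@same_law_integral _ _ _ P (rho i) (rho 0) (fun x => (x `^ s)%:E)).
- exact: measurable_rho.
- exact: measurable_rho.
- exact: same_law_rho.
- by apply/measurable_EFinP; exact: measurable_powR.
- by move=> x; rewrite lee_fin powR_ge0.
Qed.

Lemma disjoint_past j : [set j.+1%:Z] `&` past j = set0.
Proof. by rewrite -subset0 => i [/= ->] /andP[_]; lia. Qed.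

Lemma pastS j : past j `<=` past j.+1.
Proof. by move=> i; rewrite /past/=; lia. Qed.

Lemma past_last j : past j.+1 j.+1%:Z.
Proof. by rewrite /past/=; lia. Qed.

Lemma mean_rhoM j s (Z : T -> R) : (forall t, 0 <= Z t) -> K (past j) Z ->
  mu (fun t => rho j.+1%:Z t `^ s * Z t) = (moment s * mu Z)%E.
Proof.
move=> Z0 kZ; rewrite -(mean_rho_powR j.+1%:Z).
apply: (integralM_indep iid_omega (disjoint_past j)) => //.
  by apply: known_powR; exact: known_rho.
by move=> t; exact: powR_ge0.
Qed.

(** [rho j.+1] is independent of [Z j], so by [powRD_le] the moment of order [s] obeys an affine
    recursion with factor [(1 + eta) * r]; [eta] is chosen so that this is smaller than 1. *)
Lemma moment_recursion (Z W : nat -> T -> R) (s r w z : R) :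
  0 < s -> moment s = r%:E -> r < 1 ->
  (forall j t, 0 <= Z j t) -> (forall j, K (past j) (Z j)) ->
  (forall j t, 0 <= W j t) -> (forall j, measurable_fun setT (W j)) ->
  (forall j t, Z j.+1 t <= W j t + rho j.+1%:Z t * Z j t) ->
  (forall j, mu (fun t => (W j t `^ s)%R) <= w%:E)%E ->
  (mu (fun t => (Z 0%N t `^ s)%R) <= z%:E)%E ->
  exists C : R, forall j, (mu (fun t => (Z j t `^ s)%R) <= C%:E)%E.
Proof.
move=> s0 rE r1 Z0 kZ W0 mW ZW Ww Zz.
have r0 : 0 <= r.
  by rewrite -lee_fin -rE; apply: mean_ge0 => t; exact: powR_ge0.
pose eta := (1 - r) / 2; have eta0 : 0 < eta by rewrite /eta; lra.
have er : (1 + eta) * r < 1 by rewrite /eta; nra.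
have [C1 C10 hC1] := powRD_le s0 eta0.
have w0 : 0 <= w.
  by rewrite -lee_fin; apply: le_trans (Ww 0%N); apply: mean_ge0 => t; exact: powR_ge0.
(* The larger of the initial bound and the fixed point of the affine recursion is preserved by
   it. *)
pose B := Num.max z (C1 * w / (1 - (1 + eta) * r)).
have B2 : C1 * w + (1 + eta) * r * B <= B.
  have : C1 * w / (1 - (1 + eta) * r) <= B by rewrite le_max lexx orbT.
  by rewrite ler_pdivrMr ?subr_gt0//; lra.
exists B; elim=> [|j IH]; first by apply: (le_trans Zz); rewrite lee_fin le_max lexx.
have mZ k : measurable_fun setT (Z k) by exact: (known_measurable (kZ k)).
apply: (@le_trans _ _ (mu (fun t => C1 * W j t `^ s + (1 + eta) * (rho j.+1%:Z t `^ s * Z j t `^ s)))).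
  apply: mean_le.
  - by move=> t; exact: powR_ge0.
  - exact: measurable_powR_fun.
  - apply: measurable_funD; apply: measurable_funM => //; first exact: measurable_powR_fun.
    by apply: measurable_funM; apply: measurable_powR_fun => //; exact: measurable_rho.
  - move=> t; apply: (@le_trans _ _ ((W j t + rho j.+1%:Z t * Z j t) `^ s)).
      by apply: ge0_ler_powR; rewrite ?nnegrE ?(ltW s0)// addr_ge0// mulr_ge0.
    by rewrite -powRM//; apply: hC1 => //; rewrite mulr_ge0.
have e0 : 0 <= 1 + eta by lra.
rewrite /mu meanD; first last.
- apply: measurable_funM => //.
  by apply: measurable_funM; apply: measurable_powR_fun => //; exact: measurable_rho.
- by apply: measurable_funM => //; exact: measurable_powR_fun.
- by move=> t; rewrite !mulr_ge0 ?powR_ge0.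
- by move=> t; rewrite mulr_ge0 ?powR_ge0.
rewrite !meanZ//; first last.
- exact: measurable_powR_fun.
- by move=> t; exact: powR_ge0.
- by apply: measurable_funM; apply: measurable_powR_fun => //; exact: measurable_rho.
- by move=> t; rewrite !mulr_ge0 ?powR_ge0.
rewrite -/mu mean_rhoM; [|by move=> t; exact: powR_ge0|by apply: known_powR; exact: kZ].
apply: (@le_trans _ _ (C1%:E * w%:E + (1 + eta)%:E * (r%:E * B%:E))%E); last first.
  by rewrite -!EFinM -EFinD lee_fin mulrA.
rewrite rE; apply: leeD; first by rewrite lee_wpmul2l ?lee_fin.
by rewrite lee_wpmul2l ?lee_fin// lee_wpmul2l ?lee_fin.
Qed.

Let em (j : nat) (t : T) : R := cross_mean (env t) j.
Let ev (j : nat) (t : T) : R := cross_var (env t) j.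

Let em_ge0 j t : 0 <= em j t.
Proof. by apply: cross_mean_ge0 => k; exact: omega01. Qed.

Let ev_ge0 j t : 0 <= ev j t.
Proof. by apply: cross_var_ge0 => k; exact: omega01. Qed.

Lemma known_cross_mean j : K (past j) (fun t => cross_mean (env t) j).
Proof.
elim: j => [|j IH] /=; first exact: known_cst.
apply: knownD; apply: knownM; first exact: known_cst.
- by apply: knownD; [exact: known_cst|apply: known_rho; exact: past_last].
- by apply: known_rho; exact: past_last.
- by apply: knownS IH; exact: pastS.
Qed.

Lemma known_cross_var j : K (past j) (fun t => cross_var (env t) j).
Proof.
elim: j => [|j IH] /=; first exact: known_cst.
have ke := @knownS _ _ _ _ _ _ _ _ (@pastS j) (@known_cross_mean j).
have kr : K (past j.+1) (rho j.+1%:Z) by apply: known_rho; exact: past_last.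
apply: knownD; [apply: knownD|].
- by apply: knownM => //; apply: knownS IH; exact: pastS.
- exact: (knownX 2 (@known_cross_mean j.+1)).
- by apply: knownM => //; exact: (knownX 2 ke).
Qed.

Let m_em j : measurable_fun setT (em j).
Proof. exact: (known_measurable (@known_cross_mean j)). Qed.

Lemma cross_mean_moment (s r : R) : 0 < s -> moment s = r%:E -> r < 1 ->
  exists C : R, forall j, (mu (fun t => (em j t `^ s)%R) <= C%:E)%E.
Proof.
move=> s0 rE r1.
have [C1 C10 hC1] := powRD_le s0 (ltr01 : 0 < 1 :> R).
pose w := 2 `^ s * (C1 * 1 `^ s + (1 + 1) * r).
apply: (@moment_recursion em (fun j t => 2 * (1 + rho j.+1%:Z t)) s r w (2 `^ s)) => //.
- exact: known_cross_mean.
- by move=> j t; rewrite mulr_ge0// addr_ge0.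
- move=> j; apply: measurable_funM => //; apply: measurable_funD => //.
  exact: measurable_rho.
- move=> j.
  apply: (@le_trans _ _ (mu (fun t => 2 `^ s * (C1 * 1 `^ s + (1 + 1) * rho j.+1%:Z t `^ s)))).
    apply: mean_le.
    + by move=> t; exact: powR_ge0.
    + apply: measurable_powR_fun; apply: measurable_funM => //; apply: measurable_funD => //.
      exact: measurable_rho.
    + apply: measurable_funM => //; apply: measurable_funD => //; apply: measurable_funM => //.
      by apply: measurable_powR_fun; exact: measurable_rho.
    + move=> t; rewrite powRM// ?addr_ge0//; apply: ler_wpM2l; first exact: powR_ge0.
      exact: hC1.
  have mr : measurable_fun setT (fun t => rho j.+1%:Z t `^ s).
    by apply: measurable_powR_fun; exact: measurable_rho.
  rewrite /mu meanZ ?powR_ge0//; last 2 first.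
  + by move=> t; rewrite addr_ge0 ?mulr_ge0 ?powR_ge0.
  + by apply: measurable_funD => //; apply: measurable_funM.
  rewrite meanD//; last 3 first.
  + by move=> t; rewrite mulr_ge0 ?powR_ge0.
  + by move=> t; rewrite mulr_ge0 ?powR_ge0.
  + by apply: measurable_funM.
  rewrite mean_cst meanZ//; last by move=> t; exact: powR_ge0.
  by rewrite -/mu mean_rho_powR rE; exact: lexx.
- rewrite -[X in (_ <= X)%E](mean_cst P); exact: lexx.
Qed.

(** The variance is quadratic in the crossing means, so its moment of order [p / 2] involves theirs
    of order [p], while the contraction is that of [rho] at order [p / 2]. *)
Lemma cross_var_moment (p r r' : R) : 0 < p -> moment p = r%:E -> r < 1 ->
  moment (p / 2) = r'%:E -> r' < 1 ->
  exists C : R, forall j, (mu (fun t => (ev j t `^ (p / 2))%R) <= C%:E)%E.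
Proof.
move=> p0 rE r1 r'E r'1; have s0 : 0 < p / 2 by rewrite divr_gt0.
have [B hB] := cross_mean_moment p0 rE r1.
have [C1 C10 hC1] := powRD_le s0 (ltr01 : 0 < 1 :> R).
have sq (x : R) : 0 <= x -> (x ^+ 2) `^ (p / 2) = x `^ p.
  by move=> x0; rewrite -powR_mulrn// -powRrM mulrC divfK.
have r'0 : 0 <= r'.
  by rewrite -lee_fin -r'E; apply: mean_ge0 => t; exact: powR_ge0.
pose W j t := em j.+1 t ^+ 2 + rho j.+1%:Z t * em j t ^+ 2.
have mX j : measurable_fun setT (fun t => em j t ^+ 2) by exact: measurable_funX.
apply: (@moment_recursion ev W (p / 2) r' (C1 * B + (1 + 1) * (r' * B)) (4 `^ (p / 2))) => //.
- exact: known_cross_var.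
- move=> j t; apply: addr_ge0; first exact: sqr_ge0.
  by apply: mulr_ge0 => //; exact: sqr_ge0.
- move=> j; apply: measurable_funD => //; apply: measurable_funM => //.
  exact: measurable_rho.
- move=> j t; rewrite le_eqVlt; apply/orP; left; apply/eqP.
  transitivity (rho j.+1%:Z t * ev j t + em j.+1 t ^+ 2 + rho j.+1%:Z t * em j t ^+ 2); first by [].
  by rewrite /W; ring.
- move=> j.
  have mp k : measurable_fun setT (fun t => em k t `^ p) by exact: measurable_powR_fun.
  have mr : measurable_fun setT (fun t => rho j.+1%:Z t `^ (p / 2)).
    by apply: measurable_powR_fun; exact: measurable_rho.
  apply: (@le_trans _ _ (mu (fun t => C1 * em j.+1 t `^ p + (1 + 1) * (rho j.+1%:Z t `^ (p / 2) * em j t `^ p)))).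
    apply: mean_le.
    + by move=> t; exact: powR_ge0.
    + apply: measurable_powR_fun; apply: measurable_funD => //; apply: measurable_funM => //.
      exact: measurable_rho.
    + apply: measurable_funD; apply: measurable_funM => //.
      by apply: measurable_funM.
    + move=> t; rewrite -(sq (em j.+1 t))// -(sq (em j t))// -powRM ?sqr_ge0//.
      apply: hC1; first exact: sqr_ge0.
      by apply: mulr_ge0 => //; exact: sqr_ge0.
  rewrite /mu meanD; first last.
  + by apply: measurable_funM => //; apply: measurable_funM.
  + by apply: measurable_funM.
  + by move=> t; rewrite !mulr_ge0 ?powR_ge0.
  + by move=> t; rewrite mulr_ge0 ?powR_ge0.
  rewrite !meanZ//; first last.
  + by move=> t; exact: powR_ge0.
  + by apply: measurable_funM.
  + by move=> t; rewrite mulr_ge0 ?powR_ge0.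
  rewrite -/mu mean_rhoM; last 2 first.
  + by move=> t; exact: powR_ge0.
  + by apply: known_powR; exact: known_cross_mean.
  apply: (@le_trans _ _ (C1%:E * B%:E + (1 + 1)%:E * (r'%:E * B%:E))%E); last exact: lexx.
  rewrite r'E; apply: leeD; first by rewrite lee_wpmul2l ?lee_fin.
  by rewrite lee_wpmul2l ?lee_fin// lee_wpmul2l ?lee_fin.
- by rewrite /mu (_ : (fun t => _) = fun=> 4 `^ (p / 2)) ?mean_cst//; apply/funext => t; congr (_ `^ _); rewrite /ev/=; ring.
Qed.

(** Along powers of 2, the normalised moment is at most C 2^(k (1 - b s)), which is summable;
    monotonicity fills the dyadic gaps. *)
Lemma ae_growth (S : nat -> T -> R) (s b C : R) :
  0 < s -> 1 < b * s -> (forall n, measurable_fun setT (S n)) ->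
  (forall n t, 0 <= S n t) -> (forall n m t, (n <= m)%N -> S n t <= S m t) ->
  (forall n, mu (fun t => (S n t `^ s)%R) <= (n%:R * C)%:E)%E ->
  {ae P, forall t, forall eps, 0 < eps ->
    \forall n \near \oo, S n t <= eps * n%:R `^ b}.
Proof.
move=> s0 bs mS S0 Sle SC.
pose q : R := 2 `^ (1 - b * s).
have q1 : q < 1.
  rewrite /q -[X in _ < X](powRr0 (2 : R)) /powR pnatr_eq0/= ltr_expR.
  by rewrite ltr_pM2r ?ln_gt0//; lra.
have q0 : 0 <= q by exact: powR_ge0.
pose W k t := (S (2 ^ k)%N t / (2 ^ k)%:R `^ b) `^ s.
have b0 : 0 < b by rewrite -(pmulr_lgt0 _ s0) (lt_trans ltr01).
have p2 k : 0 < (2 ^ k)%:R :> R by rewrite ltr0n expn_gt0.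
have W0 k t : 0 <= W k t by exact: powR_ge0.
have ae1 : {ae P, forall t, W n t @[n --> \oo] --> 0}.
  apply: (@ae_cvg0 _ _ _ _ _ (geometric C q)) => //.
  - move=> k; apply: measurable_powR_fun; apply: measurable_funM => //.
  - move=> k; rewrite -[X in (X <= _)%E]/(mu (W k)).
    have WE : W k = fun t => ((2 ^ k)%:R `^ (- (b * s))) * S (2 ^ k)%N t `^ s.
      apply/funext => t; rewrite /W powRM ?invr_ge0 ?powR_ge0//.
      by rewrite -powRN -powRrM mulNr mulrC.
    rewrite WE /mu meanZ ?powR_ge0//; last 2 first.
    + by move=> t; exact: powR_ge0.
    + exact: measurable_powR_fun.
    apply: (@le_trans _ _ (((2 ^ k)%:R `^ (- (b * s)))%:E * ((2 ^ k)%:R * C)%:E)%E).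
      by rewrite lee_wpmul2l ?lee_fin ?powR_ge0.
    rewrite -EFinM lee_fin mulrA [_ `^ _ * _]mulrC.
    rewrite -[X in X * _ `^ _]powRr1 ?(ltW (p2 k))// -powRD; last first.
      by rewrite (gt_eqF (p2 k)) implybT.
    rewrite natrX -powR_mulrn// -powRrM mulrC /geometric/= /q -powR_mulrn ?powR_ge0//.
    by rewrite -powRrM [(1 - _) * _]mulrC.
  - by apply: is_cvg_geometric_series; rewrite ger0_norm.
apply: filterS ae1 => t Wt eps eps0.
(* [n] is compared with [2 ^ k.+1], which is at most [2 * n]; the factor 2^(-b) pays for it. *)
pose e1 := (eps * 2 `^ (- b)) `^ s.
have e10 : 0 < eps * 2 `^ (- b) by rewrite mulr_gt0 ?powR_gt0.
have e1s : 0 < e1 by rewrite powR_gt0.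
move/cvgrPdist_lt : Wt => /(_ _ e1s) [k0 _ hk0].
exists (2 ^ k0)%N => // n /= kn.
have n0 : (0 < n)%N by apply: leq_trans kn; rewrite expn_gt0.
have /andP[h1 h2] := trunc_log_bounds (erefl (1 < 2)%N) n0.
set k := trunc_log 2 n in h1 h2.
have k0k : (k0 <= k.+1)%N by apply: leqW; exact: trunc_log_max.
have := hk0 k.+1 k0k; rewrite /= sub0r normrN ger0_norm// => Wk.
have S2 : S (2 ^ k.+1)%N t / (2 ^ k.+1)%:R `^ b < eps * 2 `^ (- b).
  rewrite ltNge; apply/negP => h; move: Wk; rewrite ltNge => /negP; apply.
  apply: ge0_ler_powR => //; rewrite ?nnegrE ?(ltW s0) ?(ltW e10)//.
  by rewrite divr_ge0// powR_ge0.
apply: (le_trans (Sle _ _ t (ltnW h2))).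
move: S2; rewrite ltr_pdivrMr ?powR_gt0// => /ltW/le_trans; apply.
rewrite -mulrA ler_wpM2l// ?(ltW eps0)//.
rewrite expnS natrM powRM// mulrA -powRD ?addNr ?powRr0 ?mul1r; last by rewrite pnatr_eq0 implybT.
by apply: ge0_ler_powR; rewrite ?nnegrE ?(ltW b0)// ler_nat.
Qed.

Lemma measurable_mean_to n : measurable_fun setT (fun t => mean_to (env t) n 0).
Proof. by apply: measurable_sum => j; exact: m_em. Qed.

Lemma measurable_var_to n : measurable_fun setT (fun t => var_to (env t) n 0).
Proof. by apply: measurable_sum => j; exact: (known_measurable (@known_cross_var j)). Qed.

Let sum_moment (Z : nat -> T -> R) (s C : R) : 0 < s <= 1 ->
  (forall j, measurable_fun setT (Z j)) -> (forall j t, 0 <= Z j t) ->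
  (forall j, mu (fun t => (Z j t `^ s)%R) <= C%:E)%E ->
  forall n, (mu (fun t => ((\sum_(0 <= j < n) Z j t) `^ s)%R) <= (n%:R * C)%:E)%E.
Proof.
move=> s01 mZ Z0 ZC n.
apply: (@le_trans _ _ (mu (fun t => \sum_(0 <= j < n) Z j t `^ s))).
  apply: mean_le.
  - by move=> t; exact: powR_ge0.
  - by apply: measurable_powR_fun; exact: measurable_sum.
  - by apply: measurable_sum => j; exact: measurable_powR_fun.
  - by move=> t; exact: powR_sum_le1.
rewrite /mu mean_sum; last 2 first.
- by move=> j t; exact: powR_ge0.
- by move=> j; exact: measurable_powR_fun.
apply: (@le_trans _ _ (\sum_(0 <= j < n) C%:E)%E); first by apply: lee_sum => j _; exact: ZC.
by rewrite sumEFin lee_fin big_const_nat subn0 iter_addr addr0 mulr_natl.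
Qed.

Let sum_nondec (Z : nat -> R) n m : (forall j, 0 <= Z j) -> (n <= m)%N ->
  \sum_(0 <= j < n) Z j <= \sum_(0 <= j < m) Z j.
Proof.
move=> Z0 nm; rewrite (@big_cat_nat _ _ _ n 0%N m)//= lerDl.
by apply: sumr_ge0.
Qed.

Lemma ae_mean_to_growth (s r b : R) : 0 < s <= 1 -> moment s = r%:E -> r < 1 ->
  1 < b * s ->
  {ae P, forall t, forall eps, 0 < eps ->
    \forall n \near \oo, mean_to (env t) n 0 <= eps * n%:R `^ b}.
Proof.
move=> s01 rE r1 bs; have /andP[s0 _] := s01.
have [C hC] := cross_mean_moment s0 rE r1.
apply: (@ae_growth (fun n t => mean_to (env t) n 0) s b C) => //.
- exact: measurable_mean_to.
- by move=> n t; apply: mean_to_ge0 => k; exact: omega01.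
- by move=> n m t nm; apply: sum_nondec => // j; exact: em_ge0.
- exact: sum_moment.
Qed.

(** Growth exponent 2 and moment order [p / 2] have product [p > 1], while [p / 2 <= 1] gives the
    subadditivity used to sum the variances. *)
Lemma ae_var_to_growth (p r r' : R) : 1 < p <= 2 -> moment p = r%:E -> r < 1 ->
  moment (p / 2) = r'%:E -> r' < 1 ->
  {ae P, forall t, forall eps, 0 < eps ->
    \forall n \near \oo, var_to (env t) n 0 <= eps * n%:R `^ 2}.
Proof.
move=> /andP[p1 p2] rE r1 r'E r'1.
have p0 : 0 < p by lra.
have [C hC] := cross_var_moment p0 rE r1 r'E r'1.
apply: (@ae_growth (fun n t => var_to (env t) n 0) (p / 2) 2 C) => //.
- by rewrite divr_gt0.
- by rewrite mulrC divfK.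
- exact: measurable_var_to.
- by move=> n t; apply: var_to_ge0 => k; exact: omega01.
- by move=> n m t nm; apply: sum_nondec => // j; exact: ev_ge0.
- apply: sum_moment => //; first by lra.
  by move=> j; exact: (known_measurable (@known_cross_var j)).
Qed.

End Moments.

Section LimitLemmas.
Variable R : realType.

Lemma powR_cvg0_inv (p : R) (x : nat -> R) : 0 < p -> (forall n, 0 <= x n) ->
  x n `^ p @[n --> \oo] --> 0 -> x @ \oo --> (0 : R).
Proof.
move=> p0 x0 xp; apply/cvgrPdist_lt => eps eps0.
move/cvgrPdist_lt : xp => /(_ _ (powR_gt0 p eps0)); apply: filterS => n.
rewrite !sub0r !normrN !ger0_norm ?powR_ge0// => h; rewrite ltNge; apply/negP => xe.
move: h; rewrite ltNge => /negP; apply.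
by apply: ge0_ler_powR; rewrite ?nnegrE ?(ltW p0) ?(ltW eps0).
Qed.

Lemma cvg_series_inv_sqr (c : R) : 0 <= c ->
  cvgn (series (fun k : nat => c * (k.+1%:R ^+ 2)^-1)).
Proof.
move=> c0; apply: nondecreasing_is_cvgn.
  by apply: nondecreasing_series => k _ _; rewrite mulr_ge0// invr_ge0 sqr_ge0.
exists (2 * c) => _ [[|n] _ <-].
  by rewrite /series/= big_nil mulr_ge0.
(* Comparison with the telescoping sum of 1/k - 1/(k+1). *)
suff : \sum_(0 <= k < n.+1) c * (k.+1%:R ^+ 2)^-1 <= c * (2 - n.+1%:R^-1).
  move/le_trans; apply; rewrite mulrC ler_wpM2r//.
  by rewrite lerBlDr lerDl invr_ge0.
elim: n => [|n IH]; first by rewrite big_nat1; lra.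
rewrite big_nat_recr//=; apply: (le_trans (lerD IH (lexx _))).
rewrite -mulrDr ler_wpM2l//.
have n1 : 0 < n.+1%:R :> R by rewrite ltr0n.
have n2 : n.+2%:R = n.+1%:R + 1 :> R by rewrite natr1.
have n2p : 0 < n.+1%:R + 1 :> R by lra.
rewrite n2 -subr_ge0; move: (n.+1%:R : R) n1 n2p {n2 IH} => x x0 x1.
have -> : 2 - (x + 1)^-1 - (2 - x^-1 + ((x + 1) ^+ 2)^-1) = (x * (x + 1) ^+ 2)^-1.
  by field; rewrite (gt_eqF x0) (gt_eqF x1).
by rewrite invr_ge0 mulr_ge0 ?sqr_ge0 ?(ltW x0).
Qed.

Lemma cvg_power_ratio (a : nat) :
  (k.+2 ^ a)%:R / (k.+1 ^ a)%:R @[k --> \oo] --> (1 : R).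
Proof.
have -> : (fun k : nat => (k.+2 ^ a)%:R / (k.+1 ^ a)%:R : R) = fun k => (1 + k.+1%:R^-1) ^+ a.
  apply/funext => k; rewrite !natrX -expr_div_n; congr (_ ^+ _).
  have k1 : k.+1%:R != 0 :> R by rewrite pnatr_eq0.
  by rewrite -[k.+2%:R]natr1; field.
have h : 1 + k.+1%:R^-1 @[k --> \oo] --> (1 : R).
  by rewrite -[X in _ --> X]addr0; apply: cvgD; [exact: cvg_cst|exact: cvg_harmonic].
elim: a => [|a IH]; first by under eq_fun do rewrite expr0; exact: cvg_cst.
rewrite (_ : (fun k : nat => _ ^+ a.+1) =
  (fun k => (1 + k.+1%:R^-1) * (1 + k.+1%:R^-1) ^+ a)); last by apply/funext => k; rewrite exprS.
by rewrite -[X in _ --> X]mulr1; exact: cvgM.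
Qed.

(** The subsequence is polynomial, not geometric, so that ratios of consecutive terms tend to 1 and
    monotonicity loses nothing in the limit. *)
Lemma cvg_mean_interpolation (S : nat -> R) (a : nat) (c : R) : (0 < a)%N ->
  (forall n, 0 <= S n) -> (forall n m, (n <= m)%N -> S n <= S m) ->
  S (k.+1 ^ a)%N / (k.+1 ^ a)%:R @[k --> \oo] --> c -> S n / n%:R @[n --> \oo] --> c.
Proof.
move=> a0 S0 Sle Sc.
have up : S (k.+2 ^ a)%N / (k.+2 ^ a)%:R * ((k.+2 ^ a)%:R / (k.+1 ^ a)%:R) @[k --> \oo] --> c.
  rewrite -[X in _ --> X]mulr1; apply: cvgM; last exact: cvg_power_ratio.
  by move: Sc; rewrite -(cvg_shiftS (fun k => S (k.+1 ^ a)%N / (k.+1 ^ a)%:R)).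
have lo : S (k.+1 ^ a)%N / (k.+1 ^ a)%:R * ((k.+2 ^ a)%:R / (k.+1 ^ a)%:R)^-1 @[k --> \oo] --> c.
  rewrite -[X in _ --> X]mulr1; apply: cvgM; first exact: Sc.
  by rewrite -[X in _ --> X]invr1; apply: cvgV; [exact: oner_neq0|exact: cvg_power_ratio].
apply/cvgrPdist_le => eps eps0.
move/cvgrPdist_le : up => /(_ _ eps0) [k1 _ hk1].
move/cvgrPdist_le : lo => /(_ _ eps0) [k2 _ hk2].
pose k0 := maxn k1 k2.
exists (k0.+1 ^ a)%N => // n /= kn.
have bound k : (k.+1 ^ a <= n)%N -> (k <= n)%N.
  move=> h; apply: leq_trans h; apply: (leq_trans (leqnSn k)).
  by rewrite -{1}(expn1 k.+1) leq_pexp2l.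
have [k kn1 kmax] := @ex_maxnP (fun k => (k.+1 ^ a <= n)%N) n (ex_intro _ k0 kn) bound.
have kn2 : (n < k.+2 ^ a)%N by rewrite ltnNge; apply/negP => /kmax; rewrite ltnn.
have k0k : (k0 <= k)%N by exact: kmax.
have := hk1 k (leq_trans (leq_maxl _ _) k0k); have := hk2 k (leq_trans (leq_maxr _ _) k0k).
rewrite /=.
have p1 : 0 < (k.+1 ^ a)%:R :> R by rewrite ltr0n expn_gt0.
have p2 : 0 < (k.+2 ^ a)%:R :> R by rewrite ltr0n expn_gt0.
have np : 0 < n%:R :> R by apply: lt_le_trans p1 _; rewrite ler_nat.
rewrite invf_div mulrA divfK ?gt_eqF// mulrA divfK ?gt_eqF//.
have u : S n / n%:R <= S (k.+2 ^ a)%N / (k.+1 ^ a)%:R.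
  by apply: ler_pM; rewrite ?invr_ge0// ?Sle ?(ltnW kn2)// lef_pV2 ?posrE// ler_nat.
have l : S (k.+1 ^ a)%N / (k.+2 ^ a)%:R <= S n / n%:R.
  apply: ler_pM; rewrite ?invr_ge0// ?Sle// lef_pV2 ?posrE// ler_nat.
  exact: ltnW.
rewrite !ler_norml => /andP[a1 a2] /andP[a3 a4]; apply/andP; split; lra.
Qed.

End LimitLemmas.

(** * Law of large numbers for the mean crossing time *)

Section LawOfLargeNumbers.
Variables (R : realType) (d : measure_display) (T : measurableType d).
Variables (P : probability T R) (omega : int -> {RV P >-> R}).
Hypothesis iid_omega : iid omega.
Hypothesis omega01 : forall k t, 0 < omega k t < 1.

Variables (p r rp : R).
Hypothesis p12 : 1 < p <= 2.
Hypothesis moment1 : moment omega 1 = r%:E.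
Hypothesis r1 : r < 1.
Hypothesis momentp : moment omega p = rp%:E.
Hypothesis rp1 : rp < 1.

Let K := known omega.
Let mu := mean P.
Let em (j : nat) (t : T) : R := cross_mean (env omega t) j.
Let Rho (j : nat) (t : T) : R := rho omega j%:Z t.
Let Y j t := 2 + em j t.

(** The martingale part of the recursion [em j.+1 = 2 + Rho j.+1 * Y j], obtained by replacing
    [Rho j.+1] with its deviation from the mean [r]. *)
Definition fluctuation (n : nat) (t : T) : R :=
  \sum_(0 <= j < n) (Rho j.+1 t - r) * Y j t.

Let M := fluctuation.

Let p0 : 0 < p. Proof. by case/andP: p12 => ? _; lra. Qed.

Let em_ge0 j t : 0 <= em j t.
Proof. by apply: cross_mean_ge0 => k; exact: omega01. Qed.

Let Y_ge0 j t : 0 <= Y j t. Proof. by rewrite addr_ge0. Qed.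

Let Rho_ge0 j t : 0 <= Rho j t. Proof. by rewrite ltW// rho_gt0. Qed.

Let r_ge0 : 0 <= r.
Proof. by rewrite -lee_fin -moment1; apply: mean_ge0 => t; exact: powR_ge0. Qed.

Let rp_ge0 : 0 <= rp.
Proof. by rewrite -lee_fin -momentp; apply: mean_ge0 => t; exact: powR_ge0. Qed.

Let known_em j : K (past j) (em j). Proof. exact: known_cross_mean. Qed.
Let known_Y j : K (past j) (Y j).
Proof. by apply: knownD; [exact: known_cst|exact: known_em]. Qed.
Let known_Rho j : K (past j.+1) (Rho j.+1).
Proof. by apply: known_rho => //; exact: past_last. Qed.

Let known_M n : K (past n) (M n).
Proof.
elim: n => [|n IH].
  by rewrite /K /M /fluctuation /known; under eq_fun do rewrite big_geq//; exact: known_cst.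
rewrite /K /M /fluctuation /known; under eq_fun do rewrite big_nat_recr//=.
apply: knownD; first by apply: knownS IH; exact: pastS.
apply: knownM; last by apply: knownS (@known_Y n); exact: pastS.
by apply: knownB; [exact: known_Rho|exact: known_cst].
Qed.

Let m_ J f : K J f -> measurable_fun setT f := @known_measurable _ _ _ _ _ J f.

(** The derivative of |x|^p up to the factor [p], written with positive and negative parts so that
    measurability is immediate. *)
Let signed_power (x : R) : R :=
  (Num.max x 0) `^ (p - 1) - (Num.max (- x) 0) `^ (p - 1).

Let signed_powerE x : signed_power x = Num.sg x * `|x| `^ (p - 1).
Proof.
have q0 : p - 1 != 0 by case/andP: p12 => ? _; rewrite gt_eqF//; lra.
rewrite /signed_power; case: (ltgtP x 0) => [x0|x0|->].
- have x0' : 0 <= - x by rewrite oppr_ge0 ltW.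
  rewrite (max_l x0') ltr0_sg// ltr0_norm// powR0//; ring.
- have x0' : - x <= 0 by rewrite oppr_le0 ltW.
  rewrite (max_r x0') gtr0_sg// gtr0_norm// powR0//; ring.
- by rewrite oppr0 maxxx sgr0 subrr mul0r.
Qed.

Let measurable_signed_power : measurable_fun setT signed_power.
Proof.
apply: measurable_funB; apply: (measurableT_comp (measurable_powR (p - 1))).
  by apply: measurable_maxr.
by apply: measurable_maxr => //; exact: measurable_funN.
Qed.

Let U n t : R := p * signed_power (M n t) * Y n t.

Let known_U n : K (past n) (U n).
Proof.
apply: knownM; last exact: known_Y.
by apply: knownM; [exact: known_cst|exact: (known_comp measurable_signed_power (@known_M n))].
Qed.

Let U_bound n t : `|U n t| <= p * (`|M n t| `^ p + Y n t `^ p).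
Proof.
rewrite /U signed_powerE !normrM (ger0_norm (ltW p0)) (ger0_norm (Y_ge0 n t)).
rewrite (ger0_norm (powR_ge0 _ _)) -!mulrA ler_wpM2l ?(ltW p0)//.
have q0 : 0 <= p - 1 by case/andP: p12 => ? _; lra.
apply: (@le_trans _ _ (`|M n t| `^ (p - 1) * Y n t)).
  rewrite ler_piMl ?mulr_ge0 ?powR_ge0//.
  by rewrite normr_sg lern1 leq_b1.
have [xy|yx] := leP `|M n t| (Y n t).
  apply: (@le_trans _ _ (Y n t `^ p)); last by rewrite lerDr powR_ge0.
  rewrite -(mulr_powRB1 (Y_ge0 n t) p0) mulrC ler_wpM2l//.
  by apply: ge0_ler_powR; rewrite ?nnegrE.
apply: (@le_trans _ _ (`|M n t| `^ p)); last by rewrite lerDl powR_ge0.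
by rewrite -(mulr_powRB1 (normr_ge0 _) p0) mulrC ler_wpM2r ?powR_ge0// ltW.
Qed.

Let Upos n t : R := Num.max (U n t) 0.
Let Uneg n t : R := Num.max (- U n t) 0.

Let Upos_ge0 n t : 0 <= Upos n t. Proof. by rewrite le_max lexx orbT. Qed.
Let Uneg_ge0 n t : 0 <= Uneg n t. Proof. by rewrite le_max lexx orbT. Qed.

Let U_split n t : U n t = Upos n t - Uneg n t.
Proof. by rewrite /Upos /Uneg; case: (leP (U n t) 0); case: (leP (- U n t) 0); lra. Qed.

Let known_Upos n : K (past n) (Upos n).
Proof.
apply: (@known_comp _ _ _ _ _ _ (U n) (fun x => Num.max x 0)); last exact: known_U.
exact: measurable_maxr.
Qed.

Let known_Uneg n : K (past n) (Uneg n).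
Proof.
apply: (@known_comp _ _ _ _ _ _ (U n) (fun x => Num.max (- x) 0)); last exact: known_U.
by apply: measurable_maxr => //; exact: measurable_funN.
Qed.

Let mean_RhoM n (Z : T -> R) : (forall t, 0 <= Z t) -> K (past n) Z ->
  mu (fun t => Rho n.+1 t * Z t) = (r%:E * mu Z)%E.
Proof.
move=> Z0 kZ; rewrite -moment1 -(mean_rhoM iid_omega omega01 1 Z0 kZ).
by apply: eq_integral => t _; rewrite powRr1// Rho_ge0.
Qed.

Let mean_RhopM n (Z : T -> R) : (forall t, 0 <= Z t) -> K (past n) Z ->
  mu (fun t => Rho n.+1 t `^ p * Z t) = (rp%:E * mu Z)%E.
Proof. by move=> Z0 kZ; rewrite -momentp -(mean_rhoM iid_omega omega01 p Z0 kZ). Qed.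

Let Y_moment : exists B, forall j, (mu (fun t => (Y j t `^ p)%R) <= B%:E)%E.
Proof.
have [B hB] := cross_mean_moment iid_omega omega01 p0 momentp rp1.
have [C1 C10 hC1] := powRD_le p0 (ltr01 : 0 < 1 :> R).
exists (C1 * 2 `^ p + (1 + 1) * B) => j.
have me : measurable_fun setT (fun t => em j t `^ p).
  by apply: measurable_powR_fun; exact: (m_ (@known_em j)).
apply: (@le_trans _ _ (mu (fun t => C1 * 2 `^ p + (1 + 1) * em j t `^ p))).
  apply: mean_le.
  - by move=> t; exact: powR_ge0.
  - by apply: measurable_powR_fun; exact: (m_ (@known_Y j)).
  - by apply: measurable_funD => //; apply: measurable_funM.
  - by move=> t; apply: hC1.
rewrite /mu meanD//; last 3 first.
- by move=> t; rewrite mulr_ge0 ?powR_ge0.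
- by move=> t; rewrite mulr_ge0 ?powR_ge0.
- by apply: measurable_funM.
rewrite mean_cst meanZ//; last by move=> t; exact: powR_ge0.
apply: (@le_trans _ _ ((C1 * 2 `^ p)%:E + (1 + 1)%:E * B%:E)%E); last exact: lexx.
by apply: leeD => //; rewrite lee_wpmul2l ?lee_fin//; exact: hB.
Qed.

(* von Bahr-Esseen: the increments are centred given the past, so the linear
   term of the Taylor bound has mean zero; it is split into positive and
   negative parts so that only integrals of nonnegative functions occur. *)
Lemma fluctuation_moment : exists C : R, forall n,
  (mu (fun t => (`|fluctuation n t| `^ p)%R) <= (n%:R * C)%:E)%E.
Proof.
have [B hB] := Y_moment.
have [C1 C10 hC1] := powRD_le p0 (ltr01 : 0 < 1 :> R).
pose D := 13 * C1 * r `^ p * B + 13 * (1 + 1) * (rp * B).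
exists D; elim=> [|n IH].
  rewrite mul0r -[X in (_ <= X)%E](mean_cst P); apply: mean_le => //.
  - by apply: measurable_powR_fun; apply: measurableT_comp => //; exact: (m_ (@known_M 0)).
  - by move=> t; rewrite /fluctuation big_geq// normr0 powR0// gt_eqF.
have mM k : measurable_fun setT (fun t => `|M k t| `^ p).
  by apply: measurable_powR_fun; apply: measurableT_comp => //; exact: (m_ (@known_M k)).
have mYp : measurable_fun setT (fun t => Y n t `^ p).
  by apply: measurable_powR_fun; exact: (m_ (@known_Y n)).
have mR : measurable_fun setT (Rho n.+1) by exact: (m_ (@known_Rho n)).
have mRp : measurable_fun setT (fun t => Rho n.+1 t `^ p) by exact: measurable_powR_fun.
have mUp := m_ (@known_Upos n); have mUn := m_ (@known_Uneg n).
have Mp0 k t : 0 <= `|M k t| `^ p by exact: powR_ge0.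
have Yp0 t : 0 <= Y n t `^ p by exact: powR_ge0.
have pointwise t : `|M n.+1 t| `^ p + (r * Upos n t + Rho n.+1 t * Uneg n t) <=
    `|M n t| `^ p + (Rho n.+1 t * Upos n t + r * Uneg n t) +
    (13 * C1 * r `^ p * Y n t `^ p + 13 * (1 + 1) * (Rho n.+1 t `^ p * Y n t `^ p)).
  have := powR_norm_taylor (M n t) ((Rho n.+1 t - r) * Y n t) p12.
  have -> : M n t + (Rho n.+1 t - r) * Y n t = M n.+1 t by rewrite /M /fluctuation big_nat_recr.
  have -> : p * Num.sg (M n t) * `|M n t| `^ (p - 1) * ((Rho n.+1 t - r) * Y n t) =
      U n t * (Rho n.+1 t - r) by rewrite /U signed_powerE; ring.
  rewrite U_split normrM (ger0_norm (Y_ge0 n t)) powRM//.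
  have : `|Rho n.+1 t - r| `^ p <= C1 * r `^ p + (1 + 1) * Rho n.+1 t `^ p.
    apply: le_trans (hC1 _ _ r_ge0 (Rho_ge0 n.+1 t)).
    apply: ge0_ler_powR; rewrite ?nnegrE ?addr_ge0 ?(ltW p0)//.
    by rewrite ler_norml; have h := Rho_ge0 n.+1 t; have h0 := r_ge0; apply/andP; split; lra.
  move=> /(ler_wpM2r (Yp0 t)) h1 h2; lra.
have a1 t : 0 <= r * Upos n t by apply: mulr_ge0.
have a2 t : 0 <= Rho n.+1 t * Uneg n t by apply: mulr_ge0.
have a3 t : 0 <= Rho n.+1 t * Upos n t by apply: mulr_ge0.
have a4 t : 0 <= r * Uneg n t by apply: mulr_ge0.
have a5 t : 0 <= Rho n.+1 t `^ p * Y n t `^ p by apply: mulr_ge0 => //; exact: powR_ge0.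
have c0 : 0 <= 13 * C1 * r `^ p by rewrite !mulr_ge0 ?powR_ge0.
have a6 t : 0 <= 13 * C1 * r `^ p * Y n t `^ p by apply: mulr_ge0.
have a7 t : 0 <= 13 * (1 + 1) * (Rho n.+1 t `^ p * Y n t `^ p) by apply: mulr_ge0.
have b1 t : 0 <= r * Upos n t + Rho n.+1 t * Uneg n t by apply: addr_ge0.
have b2 t : 0 <= Rho n.+1 t * Upos n t + r * Uneg n t by apply: addr_ge0.
have b3 t : 0 <= `|M n.+1 t| `^ p + (r * Upos n t + Rho n.+1 t * Uneg n t) by apply: addr_ge0.
have b4 t : 0 <= `|M n t| `^ p + (Rho n.+1 t * Upos n t + r * Uneg n t) by apply: addr_ge0.
have b5 t : 0 <= 13 * C1 * r `^ p * Y n t `^ p + 13 * (1 + 1) * (Rho n.+1 t `^ p * Y n t `^ p).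
  by apply: addr_ge0.
have finM : exists2 m, mu (fun t => `|M n t| `^ p) = m%:E & 0 <= m <= n%:R * D.
  exact: mean_finite.
(* The parts of [U] have finite means, so the terms [r * up + r * un] that appear on both sides can
   be cancelled. *)
have finU : (mu (fun t => (p * (`|M n t| `^ p + Y n t `^ p))%R) <= (p * (n%:R * D + B))%:E)%E.
  rewrite /mu meanZ ?(ltW p0)//; last 2 first.
  - by move=> t; rewrite addr_ge0.
  - exact: measurable_funD.
  by rewrite meanD// EFinM EFinD lee_wpmul2l ?lee_fin ?(ltW p0)// leeD.
have finUp : exists2 m, mu (Upos n) = m%:E & 0 <= m <= p * (n%:R * D + B).
  apply: mean_finite => //; apply: le_trans finU; apply: mean_le => //.
    by apply: measurable_funM => //; exact: measurable_funD.
  move=> t; apply: le_trans (U_bound n t).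
  by rewrite ge_max normr_ge0 ler_norm.
have finUn : exists2 m, mu (Uneg n) = m%:E & 0 <= m <= p * (n%:R * D + B).
  apply: mean_finite => //; apply: le_trans finU; apply: mean_le => //.
    by apply: measurable_funM => //; exact: measurable_funD.
  move=> t; apply: le_trans (U_bound n t).
  by rewrite ge_max normr_ge0 -normrN ler_norm.
have [mm mmE /andP[mm0 mmD]] := finM.
have [up upE /andP[up0 _]] := finUp; have [un unE /andP[un0 _]] := finUn.
have [y yE /andP[y0 yB]] := mean_finite Yp0 (hB n).
have : (mu (fun t => `|M n.+1 t| `^ p + (r * Upos n t + Rho n.+1 t * Uneg n t))%R <=
  mu (fun t => `|M n t| `^ p + (Rho n.+1 t * Upos n t + r * Uneg n t) +
    (13 * C1 * r `^ p * Y n t `^ p + 13 * (1 + 1) * (Rho n.+1 t `^ p * Y n t `^ p)))%R)%E.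
  apply: mean_le => //.
  - apply: measurable_funD => //; apply: measurable_funD; exact: measurable_funM.
  - apply: measurable_funD; apply: measurable_funD => //.
    + by apply: measurable_funD; exact: measurable_funM.
    + exact: measurable_funM.
    + by apply: measurable_funM => //; exact: measurable_funM.
have e1 : mu (fun t => `|M n.+1 t| `^ p + (r * Upos n t + Rho n.+1 t * Uneg n t)) =
    (mu (fun t => (`|M n.+1 t| `^ p)%R) + (r * up + r * un)%:E)%E.
  rewrite /mu meanD//; last first.
  - by apply: measurable_funD; exact: measurable_funM.
  congr (_ + _)%E; rewrite meanD//; last 2 first.
  - exact: measurable_funM.
  - exact: measurable_funM.
  by rewrite meanZ// -/mu mean_RhoM// upE unE.
have e2 : mu (fun t => `|M n t| `^ p + (Rho n.+1 t * Upos n t + r * Uneg n t) +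
    (13 * C1 * r `^ p * Y n t `^ p + 13 * (1 + 1) * (Rho n.+1 t `^ p * Y n t `^ p))) =
    (mm + (r * up + r * un) + (13 * C1 * r `^ p * y + 13 * (1 + 1) * (rp * y)))%:E.
  rewrite /mu meanD//; last 2 first.
  - by apply: measurable_funD => //; apply: measurable_funD; exact: measurable_funM.
  - apply: measurable_funD; first exact: measurable_funM.
    by apply: measurable_funM => //; exact: measurable_funM.
  rewrite [X in (X + _)%E]meanD//; last first.
  - by apply: measurable_funD; exact: measurable_funM.
  rewrite [X in (_ + X + _)%E]meanD//; last 2 first.
  - exact: measurable_funM.
  - exact: measurable_funM.
  rewrite [X in (_ + X)%E]meanD//; last 2 first.
  - exact: measurable_funM.
  - by apply: measurable_funM => //; exact: measurable_funM.
  rewrite !meanZ//; last exact: measurable_funM.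
  rewrite -/mu mean_RhoM// mean_RhopM//; last by apply: known_powR; exact: known_Y.
  by rewrite mmE upE unE {1 2}/mu yE.
rewrite e1 e2 => h.
have [m' m'E /andP[m'0 _]] : exists2 m, mu (fun t => `|M n.+1 t| `^ p) = m%:E &
    0 <= m <= mm + (r * up + r * un) + (13 * C1 * r `^ p * y + 13 * (1 + 1) * (rp * y)).
  apply: mean_finite => //; apply: le_trans h.
  by rewrite leeDl// lee_fin addr_ge0// mulr_ge0.
move: h; rewrite -/M m'E -EFinD !lee_fin => h.
have h1 : 13 * C1 * r `^ p * y <= 13 * C1 * r `^ p * B by rewrite ler_wpM2l.
have h2 : 13 * (1 + 1) * (rp * y) <= 13 * (1 + 1) * (rp * B).
  by rewrite ler_wpM2l// ler_wpM2l.
rewrite -[n.+1%:R]natr1 mulrDl mul1r {2}/D; lra.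
Qed.

(** Summing the recursion of [em] gives the sum back with factor [r], up to the boundary terms
    [em n] and [em 0 = 2]. *)
Lemma mean_to_fluctuation n t :
  (1 - r) * mean_to (env omega t) n 0 =
  2 * (1 + r) * n%:R + fluctuation n t - em n t + 2.
Proof.
rewrite /mean_to; elim: n => [|n IH].
  by rewrite /fluctuation !big_geq// /em/=; ring.
rewrite big_nat_recr//= /fluctuation big_nat_recr//= -/(fluctuation n t) mulrDr IH.
rewrite -[n.+1%:R]natr1 /em/= -/(rho omega n.+1%:Z t) /Y /em /Rho; ring.
Qed.

Lemma ae_mean_to_lln :
  {ae P, forall t, mean_to (env omega t) n 0 / n%:R @[n --> \oo] --> 2 * (1 + r) / (1 - r)}.
Proof.
have q0 : 0 < p - 1 by case/andP: p12 => ? _; lra.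
(* Along [N k], the p-th moment of a term divided by [N k] is at most C N^(1-p); this exponent makes
   it at most C / (k+1)^2. *)
pose a := (Num.truncn (2 / (p - 1))).+1.
have ap : 2 <= a%:R * (p - 1).
  rewrite -ler_pdivrMr//; apply: ltW; exact: truncnS_gt.
pose N k := (k.+1 ^ a)%N.
have N0 k : 0 < (N k)%:R :> R by rewrite ltr0n expn_gt0.
have Npow k : (N k)%:R `^ (1 - p) <= (k.+1%:R ^+ 2)^-1.
  rewrite /N natrX -powR_mulrn// -powRrM -powR_mulrn// -powRN.
  by apply: ler_powR; rewrite ?ler1n//; lra.
have ae1 (F : nat -> T -> R) (C : R) : (forall n, measurable_fun setT (F n)) ->
    (forall n t, 0 <= F n t) -> 0 <= C ->
    (forall n, (0 < n)%N -> (mu (fun t => (F n t `^ p)%R) <= (n%:R * C)%:E)%E) ->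
    {ae P, forall t, F (N k) t / (N k)%:R @[k --> \oo] --> 0}.
  move=> mF F0 C0 FC.
  have : {ae P, forall t, (F (N k) t / (N k)%:R) `^ p @[k --> \oo] --> 0}.
    apply: (@ae_cvg0 _ _ _ _ _ (fun k => C * (k.+1%:R ^+ 2)^-1)).
    - by move=> k; apply: measurable_powR_fun; apply: measurable_funM.
    - by move=> k t; exact: powR_ge0.
    - move=> k; rewrite -[X in (X <= _)%E]/(mu _).
      have -> : (fun t => (F (N k) t / (N k)%:R) `^ p) =
          fun t => (N k)%:R `^ (- p) * F (N k) t `^ p.
        apply/funext => t; rewrite powRM ?invr_ge0 ?(ltW (N0 k))// mulrC; congr (_ * _).
        by rewrite -powR_inv1 ?(ltW (N0 k))// -powRrM mulN1r.
      rewrite /mu meanZ ?powR_ge0//; last 2 first.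
      + by move=> t; exact: powR_ge0.
      + exact: measurable_powR_fun.
      apply: (@le_trans _ _ (((N k)%:R `^ (- p))%:E * ((N k)%:R * C)%:E)%E).
        rewrite lee_wpmul2l ?lee_fin ?powR_ge0//; apply: FC.
        by rewrite expn_gt0.
      rewrite -EFinM lee_fin mulrA [leRHS]mulrC ler_wpM2r//.
      apply: le_trans (Npow k).
      rewrite [1 - p]addrC powRD ?powRr1 ?(ltW (N0 k))//.
      by rewrite (gt_eqF (N0 k)) implybT.
    - exact: cvg_series_inv_sqr.
  apply: filterS => t; apply: powR_cvg0_inv => // k.
  by rewrite divr_ge0// ltW.
have [C hC] := fluctuation_moment.
have [B hB] := cross_mean_moment iid_omega omega01 p0 momentp rp1.
have C0 : 0 <= C.
  rewrite -lee_fin -[C]mul1r; apply: le_trans (hC 1%N).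
  by apply: mean_ge0 => t; exact: powR_ge0.
have B0 : 0 <= B.
  rewrite -lee_fin; apply: le_trans (hB 0%N).
  by apply: mean_ge0 => t; exact: powR_ge0.
have aeM := ae1 (fun n t => `|M n t|) C _ _ C0 _.
have aeE := ae1 em B _ _ B0 _.
have mM n : measurable_fun setT (fun t => `|M n t|).
  by apply: measurableT_comp => //; exact: (m_ (@known_M n)).
have {aeM} := aeM mM (fun n t => normr_ge0 _) (fun n _ => hC n).
have {aeE} := aeE (fun n => m_ (@known_em n)) em_ge0.
have h n : (0 < n)%N -> (mu (fun t => (em n t `^ p)%R) <= (n%:R * B)%:E)%E.
  by move=> n0; apply: (le_trans (hB n)); rewrite lee_fin ler_peMl// ler1n.
move=> /(_ h); apply: filterS2 => t cE cM.
apply: (@cvg_mean_interpolation _ _ a) => //.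
- by move=> n; apply: mean_to_ge0 => k; exact: omega01.
- move=> n m nm; rewrite /mean_to (@big_cat_nat _ _ _ n 0%N m)//= lerDl.
  by apply: sumr_ge0 => j _; exact: em_ge0.
have r1' : 1 - r != 0 by rewrite gt_eqF// subr_gt0.
have -> : (fun k => mean_to (env omega t) (k.+1 ^ a) 0 / (k.+1 ^ a)%:R) =
  (fun k => (2 * (1 + r) + M (N k) t / (N k)%:R - em (N k) t / (N k)%:R + 2 * (N k)%:R^-1) / (1 - r)).
  apply/funext => k; rewrite -/(N k); apply: (mulfI r1'); rewrite mulrA mean_to_fluctuation.
  by rewrite /M; field; rewrite r1' gt_eqF.
apply: cvgMl.
rewrite -[X in _ --> X](_ : 2 * (1 + r) + 0 - 0 + 2 * 0 = _); last by ring.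
have cN : (N k)%:R^-1 @[k --> \oo] --> (0 : R).
  apply: (squeeze_cvgr _ (cvg_cst 0) (@cvg_harmonic R)).
  near=> k; rewrite invr_ge0 ltW//= lef_pV2 ?posrE// ?ltr0n// ler_nat.
  by rewrite -{1}(expn1 k.+1) leq_pexp2l.
apply: cvgD; last by apply: cvgMr.
apply: cvgB => //; apply: cvgD; first exact: cvg_cst.
apply/norm_cvg0P; move: cM; apply: cvg_trans; apply: near_eq_cvg; near=> k.
by rewrite normrM (@ger0_norm _ (N k)%:R^-1)// invr_ge0 ltW.
Unshelve. all: by end_near. Qed.

End LawOfLargeNumbers.

(** * The critical exponent *)

Section CriticalExponent.
Variables (R : realType) (d : measure_display) (T : measurableType d).
Variables (P : probability T R) (omega : int -> {RV P >-> R}).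
Hypothesis omega01 : forall k t, 0 < omega k t < 1.
Variable kappa : R.

Let m := moment omega.
Let X := rho omega 0.
Let excess (a : R) : \bar R := mean P (fun t => X t `^ a * Num.max (ln (X t)) 0).

Hypothesis kappa_unique : unique (fun a : R =>
  [/\ 0 < a, m a = 1%E & (excess a < +oo)%E]) kappa.

Let X_gt0 t : 0 < X t. Proof. exact: rho_gt0. Qed.
Let mX : measurable_fun setT X. Proof. exact: measurable_rho. Qed.

Let measurable_powX s : measurable_fun setT (fun t => X t `^ s).
Proof. exact: measurable_powR_fun. Qed.

Let measurable_excess s : measurable_fun setT (fun t => X t `^ s * Num.max (ln (X t)) 0).
Proof.
apply: measurable_funM => //; apply: measurable_maxr => //.
exact: (measurableT_comp (@measurable_ln R) mX).
Qed.

Let excess_ge0 s t : 0 <= X t `^ s * Num.max (ln (X t)) 0.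
Proof. by rewrite mulr_ge0 ?powR_ge0// le_max lexx orbT. Qed.

(** Convexity of the moments in their order, between order 0, where the moment is 1, and order
    [a]. *)
Let moment_interpolation s a : 0 < s <= a ->
  (m s <= (s / a)%:E * m a + (1 - s / a)%:E)%E.
Proof.
move=> /andP[s0 sa]; have a0 : 0 < a by exact: lt_le_trans sa.
have q0 : 0 <= s / a by rewrite divr_ge0// ltW.
have q1 : s / a <= 1 by rewrite ler_pdivrMr// mul1r.
rewrite /m /moment -meanZ//; last by move=> t; exact: powR_ge0.
rewrite -(mean_cst P) -meanD//; last 3 first.
- by move=> t; rewrite mulr_ge0 ?powR_ge0.
- by move=> t; rewrite subr_ge0.
- exact: measurable_funM.
apply: mean_le => //.
- by move=> t; exact: powR_ge0.
- by apply: measurable_funD => //; exact: measurable_funM.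
- move=> t; have -> : rho omega 0 t `^ s = (rho omega 0 t `^ a) `^ (s / a).
    by rewrite -powRrM mulrC divfK// gt_eqF.
  by apply: powR_young; rewrite ?powR_ge0// q0.
Qed.

Let kappa_gt0 : 0 < kappa. Proof. by have [[]] := kappa_unique. Qed.
Let moment_kappa : m kappa = 1%E. Proof. by have [[]] := kappa_unique. Qed.

Let excess_lt a s C : 0 <= C -> (forall t, X t `^ a * Num.max (ln (X t)) 0 <= C * X t `^ s) ->
  (m s < +oo)%E -> (excess a < +oo)%E.
Proof.
move=> C0 h ms; apply: (@le_lt_trans _ _ (C%:E * m s)%E).
  rewrite /m /moment -meanZ//; last by move=> t; exact: powR_ge0.
  by apply: mean_le => //; exact: measurable_funM.
by rewrite lte_mul_pinfty.
Qed.

(** Interpolation gives at most 1. At equality [s] would satisfy all the conditions on kappa, its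
    excess being dominated by that of kappa. *)
Lemma moment_lt1 s : 0 < s < kappa -> exists2 r : R, m s = r%:E & r < 1.
Proof.
move=> /andP[s0 sk].
have s1 : (m s <= 1%:E)%E.
  have := @moment_interpolation s kappa; rewrite s0 (ltW sk) moment_kappa => /(_ isT).
  by rewrite mule1 -EFinD addrC subrK.
have [r rE /andP[r0 r1]] := mean_finite (fun t => powR_ge0 (X t) s) s1.
exists r => //; rewrite lt_neqAle r1 andbT; apply/eqP => r1E.
have [_ uni] := kappa_unique.
have : kappa = s.
  apply: uni; split; [exact: s0|by rewrite -r1E; exact: rE|].
  have [[_ _ ek] _] := kappa_unique; apply: le_lt_trans ek.
  apply: mean_le => // t.
  have [l0|l0] := leP (ln (X t)) 0; first by rewrite !mulr0.
  rewrite ler_wpM2r ?(ltW l0)//; apply: ler_powR; last exact: ltW.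
  by rewrite leNgt; apply/negP => X1; move: l0; rewrite ltNge ln_le0// ltW.
by move=> kE; move: sk; rewrite kE ltxx.
Qed.

Let moment_ge1 a : kappa < a -> (1 <= m a)%E.
Proof.
move=> ka; have a0 : 0 < a by exact: lt_trans ka.
have := @moment_interpolation kappa a; rewrite kappa_gt0 (ltW ka) moment_kappa => /(_ isT).
have m0 : (0 <= m a)%E by apply: mean_ge0 => t; exact: powR_ge0.
case: (m a) m0 => [x|_ _|//]; last by rewrite leey.
rewrite !lee_fin => _ h.
have : 0 < kappa / a by rewrite divr_gt0.
set q := kappa / a in h * => q0.
have : q * 1 <= q * x by lra.
by rewrite ler_pM2l.
Qed.

(* A moment equal to 1 at some s > kappa would equal 1 at (kappa + s) / 2 too,
   where the excess is finite: kappa would not be unique. *)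
Lemma moment_gt1 s : kappa < s -> (1 < m s)%E.
Proof.
move=> ks; have s0 : 0 < s by exact: lt_trans ks.
rewrite lt_neqAle moment_ge1// andbT eq_sym; apply/eqP => ms.
pose a := (kappa + s) / 2.
have ka : kappa < a by rewrite /a; lra.
have sa : a < s by rewrite /a; lra.
have a0 : 0 < a by exact: lt_trans ka.
have ma : m a = 1%E.
  apply/eqP; rewrite eq_le moment_ge1// andbT.
  have := @moment_interpolation a s; rewrite a0 (ltW sa) ms => /(_ isT).
  by rewrite mule1 -EFinD addrC subrK.
have [_ uni] := kappa_unique.
have : kappa = a; last by move=> kE; move: ka; rewrite -kE ltxx.
apply: uni; split => //.
(* The constant comes from [(s - a) * ln X = ln (X^(s - a)) <= X^(s - a)]. *)
apply: (@excess_lt a s (s - a)^-1); rewrite ?invr_ge0 ?subr_ge0 ?(ltW sa)//.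
  move=> t; have [l0|l0] := leP (ln (X t)) 0.
    by rewrite mulr0 mulr_ge0 ?powR_ge0// invr_ge0 subr_ge0 ltW.
  rewrite ler_pdivlMl ?subr_gt0// mulrCA -ln_powR.
  have -> : X t `^ s = X t `^ a * X t `^ (s - a).
    by rewrite -powRD ?[a + _]addrC ?subrK// (gt_eqF (X_gt0 t)) implybT.
  by rewrite ler_wpM2l ?powR_ge0// ltW// ln_sublinear// powR_gt0.
by rewrite ms ltry.
Qed.

End CriticalExponent.

(** * The annealed mean of the hitting time of 1 *)

Section AnnealedHittingTime.
Variables (R : realType) (d : measure_display) (T : measurableType d).
Variables (P : probability T R) (omega : int -> {RV P >-> R}).
Hypothesis iid_omega : iid omega.
Hypothesis omega01 : forall k t, 0 < omega k t < 1.
Variable r : R.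
Hypothesis moment1 : moment omega 1 = r%:E.
Hypothesis r1 : r < 1.

Let K := known omega.
Let mu := mean P.
Let left (k : nat) : set int := [set i | i <= - k%:Z].
Let b (N k : nat) (t : T) : R := back (env omega t) N k.

Let r_ge0 : 0 <= r.
Proof. by rewrite -lee_fin -moment1; apply: mean_ge0 => t; exact: powR_ge0. Qed.

Let b_ge0 N k t : 0 <= b N k t.
Proof. by apply: back_ge0 => i; exact: omega01. Qed.

Let known_b N k : K (left k) (b N k).
Proof.
elim: N k => [|N IH] k; first exact: known_cst.
have kr : K (left k) (rho omega (- k%:Z)) by apply: known_rho => //; rewrite /left/=.
apply: knownD; first by apply: knownD => //; exact: known_cst.
by apply: knownM => //; apply: knownS (@IH k.+1) => i; rewrite /left/=; lia.
Qed.

Let mean_b N k : mu (b N k) = ((1 + r) / (1 - r) * (1 - r ^+ N))%:E.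
Proof.
elim: N k => [|N IH] k.
  by rewrite expr0 subrr mulr0 -(mean_cst P).
have mb : measurable_fun setT (b N k.+1) by exact: (known_measurable (@known_b N k.+1)).
have mr : measurable_fun setT (rho omega (- k%:Z)) by exact: measurable_rho.
have r0 t : 0 <= rho omega (- k%:Z) t by rewrite ltW// rho_gt0.
have rb0 t : 0 <= rho omega (- k%:Z) t * b N k.+1 t by exact: mulr_ge0.
have -> : b N.+1 k = fun t => 1 + rho omega (- k%:Z) t + rho omega (- k%:Z) t * b N k.+1 t.
  by [].
have mr1 : mu (rho omega (- k%:Z)) = r%:E.
  rewrite -moment1 -(mean_rho_powR iid_omega omega01 (- k%:Z)).
  by apply: eq_integral => t _; rewrite powRr1.
rewrite /mu meanD//; last 3 first.
- by move=> t; rewrite addr_ge0.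
- exact: measurable_funD.
- exact: measurable_funM.
rewrite meanD// mean_cst -/mu mr1.
have dj : [set - k%:Z] `&` left k.+1 = set0.
  by rewrite -subset0 => i [/= ->]; rewrite /left/=; lia.
have -> : mu (fun t => rho omega (- k%:Z) t * b N k.+1 t) = (r%:E * mu (b N k.+1))%E.
  rewrite -mr1; apply: (integralM_indep iid_omega dj) => //.
    exact: known_rho.
  exact: known_b.
rewrite IH -EFinM -!EFinD; congr EFin; rewrite exprS; field.
by rewrite gt_eqF// subr_gt0.
Qed.

(** Monotone convergence along the truncations. This identifies the limit [2 * (1 + r) / (1 - r)] of
    the law of large numbers as twice the annealed mean; the 2 is the slowdown by laziness. *)
Lemma annealed_hitting_time (dX : measure_display) (TX : measurableType dX)
    (PX : T -> probability TX R) (Z : nat -> TX -> int) :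
  (forall t, markov_chain (PX t) (walk_kernel (env omega t)) 0 Z) ->
  (\int[P]_t \int[PX t]_s hitting_time R (fun l => Z l s) 1%R =
   ((1 + r) / (1 - r))%:E)%E.
Proof.
move=> mcZ.
have nd t : {homo (fun N => (b N 0 t)%:E) : n m / (n <= m)%N >-> (n <= m)%E}.
  move=> n m nm; rewrite lee_fin; move: n m nm.
  by apply/nondecreasing_seqP => n; apply: back_le => i; exact: omega01.
transitivity (\int[P]_t limn (fun N => (b N 0 t)%:E))%E.
  apply: eq_integral => t _.
  rewrite (mean_hitting_time (fun k => omega01 k t) (mcZ t)).
  by apply/esym/cvg_lim => //; exact: ereal_nondecreasing_cvgn.
rewrite (@monotone_convergence _ _ _ P setT _ (fun N t => (b N 0 t)%:E))//; last 2 first.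
- by move=> N; apply/measurable_EFinP; exact: (known_measurable (@known_b N 0)).
- by move=> N t _; rewrite lee_fin.
apply/cvg_lim => //.
rewrite (_ : (fun N => _) = fun N => ((1 + r) / (1 - r) * (1 - r ^+ N))%:E); last first.
  by apply/funext => N; exact: mean_b.
apply: cvg_EFin; first by near=> N.
rewrite -[X in _ --> X]mulr1; apply: cvgMr.
rewrite -[X in _ --> X]subr0; apply: cvgB; first exact: cvg_cst.
by apply: cvg_expr; rewrite ger0_norm.
Unshelve. all: by end_near. Qed.

End AnnealedHittingTime.

(** * Products of odds over blocks *)

Section OddsProducts.
Variables (R : realType) (d : measure_display) (T : measurableType d).
Variables (P : probability T R) (omega : int -> {RV P >-> R}).
Hypothesis iid_omega : iid omega.
Hypothesis omega01 : forall k t, 0 < omega k t < 1.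

Let K := known omega.
Let mu := mean P.

Definition odds_prod (a b : nat) (t : T) : R := \prod_(a.+1 <= k < b.+1) rho omega k%:Z t.
Definition between (a b : nat) : set int := [set i | a%:Z < i <= b%:Z].

Lemma odds_prod_gt0 a b t : 0 < odds_prod a b t.
Proof. by apply: prodr_gt0 => k _; exact: rho_gt0. Qed.

Lemma known_odds_prod a b : K (between a b) (odds_prod a b).
Proof.
apply: known_prod => k; rewrite mem_index_iota => /andP[ak kb].
by apply: known_rho => //; rewrite /between/=; lia.
Qed.

Lemma measurable_odds_prod a b : measurable_fun setT (odds_prod a b).
Proof. exact: (known_measurable (@known_odds_prod a b)). Qed.

Lemma odds_prodS a b : (a <= b)%N ->
  odds_prod a b.+1 = fun t => rho omega b.+1%:Z t * odds_prod a b t.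
Proof. by move=> ab; apply/funext => t; rewrite /odds_prod big_nat_recr//= mulrC. Qed.

Lemma odds_prod_cat a b c t : (a <= b)%N -> (b <= c)%N ->
  odds_prod a c t = odds_prod a b t * odds_prod b c t.
Proof. by move=> ab bc; rewrite /odds_prod -big_cat_nat. Qed.

Lemma odds_prod_same_law a L : same_law P (odds_prod a (a + L)) (odds_prod 0 L).
Proof.
have one b : odds_prod b b = fun=> 1.
  by apply/funext => t; rewrite /odds_prod big_geq.
elim: L => [|L IH]; first by rewrite addn0 !one.
rewrite addnS !odds_prodS ?leq_addr//.
have dj b n : [set n.+1%:Z] `&` between b n = set0.
  by rewrite -subset0 => i [/= ->] /andP[_]; lia.
apply: (same_lawM iid_omega (dj a (a + L)%N) (dj 0%N L)) => //.
- exact: known_rho.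
- exact: known_odds_prod.
- exact: known_rho.
- exact: known_odds_prod.
- exact: same_law_rho.
Qed.

Lemma mean_odds_prod s a L :
  mu (fun t => odds_prod a (a + L) t `^ s) = (moment omega s ^+ L)%E.
Proof.
elim: L => [|L IH].
  rewrite addn0 expe0 -(mean_cst P); apply: eq_integral => t _.
  by rewrite /odds_prod big_geq// powR1.
rewrite addnS expeS.
transitivity (mu (fun t => rho omega (a + L).+1%:Z t `^ s * odds_prod a (a + L) t `^ s)).
  apply: eq_integral => t _; rewrite (odds_prodS (leq_addr _ _)) powRM// ltW//.
    exact: rho_gt0.
  exact: odds_prod_gt0.
rewrite /mu mean_rhoM//; first by rewrite -/mu IH.
  by move=> t; exact: powR_ge0.
apply: known_powR; apply: knownS (@known_odds_prod a (a + L)).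
by move=> i; rewrite /between /past/=; lia.
Qed.

End OddsProducts.

(** * Stationary mass away from the right end *)

Section StationaryMass.
Variables (R : realType) (d : measure_display) (T : measurableType d).
Variables (P : probability T R) (omega : int -> {RV P >-> R}).
Hypothesis iid_omega : iid omega.
Hypothesis omega01 : forall k t, 0 < omega k t < 1.
Variables s r : R.
Hypothesis s01 : 0 < s <= 1.
Hypothesis moments : moment omega s = r%:E.
Hypothesis r1 : r < 1.

Let mu := mean P.

Let r_ge0 : 0 <= r.
Proof. by rewrite -lee_fin -moments; apply: mean_ge0 => t; exact: powR_ge0. Qed.

Lemma geometric_sum_le (x : R) (m k : nat) : 0 <= x < 1 -> (k <= m)%N ->
  \sum_(i < k.+1) x ^+ (m - i) <= x ^+ (m - k) / (1 - x).
Proof.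
move=> /andP[x0 x1]; have x1' : 0 < 1 - x by lra.
elim: k => [|k IH] km.
  by rewrite big_ord1 subn0 ler_pdivlMr// ler_piMr ?exprn_ge0//; lra.
rewrite big_ord_recr/=; apply: (le_trans (lerD (IH (ltnW km)) (lexx _))).
have -> : (m - k = (m - k.+1).+1)%N by lia.
rewrite exprS ler_pdivlMr// mulrDl divfK ?gt_eqF//.
have h : 0 <= x ^+ (m - k.+1) by exact: exprn_ge0.
nra.
Qed.

(** A site at distance at least [n %/ D] from [n] has a tail product whose moment of order [s] is at
    most of order r^(n/D), so the expected sum of powers is summable in [n]. *)
Lemma ae_stationary_mass (D : nat) : (0 < D)%N ->
  {ae P, forall t, forall eps, 0 < eps ->
    \forall n \near \oo, \sum_(x < (n - n %/ D).+1) tail_prod (env omega t) n x <= eps}.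
Proof.
move=> D0; have /andP[s0 s1] := s01.
pose x : R := Num.max r 2^-1.
have x0 : 0 < x by rewrite lt_max invr_gt0 ltr0n orbT.
have x1 : x < 1 by rewrite gt_max r1/= invf_lt1// ltr1n.
have rx : r <= x by rewrite le_max lexx.
(* The D-th root turns powers with exponent [n %/ D] into a geometric sequence in [n]; rounding
   costs one factor [x], kept at least 1/2 by its definition. *)
pose q := x `^ (D%:R^-1).
have q0 : 0 < q by exact: powR_gt0.
have qD : q ^+ D = x.
  by rewrite -powR_mulrn ?(ltW q0)// -powRrM mulVf ?powRr1 ?(ltW x0)// pnatr_eq0 -lt0n.
have q1 : q < 1.
  rewrite ltNge; apply/negP => q1; move: x1; rewrite -qD ltNge => /negP; apply.
  exact: exprn_ege1.
have xq n : x ^+ (n %/ D) <= q ^+ n / x.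
  rewrite ler_pdivlMr// -[X in _ <= q ^+ X](subnK (leq_divM n D)) -{1}qD -exprM.
  rewrite [(D * _)%N]mulnC exprD mulrC ler_wpM2r ?exprn_ge0 ?(ltW q0)//.
  rewrite -qD; apply: ler_wiXn2l; rewrite ?(ltW q0) ?(ltW q1)//.
  by rewrite leq_subLR addnC -mulSn ltnW// ltn_ceil.
(* For [n < D] the quotient [n %/ D] is 0 and nothing would be cut off. *)
pose W n t := if (n < D)%N then 0 else
  \sum_(i < (n - n %/ D).+1) odds_prod omega i n.-1 t `^ s.
have Wge0 n t : 0 <= W n t.
  by rewrite /W; case: ifP => // _; apply: sumr_ge0 => i _; exact: powR_ge0.
have mop i n : measurable_fun setT (fun t => odds_prod omega i n t `^ s).
  by apply: measurable_powR_fun; exact: measurable_odds_prod.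
have cvgW : {ae P, forall t, W n t @[n --> \oo] --> 0}.
  apply: (@ae_cvg0 _ _ _ _ _ (geometric (x^-1 / x / (1 - x)) q)) => //.
  - move=> n; rewrite /W; case: (ltnP n D) => _; first exact: measurable_cst.
    by apply: measurable_sum => i; exact: mop.
  - move=> n; rewrite -[X in (X <= _)%E]/(mu (W n)) /W.
    have nn : 0 <= geometric (x^-1 / x / (1 - x)) q n.
      rewrite /geometric/=; apply: mulr_ge0; last by rewrite exprn_ge0// ltW.
      by rewrite !divr_ge0 ?invr_ge0 ?(ltW x0)// subr_ge0 ltW.
    case: (ltnP n D) => Dn; first by rewrite /mu mean_cst lee_fin.
    have n0 : (0 < n)%N by exact: leq_trans Dn.
    have nD : (0 < n %/ D)%N by rewrite divn_gt0.
    have nDn : (n %/ D <= n)%N by exact: leq_div.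
    have ie i : (i < (n - n %/ D).+1)%N -> (i <= n.-1)%N.
      by rewrite ltnS => /leq_trans; apply; rewrite -subn1 leq_sub2l.
    rewrite /mu mean_sum//; last by move=> i t; exact: powR_ge0.
    rewrite -/mu (eq_bigr (fun i : 'I__ => (r ^+ (n.-1 - i))%:E)); last first.
      move=> i _; rewrite EFin_expe -moments -(mean_odds_prod iid_omega omega01 s i).
      by rewrite subnKC// ie.
    rewrite sumEFin lee_fin.
    apply: (@le_trans _ _ (\sum_(i < (n - n %/ D).+1) x ^+ (n.-1 - i))).
      by apply: ler_sum => i _; rewrite lerXn2r ?nnegrE ?(ltW x0).
    apply: (le_trans (geometric_sum_le _ _)); first by rewrite (ltW x0).
      exact: ie.
    have -> : (n.-1 - (n - n %/ D) = (n %/ D).-1)%N.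
      by rewrite -(subn1 n) -subnDA addnC subnDA subKn// subn1.
    rewrite /geometric/= mulrAC ler_wpM2r ?invr_ge0 ?subr_ge0 ?(ltW x1)//.
    rewrite -mulrA ler_pdivlMl// -exprS prednK// mulrC; exact: xq.
  - by apply: is_cvg_geometric_series; rewrite ger0_norm// ltW.
apply: filterS cvgW => t Wt eps eps0.
(* The bound 1 puts every product in (0, 1], where it is at most its power of order [s <= 1]. *)
have e0 : 0 < Num.min eps 1 by rewrite lt_min eps0 ltr01.
move/cvgrPdist_lt : Wt => /(_ _ e0); apply: filterS2 (nbhs_infty_ge D) => n Dn.
have n0 : (0 < n)%N by exact: leq_trans Dn.
rewrite sub0r normrN ger0_norm// /W ltnNge Dn/= lt_min => /andP[We W1].
apply: (le_trans _ (ltW We)); apply: ler_sum => i _.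
have -> : tail_prod (env omega t) n i = odds_prod omega i n.-1 t by rewrite /odds_prod prednK.
have o0 := odds_prod_gt0 omega01 i n.-1 t.
have oW : odds_prod omega i n.-1 t `^ s <= 1.
  apply: le_trans (ltW W1); rewrite (bigD1 i)//= lerDl.
  by apply: sumr_ge0 => j _; exact: powR_ge0.
have o1 : odds_prod omega i n.-1 t <= 1.
  rewrite leNgt; apply/negP => o1; move: oW; rewrite leNgt => /negP; apply.
  rewrite -[X in X < _](congr1 (@^~ s) (@powR1 R)).
  by apply: gt0_ltr_powR; rewrite ?nnegrE// ltW.
by apply: ger1_powR => //; rewrite o0.
Qed.

End StationaryMass.

(** * Deep valleys *)

Section GeometricGrowth.
Variable R : realType.
Implicit Types x z : R.

Lemma powR_gt1 z x : 1 < z -> 0 < x -> 1 < z `^ x.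
Proof.
move=> z1 x0; rewrite -[X in X < _](powRr0 z) /powR gt_eqF ?(lt_trans ltr01 z1)//.
by rewrite ltr_expR ltr_pM2r// ln_gt0.
Qed.

Lemma powRX z a n : 0 <= z -> (z ^+ n) `^ a = (z `^ a) ^+ n.
Proof.
by move=> z0; rewrite -(powR_mulrn _ z0) -powRrM mulrC powRrM powR_mulrn// powR_ge0.
Qed.

Lemma bernoulli z n : 0 <= z -> 1 + n%:R * z <= (1 + z) ^+ n.
Proof.
move=> z0; elim: n => [|n IH]; first by rewrite mul0r addr0 expr0.
rewrite exprS mulrDl mul1r -natr1 mulrDl mul1r addrA.
apply: lerD; first exact: IH.
by rewrite ler_peMr// exprn_ege1// lerDl.
Qed.

Lemma expr_unbounded z x : 1 < z -> exists n, x < z ^+ n.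
Proof.
move=> z1; have z0 : 0 < z - 1 by rewrite subr_gt0.
exists (Num.truncn (`|x| / (z - 1))).+1.
have /bernoulli : 0 <= z - 1 by exact: ltW.
move=> /(_ (Num.truncn (`|x| / (z - 1))).+1); rewrite [1 + (z - 1)]addrC subrK; apply: lt_le_trans.
apply: (le_lt_trans (ler_norm x)); rewrite -ltrBlDl.
apply: (@lt_le_trans _ _ `|x|); first by rewrite ltrBlDr ltrDl.
by rewrite -ler_pdivrMr// ltW// truncnS_gt.
Qed.

Lemma expr_bracket z x : 1 < z -> 1 <= x -> exists n, z ^+ n <= x < z ^+ n.+1.
Proof.
move=> z1 x1; have ex := expr_unbounded x z1.
have := ex_minnP ex; case=> [[|n]] xn nmin.
  by move: xn; rewrite expr0 ltNge x1.
exists n; rewrite xn andbT leNgt; apply/negP => /nmin; by rewrite ltnn.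
Qed.

Lemma linear_geometric_bound z x : 1 < z ->
  exists N, forall n, (N <= n)%N -> x * n%:R <= z ^+ n.
Proof.
(* One factor [w ^+ n] absorbs the constant and the other one the linear term. *)
move=> z1; pose w := Num.sqrt z.
have z0 : 0 < z by exact: lt_trans z1.
have w1 : 1 < w by rewrite -sqrtr1 ltr_sqrt.
have [N hN] := expr_unbounded (x / (w - 1)) w1.
exists N => n Nn.
have -> : z = w * w by rewrite -expr2 sqr_sqrtr// ltW.
rewrite exprMn.
have h1 : x / (w - 1) <= w ^+ n.
  by apply: (le_trans (ltW hN)); rewrite ler_weXn2l// ltW.
have h2 : n%:R * (w - 1) <= w ^+ n.
  have /bernoulli : 0 <= w - 1 by rewrite subr_ge0 ltW.
  by move=> /(_ n); rewrite [1 + (w - 1)]addrC subrK; apply: le_trans; rewrite lerDr.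
have [x0|x0] := leP x 0.
  by apply: (@le_trans _ _ 0); [rewrite mulr_le0_ge0|rewrite mulr_ge0 ?exprn_ge0// sqrtr_ge0].
have -> : x * n%:R = x / (w - 1) * (n%:R * (w - 1)).
  by field; rewrite gt_eqF// subr_gt0.
apply: ler_pM => //; first by rewrite divr_ge0 ?(ltW x0)// subr_ge0 ltW.
by rewrite mulr_ge0// subr_ge0 ltW.
Qed.

Lemma expr_bernoulli_inv (p : R) N : 0 <= p <= 1 -> (1 - p) ^+ N * (1 + N%:R * p) <= 1.
Proof.
move=> /andP[p0 p1]; elim: N => [|N IH]; first by rewrite mul0r addr0 expr0 mul1r.
rewrite exprSr -mulrA; apply: le_trans IH; apply: ler_wpM2l.
  by rewrite exprn_ge0// subr_ge0.
have n0 : 0 <= N%:R :> R by [].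
rewrite -natr1; nra.
Qed.

End GeometricGrowth.

Section TailMoment.
Variables (R : realType) (d : measure_display) (T : measurableType d).
Variables (P : probability T R) (s k : R).
Hypothesis sk : 0 < s < k.

(* A tail of order [c^-k] bounds the moment of order [s < k], by dyadic slicing. *)
Lemma tail_moment : exists M : R, forall B : T -> R, (forall t, 0 <= B t) ->
  measurable_fun setT B ->
  (forall c, 1 < c -> (P [set t | (c <= B t)%R] <= (c `^ (- k))%:E)%E) ->
  (mean P (fun t => (B t `^ s)%R) <= M%:E)%E.
Proof.
have /andP[s0 sk'] := sk.
have two1 : (1 : R) < 2 by rewrite ltr1n.
pose x : R := 2 `^ (s - k).
have x0 : 0 < x by exact: powR_gt0.
have x1 : x < 1.
  by rewrite /x -opprB powRN invf_lt1 ?powR_gt0// powR_gt1// subr_gt0.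
have pow2 (n : nat) a : ((2 : R) ^+ n) `^ a = (2 `^ a) ^+ n.
  exact: powRX.
exists (1 + 2 `^ s / (1 - x)) => B B0 mB tail.
pose A n := [set t | 2 ^+ n <= B t].
have mA n : measurable (A n).
  have -> : A n = setT `&` B @^-1` `[2 ^+ n, +oo[.
    by rewrite setTI; apply/seteqP; split => t /=; rewrite in_itv/= andbT.
  exact: mB.
pose term n t : R := (2 ^+ n.+1) `^ s * \1_(A n) t.
have term0 n t : 0 <= term n t by rewrite mulr_ge0 ?powR_ge0.
have mterm n : measurable_fun setT (term n) by exact: measurable_funM.
have slice t : ((B t `^ s)%:E <= 1%:E + \sum_(0 <= n <oo) (term n t)%:E)%E.
  have ge0 : (0 <= \sum_(0 <= n <oo) (term n t)%:E)%E.
    by apply: nneseries_ge0 => n _ _; rewrite lee_fin.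
  have [B1|B1] := ltP (B t) 1.
    apply: (@le_trans _ _ 1%:E); last by rewrite leeDl.
    rewrite lee_fin -[X in _ <= X](congr1 (@^~ s) (@powR1 R)).
    by apply: ge0_ler_powR; rewrite ?nnegrE ?(ltW s0)// ltW.
  have [n /andP[nB Bn]] := expr_bracket two1 B1.
  apply: (@le_trans _ _ (\sum_(0 <= n <oo) (term n t)%:E)%E); last by rewrite leeDr.
  apply: le_trans (nneseries_lim_ge n.+1 _); last by move=> *; rewrite lee_fin.
  rewrite big_nat_recr//=; apply: (@le_trans _ _ (term n t)%:E); last first.
    by rewrite leeDr// sume_ge0// => i _; rewrite lee_fin.
  rewrite lee_fin /term indicE mem_set//= mulr1.
  by apply: ge0_ler_powR; rewrite ?nnegrE ?(ltW s0) ?exprn_ge0// ltW.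
apply: (@le_trans _ _ (\int[P]_t (1%:E + \sum_(0 <= n <oo) (term n t)%:E))%E).
  apply: ge0_le_integral => //.
  - by move=> t _; rewrite lee_fin powR_ge0.
  - by apply/measurable_EFinP; exact: measurable_powR_fun.
  - apply: emeasurable_funD => //; apply: ge0_emeasurable_sum => [n t _ _|n _].
      by rewrite lee_fin.
    exact/measurable_EFinP.
rewrite ge0_integralD//; last 2 first.
- by move=> t _; apply: nneseries_ge0 => n _ _; rewrite lee_fin.
- apply: ge0_emeasurable_sum => [n t _ _|n _]; first by rewrite lee_fin.
  exact/measurable_EFinP.
rewrite -/(mean P (fun=> 1)) mean_cst EFinD; apply: leeD => //.
rewrite integral_nneseries//; last 2 first.
- by move=> n; exact/measurable_EFinP.
- by move=> n t _; rewrite lee_fin.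
have cg : series (geometric (2 `^ s) x) n @[n --> \oo] --> 2 `^ s / (1 - x).
  by apply: cvg_geometric_series; rewrite ger0_norm ?(ltW x0).
have -> : (2 `^ s / (1 - x))%:E = (\sum_(0 <= n <oo) (geometric (2 `^ s) x n)%:E)%E.
  apply/esym/cvg_lim => //.
  rewrite (_ : (fun n => _) = fun n => (series (geometric (2 `^ s) x) n)%:E); last first.
    by apply/funext => n; rewrite sumEFin.
  by apply: cvg_EFin => //; exact: nearW.
apply: lee_nneseries => [n _ _|n _]; first by apply: integral_ge0 => t _; rewrite lee_fin.
rewrite -[leLHS]/(mean P (term n)) /term meanZ ?powR_ge0//.
rewrite /mean integral_indic// setIT pow2 exprS /geometric/=.
have PA : (P (A n) <= ((2 ^+ n) `^ (- k))%:E)%E.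
  case: n => [|n]; first by rewrite expr0 powR1 probability_le1.
  by apply: tail; rewrite exprn_egt1.
apply: (@le_trans _ _ ((2 `^ s * (2 `^ s) ^+ n)%:E * ((2 ^+ n) `^ (- k))%:E)%E).
  by rewrite lee_wpmul2l// lee_fin mulr_ge0 ?exprn_ge0 ?powR_ge0.
rewrite -EFinM lee_fin pow2 -mulrA -exprMn /x powRD ?pnatr_eq0 ?implybT//.
Qed.

End TailMoment.

(** * Steep blocks and their independent repetitions *)

Section DeepValleys.
Variables (R : realType) (d : measure_display) (T : measurableType d).
Variables (P : probability T R) (omega : int -> {RV P >-> R}).
Hypothesis iid_omega : iid omega.
Hypothesis omega01 : forall k t, 0 < omega k t < 1.

Let B := odds_prod omega.
Let B_gt0 a b t : 0 < B a b t. Proof. exact: odds_prod_gt0. Qed.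

Let ge_setE (f : T -> R) c : [set t | c <= f t] = f @^-1` `[c, +oo[.
Proof. by apply/seteqP; split => t /=; rewrite in_itv/= andbT. Qed.

Let lt_setE (f : T -> R) c : [set t | f t < c] = f @^-1` `]-oo, c[.
Proof. by apply/seteqP; split => t /=; rewrite in_itv/=. Qed.

Let prob_finite A : measurable A -> P A = (fine (P A))%:E.
Proof. by move=> mA; rewrite fineK//; exact: fin_num_measure. Qed.

Let between_disjoint a b c : between a b `&` between b c = set0.
Proof. by rewrite -subset0 => i [] /andP[_ ib] /andP[bi _]; move: ib; rewrite leNgt bi. Qed.

(** Otherwise all block products have tails of order c^(-k), so [tail_moment] bounds their moments
    of order [s] uniformly in the length [L], whereas these are powers of a number larger than 1, or
    infinite. *)
Lemma steep_block s k : 0 < s < k -> (1 < moment omega s)%E ->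
  exists L : nat, exists2 c : R, 1 < c &
    ((c `^ (- k))%:E <= P [set t | (c <= B 0 L t)%R])%E.
Proof.
move=> sk ms; apply: contrapT => no.
have [M hM] := tail_moment P sk.
have bounded L : (moment omega s ^+ L <= M%:E)%E.
  rewrite -(mean_odds_prod iid_omega omega01 s 0 L) add0n; apply: hM.
  - by move=> t; exact/ltW/B_gt0.
  - exact: measurable_odds_prod.
  - move=> c c1; rewrite leNgt; apply/negP => h; apply: no.
    by exists L, c => //; exact: ltW.
move: ms bounded; case: (moment omega s) => [r|_ /(_ 1%N)|//].
  rewrite lte_fin => r1 bounded; have [n hn] := expr_unbounded M r1.
  by have := bounded n; rewrite -EFin_expe lee_fin leNgt hn.
by rewrite -[X in (X ^+ _)%E]/(+oo%E).
Qed.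

Lemma steep_blocks L c q m b : 0 <= q ->
  (q%:E <= P [set t | (c <= B 0 L t)%R])%E -> 0 <= c ->
  ((q ^+ m)%:E <= P [set t | (c ^+ m <= B b (b + m * L) t)%R])%E.
Proof.
move=> q0 qP c0; elim: m b => [|m IH] b.
  rewrite mul0n addn0 !expr0 (_ : [set t | _] = setT) ?probability_setT//.
  by apply/seteqP; split => // t _; rewrite /B /odds_prod/= big_geq.
pose b' := (b + m * L)%N.
have -> : (b + m.+1 * L = b' + L)%N by rewrite mulSn addnA addnAC.
pose E1 := [set t | c ^+ m <= B b b' t].
pose E2 := [set t | c <= B b' (b' + L)%N t].
have kB x y : known omega (between x y) (B x y) by exact: known_odds_prod.
have h1 : <<s events_of omega (between b b') >> E1.
  by rewrite /E1 ge_setE; move/knownP : (kB b b'); apply; exact: measurable_itv.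
have h2 : <<s events_of omega (between b' (b' + L)%N) >> E2.
  by rewrite /E2 ge_setE; move/knownP : (kB b' (b' + L)%N); apply; exact: measurable_itv.
have m1 := gen_measurable h1; have m2 := gen_measurable h2.
apply: (@le_trans _ _ (P (E1 `&` E2))).
  rewrite (indep_events iid_omega (@between_disjoint b b' (b' + L)) h1 h2).
  have PE2 : P E2 = P [set t | c <= B 0 L t].
    by rewrite ge_setE /E2 ge_setE; apply: odds_prod_same_law => //; exact: measurable_itv.
  move: (IH b) qP; rewrite -/b' -/E1 -PE2 (prob_finite m1) (prob_finite m2).
  rewrite -EFinM !lee_fin exprSr => x1 x2; apply: ler_pM => //; exact: exprn_ge0.
apply: le_measure; rewrite ?inE.
- exact: measurableI.
- rewrite ge_setE -[X in measurable X]setTI; apply: measurable_odds_prod => //; exact: measurable_itv.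
- move=> t [t1 t2] /=; rewrite /B (@odds_prod_cat _ _ _ _ _ b b' (b' + L)%N) ?leq_addr//.
  by rewrite exprSr; apply: ler_pM => //; exact: exprn_ge0.
Qed.

Let shallow h M N := [set t | forall i, (i < N)%N -> B (i * M) (i.+1 * M) t < h].

Let shallowS h M N : shallow h M N.+1 =
  shallow h M N `&` [set t | B (N * M) (N.+1 * M) t < h].
Proof.
apply/seteqP; split => t /=.
  by move=> H; split => [i iN|]; apply: H => //; exact: ltnW.
by move=> [H1 H2] i; rewrite ltnS leq_eqVlt => /predU1P[->//|]; exact: H1.
Qed.

Let known_shallow h M N : <<s events_of omega (between 0 (N * M)) >> (shallow h M N).
Proof.
elim: N => [|N IH].
  rewrite (_ : shallow h M 0 = setT); last by apply/seteqP; split => // t _ i.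
  exact: (@measurableT _ (g_sigma_algebraType (events_of omega _))).
rewrite shallowS.
apply: (@measurableI _ (g_sigma_algebraType (events_of omega (between 0 (N.+1 * M))))).
  apply: sub_smallest2r IH => //; apply: events_ofS => i.
  by rewrite /between/= mulSn; lia.
have k : known omega (between 0 (N.+1 * M)) (B (N * M) (N.+1 * M)).
  apply: knownS (@known_odds_prod _ _ _ _ omega omega01 (N * M) (N.+1 * M)) => i.
  by rewrite /between/= => /andP[h1 ->]; rewrite andbT; apply: le_lt_trans h1.
by rewrite lt_setE; move/knownP : k; apply; exact: measurable_itv.
Qed.

Let prob_shallow h M N (p : R) : 0 <= p <= 1 ->
  (forall b, (p%:E <= P [set t | (h <= B b (b + M) t)%R])%E) ->
  (P (shallow h M N) <= ((1 - p) ^+ N)%:E)%E.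
Proof.
move=> /andP[p0 p1] hp; elim: N => [|N IH].
  by rewrite expr0 probability_le1//; exact: (gen_measurable (@known_shallow h M 0)).
have kB : known omega (between (N * M) (N.+1 * M)) (B (N * M) (N.+1 * M)).
  exact: known_odds_prod.
pose E := [set t | B (N * M) (N.+1 * M) t < h].
have hE : <<s events_of omega (between (N * M) (N.+1 * M)) >> E.
  by rewrite /E lt_setE; move/knownP : kB; apply; exact: measurable_itv.
have mE := gen_measurable hE; have mS := gen_measurable (@known_shallow h M N).
have PE : (P E <= (1 - p)%:E)%E.
  have -> : E = ~` [set t | h <= B (N * M) (N * M + M) t].
    by apply/seteqP; split => t; rewrite /E/= mulSn [(M + _)%N]addnC ltNge => /negP.
  have mC : measurable [set t | h <= B (N * M) (N * M + M) t].
    by rewrite ge_setE -[X in measurable X]setTI; apply: measurable_odds_prod => //; exact: measurable_itv.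
  rewrite probability_setC// EFinB; apply: leeB => //; exact: hp.
rewrite shallowS (indep_events iid_omega (@between_disjoint 0 _ _) (@known_shallow h M N) hE).
move: IH PE; rewrite (prob_finite mE) (prob_finite mS) -EFinM !lee_fin exprSr => x1 x2.
by apply: ler_pM => //; apply: fine_ge0; exact: measure_ge0.
Qed.

(** About c^(k2 m) independent blocks are tried, each steep with probability at least c^(-k m). By
    [expr_bernoulli_inv] all fail with probability at most c^(-(k2 - k) m), which is summable. *)
Lemma ae_deep_valley s k k2 : 0 < s < k -> k < k2 -> (1 < moment omega s)%E ->
  exists L : nat, exists2 c : R, 1 < c &
  {ae P, forall t, \forall m \near \oo, exists2 i,
    (i < (Num.truncn ((c `^ k2) ^+ m)).+1)%N &
    c ^+ m <= B (i * (m * L)) (i.+1 * (m * L)) t}.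
Proof.
move=> sk kk2 ms; have [L [c c1 cP]] := steep_block sk ms.
exists L, c => //.
have /andP[s0 /(lt_trans s0) k0] := sk.
have c0 : 0 < c by exact: lt_trans c1.
pose y := c `^ k2; pose q := c `^ (- k).
have q0 : 0 < q by exact: powR_gt0.
have q1 : q <= 1 by rewrite /q powRN invf_le1 ?powR_gt0// ltW// powR_gt1.
have y0 : 0 <= y by exact: powR_ge0.
have qy1 : 1 < q * y.
  by rewrite /q /y -powRD ?(gt_eqF c0) ?implybT// addrC powR_gt1// subr_gt0.
have qy0 : 0 < q * y by exact: lt_trans qy1.
pose N m := (Num.truncn (y ^+ m)).+1.
pose W m t : R := \1_(shallow (c ^+ m) (m * L) (N m)) t.
have mS m : measurable (shallow (c ^+ m) (m * L) (N m)).
  exact: (gen_measurable (@known_shallow _ _ _)).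
have cvgW : {ae P, forall t, W m t @[m --> \oo] --> 0}.
  apply: (@ae_cvg0 _ _ _ _ _ (geometric 1 (q * y)^-1)) => //.
  - by move=> m; exact: measurable_indic.
  - move=> m; rewrite integral_indic// setIT.
    have qm : 0 <= q ^+ m <= 1 by rewrite exprn_ge0 ?(ltW q0)// exprn_ile1 ?(ltW q0).
    apply: (le_trans (@prob_shallow _ _ _ (q ^+ m) qm _)).
      by move=> b; apply: steep_blocks => //; exact: ltW.
    rewrite lee_fin /geometric/= mul1r exprVn.
    have := expr_bernoulli_inv (N m) qm; rewrite -ler_pdivlMr; last first.
      have /andP[h _] := qm; by rewrite ltr_wpDr// mulr_ge0.
    move/le_trans; apply; rewrite mul1r lef_pV2 ?posrE ?exprn_gt0//; last first.
      have /andP[h _] := qm; by rewrite ltr_wpDr// mulr_ge0.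
    rewrite exprMn mulrC; apply: (@le_trans _ _ ((N m)%:R * q ^+ m)); last by rewrite lerDr.
    have /andP[h _] := qm; apply: ler_wpM2r => //; apply/ltW/truncnS_gt.
  - apply: is_cvg_geometric_series; rewrite ger0_norm ?invr_ge0 ?(ltW qy0)//.
    by rewrite invf_lt1.
apply: filterS cvgW => t /cvgrPdist_lt /(_ _ ltr01); apply: filterS => m.
rewrite sub0r normrN /W indicE.
case: (boolP (t \in _)) => [_|/negP]; first by rewrite normr1 ltxx.
rewrite inE/= => nS _; apply: contrapT => nex; apply: nS => i iN.
by rewrite ltNge; apply/negP => h; apply: nex; exists i.
Qed.

End DeepValleys.

(** * Deep valleys in the first half of the interval *)

Section ValleysInRange.
Variables (R : realType) (d : measure_display) (T : measurableType d).
Variables (P : probability T R) (omega : int -> {RV P >-> R}).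
Hypothesis iid_omega : iid omega.
Hypothesis omega01 : forall k t, 0 < omega k t < 1.

Lemma first_half a n : (0 < n)%N -> (2 * a <= n)%N -> (a < n)%N /\ (a <= n - n %/ 2)%N.
Proof. lia. Qed.

Lemma ae_valley_in_range s b : 0 < s -> 0 < b -> s * b < 1 -> (1 < moment omega s)%E ->
  {ae P, forall t, \forall n \near \oo, exists i j,
    [/\ (i <= j < n)%N, (j <= n - n %/ 2)%N & n%:R `^ b <= odds_prod omega i j t]}.
Proof.
move=> s0 b0 sb ms.
have sb' : s < b^-1 by rewrite -[b^-1]mul1r ltr_pdivlMr.
(* The orders [s < k < k2 < k3] below [b^-1] leave room for the tail bound, the number of trials,
   the block lengths and the depth respectively. *)
pose e := (b^-1 - s) / 4.
have e0 : 0 < e by rewrite /e; lra.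
pose k := s + e; pose k2 := s + 2 * e; pose k3 := s + 3 * e.
have k3b : k3 * b < 1 by rewrite -ltr_pdivlMr// mul1r /k3 /e; lra.
have sk : 0 < s < k by rewrite s0/= /k; lra.
have kk2 : k < k2 by rewrite /k /k2; lra.
have [L [c c1 valley]] := ae_deep_valley iid_omega omega01 sk kk2 ms.
have c0 : 0 < c by exact: lt_trans c1.
pose y := c `^ k2; pose z := c `^ e; pose Z := c `^ k3; pose x := c `^ (1 - k3 * b).
have y1 : 1 < y by apply: powR_gt1 => //; rewrite /k2; lra.
have Z1 : 1 < Z by apply: powR_gt1 => //; rewrite /k3; lra.
have z1 : 1 < z by exact: powR_gt1.
have x1 : 1 < x by apply: powR_gt1 => //; rewrite subr_gt0.
have Zzy : Z = z * y.
  rewrite /Z /z /y -powRD ?(gt_eqF c0) ?implybT//; congr (_ `^ _).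
  by rewrite /k3 /k2; ring.
have cx : c = Z `^ b * x.
  by rewrite /Z /x -powRrM -powRD ?(gt_eqF c0) ?implybT// addrC subrK powRr1// ltW.
have Zb1 : 1 < Z `^ b by exact: powR_gt1.
have [N1 hN1] := linear_geometric_bound (4 * L%:R) z1.
have [N2 hN2] := expr_unbounded (Z `^ b) x1.
apply: filterS valley => t [N3 _ hN3].
pose M := maxn N1 (maxn N2 N3).
exists (maxn 1 (Num.truncn (Z ^+ M)).+1) => // n /=.
rewrite geq_max => /andP[n0 nM].
have n1 : 1 <= n%:R :> R by rewrite ler1n.
(* The scale [m] belongs to [n] through [Z = c^k3], slightly larger than the growth rate [y] of the
   number of blocks. *)
have [m /andP[mn nm]] := expr_bracket Z1 n1.
have Mm : (M <= m)%N.
  rewrite leqNgt; apply/negP => mM.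
  have : n%:R < Z ^+ M.
    by apply: (lt_le_trans nm); rewrite ler_weXn2l// ltW.
  rewrite ltNge => /negP; apply; apply/ltW/(lt_le_trans (truncnS_gt _)).
  by rewrite ler_nat.
have {}Mm : [/\ (N1 <= m)%N, (N2 <= m)%N & (N3 <= m)%N].
  by move: Mm; rewrite /M !geq_max => /andP[? /andP[? ?]].
have [m1 m2 m3] := Mm.
have [i iN hi] := hN3 m m3.
exists (i * (m * L))%N, (i.+1 * (m * L))%N.
(* The blocks cover at most 2 y^m m L sites, and z^m absorbs [4 * L * m]. The factor 2 keeps the
   valley in the first half, where the stationary mass is small. *)
have range : (2 * (i.+1 * (m * L)) <= n)%N.
  rewrite -(ler_nat R); apply: le_trans mn.
  apply: (@le_trans _ _ ((4 * L%:R) * m%:R * y ^+ m)); last first.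
    by rewrite Zzy exprMn; apply: ler_wpM2r (hN1 _ m1); rewrite exprn_ge0// ltW// (lt_trans ltr01).
  have ym : 1 <= y ^+ m by rewrite exprn_ege1// ltW.
  have iy : i.+1%:R <= 2 * y ^+ m :> R.
    apply: (@le_trans _ _ ((Num.truncn (y ^+ m))%:R + 1)); first by rewrite natr1 ler_nat.
    have : (Num.truncn (y ^+ m))%:R <= y ^+ m by rewrite truncn_le (le_trans ler01).
    by lra.
  have -> : 4 * L%:R * m%:R * y ^+ m = 2 * ((2 * y ^+ m) * (m%:R * L%:R)) by ring.
  by rewrite !natrM ler_pM2l// ler_wpM2r// mulr_ge0.
split.
- by rewrite leq_mul2r leqnSn orbT/=; case: (first_half n0 range).
- by case: (first_half n0 range).
- apply: le_trans hi; rewrite [X in X ^+ _]cx exprMn.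
  (* Passing from [n] to [Z ^+ m.+1] costs one factor Z^b, which x^m covers. *)
  apply: (@le_trans _ _ ((Z ^+ m.+1) `^ b)).
    have Z0 : 0 <= Z by rewrite ltW// (lt_trans ltr01).
    by apply: ge0_ler_powR; rewrite ?nnegrE ?exprn_ge0 ?(ltW b0) ?(ltW nm).
  rewrite powRX ?(ltW (lt_trans ltr01 Z1))// exprSr.
  apply: ler_wpM2l; first by rewrite exprn_ge0// powR_ge0.
  by apply: (le_trans (ltW hN2)); rewrite ler_weXn2l// ltW.
Qed.

End ValleysInRange.

(** * Asymptotics of the mixing time *)

Section LazyWalkLaw.
Variables (R : realType) (w : int -> R) (n : nat).
Hypothesis n_gt0 : (0 < n)%N.
Variables (d : measure_display) (T : measurableType d).
Variables (Q : 'I_n.+1 -> probability T R) (Y : nat -> T -> 'I_n.+1).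

Lemma law_lazy_walk :
  (forall z, markov_chain (Q z) (lazy_reflected_kernel w (n := n)) z Y) ->
  forall l (x y : 'I_n.+1),
    law (Q x) (Y l) y = iter l (step w n) (fun k => (k == y)%:R) x.
Proof.
move=> mcY l x y; rewrite (law_markov_chain (mcY x)).
elim: l x => [//|l IH] x.
rewrite iterS -(sum_lazy_reflected_kernel w n_gt0).
by apply: eq_bigr => j _; congr (_ * _); exact: IH.
Qed.

End LazyWalkLaw.

(** * Almost sure bounds on the mixing time *)

Section MixingTime.
Variables (R : realType) (d : measure_display) (T : measurableType d).
Variables (P : probability T R) (omega : int -> {RV P >-> R}).
Hypothesis iid_omega : iid omega.
Hypothesis omega01 : forall k t, 0 < omega k t < 1.
Variables (dY : measure_display) (TY : nat -> measurableType dY).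
Variables (PY : T -> forall n : nat, 'I_n.+1 -> probability (TY n) R).
Variable Y : forall n : nat, nat -> TY n -> 'I_n.+1.
Hypothesis mcY : forall t n z, (0 < n)%N ->
  markov_chain (@PY t n z) (lazy_reflected_kernel (env omega t) (n := n)) z (@Y n).

Let w t := env omega t.
Let tmix (t : T) (n : nat) : nat :=
  mixing_time (lazy_reflected_kernel (w t) (n := n)) (@PY t n) (@Y n).

Let w01 t k : 0 < w t k < 1. Proof. exact: omega01. Qed.

Let lawE t n : (0 < n)%N -> forall l (x y : 'I_n.+1),
  law (@PY t n x) (@Y n l) y = iter l (step (w t) n) (fun k => (k == y)%:R) x.
Proof. by move=> n0; apply: law_lazy_walk => // z; exact: mcY. Qed.

Lemma ae_stat_small s r D : 0 < s <= 1 -> moment omega s = r%:E -> r < 1 -> (0 < D)%N ->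
  {ae P, forall t, \forall n \near \oo,
    \sum_(y < (n - n %/ D).+1) stat (w t) n y <= 1 / 4}.
Proof.
move=> s01 ms r1 D0.
have := ae_stationary_mass iid_omega omega01 s01 ms r1 D0.
apply: filterS => t /(_ (1 / 8)) /(_ ltac:(by rewrite divr_gt0)).
apply: filterS2 (nbhs_infty_ge D) => n Dn mass.
have n0 : (0 < n)%N by exact: leq_trans Dn.
have nD : (n - n %/ D < n)%N.
  by rewrite ltn_subrL divn_gt0// Dn.
apply: (le_trans (stat_mass (w01 t) n0 nD)).
by rewrite /w; lra.
Qed.

Lemma ae_mixing_le_power s r b : 0 < s <= 1 -> moment omega s = r%:E -> r < 1 -> 1 < b * s ->
  {ae P, forall t, \forall n \near \oo, (tmix t n)%:R <= n%:R `^ b}.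
Proof.
move=> s01 ms r1 bs.
(* With [b >= 1] and [n >= 2] the additive 1 of [tmix_le_mean] is at most half of n^b; the tolerance
   1/8 gives the other half. *)
have b1 : 1 <= b.
  have /andP[s0 s1] := s01; rewrite leNgt; apply/negP => b1; nra.
have := ae_mean_to_growth iid_omega omega01 s01 ms r1 bs.
apply: filterS => t /(_ (1 / 8)) /(_ ltac:(by rewrite divr_gt0)).
apply: filterS2 (nbhs_infty_ge 2) => n n2 grow.
have n0 : (0 < n)%N by exact: leq_trans n2.
apply: (le_trans (tmix_le_mean (w01 t) n0 (@lawE t n n0))).
have : n%:R `^ 1 <= n%:R `^ b :> R by apply: ler_powR => //; rewrite ler1n.
rewrite powRr1//.
have : 2 <= n%:R :> R by rewrite (ler_nat _ 2).
by move: grow; rewrite -/(w t); lra.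
Qed.

Lemma ae_mixing_ge_power s r a b : 0 < s <= 1 -> moment omega s = r%:E -> r < 1 ->
  0 < a -> 0 < b -> a * b < 1 -> (1 < moment omega a)%E ->
  {ae P, forall t, \forall n \near \oo, n%:R `^ b <= (tmix t n)%:R}.
Proof.
move=> s01 ms r1 a0 b0 ab ma.
have valley := ae_valley_in_range iid_omega omega01 a0 b0 ab ma.
apply: filterS2 valley (ae_stat_small s01 ms r1 (erefl : (0 < 2)%N)) => t valley small.
apply: filterS3 valley small (nbhs_infty_gt 0%N) => n [i [j [ijn jn deep]]] small n0.
apply: (tmix_ge_valley (w01 t) n0 (@lawE t n n0) _ ijn) => //.
  by rewrite powR_gt0// ltr0n.
apply: le_trans small.
rewrite -(big_mkord xpredT) -[leRHS](big_mkord xpredT (fun y => stat (w t) n y)).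
rewrite [leRHS](@big_cat_nat _ _ _ j.+1)//= lerDl.
by apply: sumr_ge0 => y _; apply: stat_ge0.
Qed.

Lemma cvg_ln_ratio (u : nat -> nat) (kappa : R) : 0 < kappa ->
  (forall b, kappa^-1 < b -> \forall n \near \oo, (u n)%:R <= n%:R `^ b) ->
  (forall b, 0 < b < kappa^-1 -> \forall n \near \oo, n%:R `^ b <= (u n)%:R) ->
  ln (u n)%:R / ln n%:R @[n --> \oo] --> kappa^-1.
Proof.
move=> k0 hi lo; have ki0 : 0 < kappa^-1 by rewrite invr_gt0.
apply/cvgrPdist_le => eps eps0.
pose e := Num.min eps (kappa^-1 / 2).
have e0 : 0 < e by rewrite lt_min eps0/= divr_gt0.
have ee : e <= eps by rewrite ge_min lexx.
have ek : e <= kappa^-1 / 2 by rewrite ge_min lexx orbT.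
have hi' := hi (kappa^-1 + e) ltac:(lra).
have lo' := lo (kappa^-1 - e) ltac:(lra).
apply: filterS3 hi' lo' (nbhs_infty_gt 1) => n hi' lo' n1.
have ln0 : 0 < ln n%:R :> R by rewrite ln_gt0// ltr1n.
have n0 : 0 < n%:R :> R by rewrite ltr0n ltnW.
have u0 : 0 < (u n)%:R :> R by apply: lt_le_trans lo'; exact: powR_gt0.
have h1 : ln (u n)%:R <= (kappa^-1 + e) * ln n%:R.
  by rewrite -ln_powR ler_ln// posrE powR_gt0.
have h2 : (kappa^-1 - e) * ln n%:R <= ln (u n)%:R.
  by rewrite -ln_powR ler_ln// posrE powR_gt0.
rewrite distrC ler_distl; apply/andP; split.
  by rewrite ler_pdivlMr//; apply: le_trans h2; rewrite ler_pM2r//; lra.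
by rewrite ler_pdivrMr//; apply: (le_trans h1); rewrite ler_pM2r//; lra.
Qed.

Lemma near_truncated D (p : set nat) : (1 < D)%N ->
  (\forall n \near \oo, p n) -> \forall n \near \oo, p (n - n %/ D)%N.
Proof.
move=> D1 [N _ hN]; exists (2 * N)%N => // n /= Nn; apply: hN => /=.
have : (n %/ D <= n %/ 2)%N by exact: leq_div2l.
by move: (n %/ D)%N => a; lia.
Qed.

(** Above, Chebyshev shows that [n] is crossed shortly after its mean time. Below, the walk must
    first reach [k = n - n %/ D], above which most of the stationary mass lies, and Chebyshev
    excludes this much before the mean time. *)
Lemma cvg_mixing_linear t (v : R) : 0 <= v ->
  mean_to (w t) n 0 / n%:R @[n --> \oo] --> v ->
  (forall eps, 0 < eps -> \forall n \near \oo, var_to (w t) n 0 <= eps * n%:R `^ 2) ->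
  (forall D, (0 < D)%N -> \forall n \near \oo,
    \sum_(y < (n - n %/ D).+1) stat (w t) n y <= 1 / 4) ->
  (tmix t n)%:R / n%:R @[n --> \oo] --> v.
Proof.
move=> v0 lln vargrow mass.
have law_n (x : R) : 0 < x -> \forall n \near \oo,
    `|mean_to (w t) n 0 - v * n%:R| <= x * n%:R.
  move=> x0; move/cvgrPdist_le : lln => /(_ _ x0).
  apply: filterS2 (nbhs_infty_gt 0%N) => n n0.
  have n0' : 0 < n%:R :> R by rewrite ltr0n.
  rewrite distrC -[X in _ -> _ <= _ * X](gtr0_norm n0') -ler_pdivrMr ?normr_gt0 ?gt_eqF//.
  by rewrite -normf_div mulrBl mulfK// gt_eqF.
apply/cvgrPdist_le => eps eps0.
(* Three errors of size [x * n]: law of large numbers and Chebyshev margin on both sides, together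
   with the rounding of [l] above and the cut at [k] below. *)
have [x x0 xe] : exists2 x, 0 < x & eps = 3 * x.
  by exists (eps / 3); [rewrite divr_gt0|field].
(* [D >= v / x] makes the loss [v * (n %/ D)] at most [x * n]; the second successor ensures [1 < D],
   as [near_truncated] requires. *)
pose D := (Num.truncn (v / x)).+2.
have vD : v <= x * D%:R.
  rewrite -ler_pdivrMl// mulrC; apply: (le_trans (ltW (truncnS_gt _))).
  by rewrite ler_nat.
have var1 := vargrow (x ^+ 2 / 4) ltac:(by rewrite divr_gt0// exprn_gt0).
have upper : \forall n \near \oo, (tmix t n)%:R <= (v + eps) * n%:R.
  have l1 := law_n x x0.
  apply: filterS3 l1 var1 (nbhs_infty_gt (Num.truncn x^-1)) => n.
  rewrite powR_mulrn// ler_norml => /andP[_ l1] v1 nx.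
  have n0 : (0 < n)%N by exact: leq_ltn_trans nx.
  have xn : 1 <= x * n%:R.
    rewrite -ler_pdivrMl// mulr1; apply: (le_trans (ltW (truncnS_gt _))).
    by rewrite ler_nat.
  have vx0 : 0 <= (v + 2 * x) * n%:R by rewrite mulr_ge0// addr_ge0// mulr_ge0// ltW.
  pose l := (Num.truncn ((v + 2 * x) * n%:R)).+1.
  have l_lo : (v + 2 * x) * n%:R < l%:R by exact: truncnS_gt.
  have l_hi : l%:R <= (v + 2 * x) * n%:R + 1.
    by rewrite /l -natr1 lerD2r truncn_le.
  apply: (@le_trans _ _ l%:R).
    rewrite ler_nat; apply: (tmix_le_chebyshev (w01 t) n0 (@lawE t n n0)); first by nra.
    apply: (@le_trans _ _ ((x * n%:R) ^+ 2)).
      by rewrite exprMn; lra.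
    by rewrite lerXn2r ?nnegrE ?mulr_ge0 ?(ltW x0)//; nra.
  by apply: (le_trans l_hi); rewrite xe; lra.
have lower : \forall n \near \oo, (v - eps) * n%:R <= (tmix t n)%:R.
  have D1 : (1 < D)%N by [].
  have l1 := near_truncated D1 (law_n x x0).
  have v2 := near_truncated D1 var1.
  apply: filterS2 (nbhs_infty_gt 0%N) (filterI (mass D (ltnW D1)) (filterI l1 v2)) => n n0 [m1 [+ +]].
  have kn : (n - n %/ D <= n)%N by exact: leq_subr.
  set k := (n - n %/ D)%N in m1 kn *.
  rewrite powR_mulrn// ler_norml => /andP[l2 _] v3.
  have kn' : k%:R <= n%:R :> R by rewrite ler_nat.
  have k0 : 0 <= k%:R :> R by [].
  have vk : v * n%:R - x * n%:R <= v * k%:R.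
    rewrite /k natrB ?leq_div// mulrBr lerD2l lerN2.
    apply: (le_trans (ler_wpM2r _ vD)) => //; rewrite -mulrA ler_pM2l// -natrM ler_nat mulnC.
    exact: leq_divM.
  have xk : x * k%:R <= x * n%:R by rewrite ler_pM2l.
  have [tm|/ltW tm] := leP (tmix t n)%:R (mean_to (w t) k 0); last first.
    have xn0 : 0 <= x * n%:R by rewrite mulr_ge0// ltW.
    by apply: le_trans tm; rewrite mulrBl xe; lra.
  have := tmix_ge_chebyshev (w01 t) n0 (@lawE t n n0) kn _ tm.
  rewrite (le_trans _ m1); last by rewrite big_ord_recr/= lerDl stat_ge0.
  move=> /(_ isT) sq.
  have dev : mean_to (w t) k 0 - (tmix t n)%:R <= x * k%:R.
    rewrite -(@ler_pXn2r _ 2) ?nnegrE ?subr_ge0 ?mulr_ge0 ?(ltW x0)//.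
    apply: (le_trans sq); rewrite exprMn.
    have h : 0 <= x ^+ 2 * k%:R ^+ 2 by rewrite mulr_ge0 ?sqr_ge0.
    by move: v3 h; lra.
  by rewrite mulrBl xe; lra.
apply: filterS3 upper lower (nbhs_infty_gt 0%N) => n up lo n0.
have n0' : 0 < n%:R :> R by rewrite ltr0n.
by rewrite distrC ler_distl ler_pdivlMr// ler_pdivrMr// up lo.
Qed.

End MixingTime.

(** * The two regimes of the mixing time *)

Section Conclusion.
Variables (R : realType) (d : measure_display) (T : measurableType d).
Variables (P : probability T R) (omega : int -> {RV P >-> R}).
Hypothesis iid_omega : iid omega.
Hypothesis omega01 : forall k t, 0 < omega k t < 1.
Variables (dY : measure_display) (TY : nat -> measurableType dY).
Variables (PY : T -> forall n : nat, 'I_n.+1 -> probability (TY n) R).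
Variable Y : forall n : nat, nat -> TY n -> 'I_n.+1.
Hypothesis mcY : forall t n z, (0 < n)%N ->
  markov_chain (@PY t n z) (lazy_reflected_kernel (env omega t) (n := n)) z (@Y n).
Variable kappa : R.
Hypothesis moment_small : forall s, 0 < s < kappa ->
  exists2 r : R, moment omega s = r%:E & r < 1.

Let tmix (t : T) (n : nat) : nat :=
  mixing_time (lazy_reflected_kernel (env omega t) (n := n)) (@PY t n) (@Y n).

Lemma ae_mixing_linear : 1 < kappa -> exists2 r : R, moment omega 1 = r%:E /\ r < 1 &
  {ae P, forall t, (tmix t n)%:R / n%:R @[n --> \oo] --> 2 * ((1 + r) / (1 - r))}.
Proof.
move=> k1; have [r rE r1] := @moment_small 1 ltac:(by rewrite ltr01).
exists r => //.
(* Strictly between 1 and kappa and below 2, so that the moments of orders 1, [p] and [p / 2] are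
   all smaller than 1. *)
pose p := (1 + Num.min kappa 2) / 2.
have mk : 1 < Num.min kappa 2 by rewrite lt_min k1 ltr1n.
have mk' : Num.min kappa 2 <= kappa by rewrite ge_min lexx.
have mk2 : Num.min kappa 2 <= 2 by rewrite ge_min lexx orbT.
have p12 : 1 < p <= 2 by rewrite /p; lra.
have [rp rpE rp1] := @moment_small p ltac:(rewrite /p; lra).
have [rh rhE rh1] := @moment_small (p / 2) ltac:(rewrite /p; lra).
have r0 : 0 <= r by rewrite -lee_fin -rE; apply: mean_ge0 => t; exact: powR_ge0.
have lln := ae_mean_to_lln iid_omega omega01 p12 rE r1 rpE rp1.
have vg := ae_var_to_growth iid_omega omega01 p12 rpE rp1 rhE rh1.
have mass : {ae P, forall t, forall D, (0 < D)%N -> \forall n \near \oo,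
    \sum_(y < (n - n %/ D).+1) stat (env omega t) n y <= 1 / 4}.
  (* [D] depends on the tolerance in [cvg_mixing_linear]; a countable union of null sets covers all
     its values. *)
  apply/ae_foralln => D; have [->|D0] := posnP D; first exact: aeW.
  have h := ae_stat_small iid_omega omega01 (s := 1) _ rE r1 D0.
  by apply: filterS (h _) => //; rewrite ltr01 lexx.
apply: filterS3 lln vg mass => t h1 h2 h3.
apply: (cvg_mixing_linear omega01 mcY) => //; last by rewrite mulrA.
have r1' : 0 <= 1 - r by rewrite subr_ge0 ltW.
by rewrite mulr_ge0// divr_ge0// addr_ge0.
Qed.

Hypothesis kappa_gt0 : 0 < kappa.
Hypothesis moment_large : forall s, kappa < s -> (1 < moment omega s)%E.

Lemma ae_mixing_polynomial : kappa <= 1 ->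
  {ae P, forall t, ln (tmix t n)%:R / ln n%:R @[n --> \oo] --> kappa^-1}.
Proof.
move=> k1; have ki0 : 0 < kappa^-1 by rewrite invr_gt0.
have bk x : (x < kappa^-1) = (kappa * x < 1) by rewrite -[_^-1]mul1r ltr_pdivlMr// mulrC.
have kb x : (kappa^-1 < x) = (1 < x * kappa) by rewrite -[_^-1]mul1r ltr_pdivrMr.
(* Exponents are approximated along a sequence, so that the exceptional sets form a countable
   union. *)
pose e (m : nat) : R := m.+1%:R^-1.
have e0 m : 0 < e m by rewrite invr_gt0.
have small x : 0 < x -> exists m, e m < x.
  move=> x0; exists (Num.truncn x^-1).
  by rewrite /e invf_plt ?posrE//; exact: truncnS_gt.
have power_le (n : nat) (b b' : R) : (0 < n)%N -> b <= b' -> n%:R `^ b <= n%:R `^ b' :> R.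
  by move=> n0 bb'; apply: ler_powR => //; rewrite ler1n.
have upper : {ae P, forall t, forall m, \forall n \near \oo,
    (tmix t n)%:R <= n%:R `^ (kappa^-1 + e m) :> R}.
  apply/ae_foralln => m.
  pose b := kappa^-1 + e m; have b0 : 0 < b by rewrite addr_gt0.
  have bib : b^-1 < kappa by rewrite invf_plt ?posrE// ltrDl.
  (* The midpoint satisfies both [s < kappa] and [b * s > 1]; the midpoint [a] of the lower bound
     plays the symmetric role above kappa. *)
  pose s := (b^-1 + kappa) / 2.
  have s0 : 0 < s by rewrite divr_gt0// addr_gt0 ?invr_gt0.
  have sk : s < kappa by rewrite /s; lra.
  have bs : 1 < b * s by rewrite mulrC -ltr_pdivrMr// mul1r /s; lra.
  have [r rE r1] := @moment_small s ltac:(by rewrite s0).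
  by apply: (ae_mixing_le_power iid_omega omega01 mcY _ rE r1 bs); rewrite s0 (le_trans (ltW sk)).
have lower : {ae P, forall t, forall m, 0 < kappa^-1 - e m -> \forall n \near \oo,
    n%:R `^ (kappa^-1 - e m) <= (tmix t n)%:R :> R}.
  apply/ae_foralln => m.
  have [b0|b0] := ltP 0 (kappa^-1 - e m); last by exact: aeW.
  pose b := kappa^-1 - e m.
  have kb1 : kappa < b^-1 by rewrite invf_pgt ?posrE// /b ltrBlDr ltrDl.
  pose a := (b^-1 + kappa) / 2.
  have ka : kappa < a by rewrite /a; lra.
  have ab : a * b < 1 by rewrite -ltr_pdivlMr// mul1r /a; lra.
  have k2 : 0 < kappa / 2 by rewrite divr_gt0.
  (* Any order below kappa and at most 1 controls the stationary mass. *)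
  have [r rE r1] := @moment_small (kappa / 2) ltac:(by rewrite k2; lra).
  have h01 : 0 < kappa / 2 <= 1 by rewrite k2; lra.
  have h := ae_mixing_ge_power iid_omega omega01 mcY h01 rE r1
    (lt_trans kappa_gt0 ka) b0 ab (moment_large ka).
  by apply: filterS h => t + _.
apply: filterS2 upper lower => t hi lo; apply: cvg_ln_ratio => // b.
- rewrite -subr_gt0 => /small[m em]; apply: filterS2 (hi m) (nbhs_infty_gt 0%N) => n + n0.
  by move/le_trans; apply; apply: power_le => //; move: em; lra.
- move=> /andP[b0]; rewrite -subr_gt0 => /small[m em].
  have lom : 0 < kappa^-1 - e m by move: em; lra.
  apply: filterS2 (lo m lom) (nbhs_infty_gt 0%N) => n + n0.
  by apply: le_trans; apply: power_le => //; move: em; lra.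
Qed.

End Conclusion.

Theorem theorem1p6 (R : realType)
    (d : measure_display) (T : measurableType d) (P : probability T R)
    (omega : int -> {RV P >-> R})
    (dX : measure_display) (TX : measurableType dX)
    (PX : T -> probability TX R) (X : nat -> TX -> int)
    (dY : measure_display) (TY : nat -> measurableType dY)
    (PY : T -> forall n : nat, 'I_n.+1 -> probability (TY n) R)
    (Y : forall n : nat, nat -> TY n -> 'I_n.+1)
    (kappa : R) :
  let env (t : T) (k : int) : R := omega k t in
  let rho0 (t : T) : R := (1 - omega 0 t) / omega 0 t in
  let ET1 : \bar R :=
    (\int[P]_t \int[PX t]_s hitting_time R (fun l => X l s) 1%R)%E in
  let tmix (t : T) (n : nat) : nat :=
    mixing_time (lazy_reflected_kernel (env t) (n := n)) (PY t n) (Y n) in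
  iid omega ->
  (forall k t, 0 < omega k t < 1) ->
  (forall t, markov_chain (PX t) (walk_kernel (env t)) 0 X) ->
  (forall t n z, (0 < n)%N ->
     markov_chain (PY t n z) (lazy_reflected_kernel (env t) (n := n)) z (Y n)) ->
  ('E_P[fun t => ln (rho0 t)] < 0)%E ->
  unique (fun a : R =>
    [/\ 0 < a, ('E_P[fun t => (rho0 t `^ a)%R] = 1)%E &
        ('E_P[fun t => (rho0 t `^ a * Num.max (ln (rho0 t)) 0)%R] < +oo)%E])
    kappa ->
  {ae P, forall t,
    (0 < kappa <= 1 ->
       (ln (tmix t n)%:R / ln n%:R : R) @[n --> \oo] --> kappa^-1) /\
    (1 < kappa ->
       ((tmix t n)%:R / n%:R)%:E @[n --> \oo] --> (2%:E * ET1)%E)}.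
Proof.
move=> env rho0 ET1 tmix iid_omega omega01 mcX mcY _ kappa_unique.
have {}kappa_unique : unique (fun a : R => [/\ 0 < a, moment omega a = 1%E &
    (mean P (fun t => (rho omega 0 t `^ a * Num.max (ln (rho omega 0 t)) 0)%R) < +oo)%E]) kappa.
  by move: kappa_unique; rewrite unlock.
have small := moment_lt1 omega01 kappa_unique.
have large := moment_gt1 omega01 kappa_unique.
have kappa_gt0 : 0 < kappa by have [[]] := kappa_unique.
have [k1|k1] := leP kappa 1.
  have h := ae_mixing_polynomial iid_omega omega01 mcY small kappa_gt0 large k1.
  by apply: filterS h => t ht; split=> [_|]; [exact: ht|].
have [r [rE r1] h] := ae_mixing_linear iid_omega omega01 mcY small k1.
apply: filterS h => t ht; split=> [/andP[]//|_].
rewrite /ET1 (annealed_hitting_time iid_omega omega01 rE r1 mcX) -EFinM.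
by apply: cvg_EFin => //; exact: nearW.
Qed.
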